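(* Let $d$ be a positive integer, and let $F$ be a discrete distribution function on $\mathbb{R}^d$ of the form $$F(x)=\sum_{k\in\mathbb{N}:\ x_k\in(-\infty,x]} p_{x_k},\qquad x\in\mathbb{R}^d,$$ where $x_k\in\mathbb{R}^d$, $k\in\mathbb{N}$, are distinct, $p_{x_k}\geqslant 0$ for all $k\in\mathbb{N}$, and $\sum_{k=1}^\infty p_{x_k}=1$. Let $$f(t)=\int_{\mathbb{R}^d}e^{i\langle t,x\rangle}\,dF(x)=\sum_{k\in\mathbb{N}}p_{x_k}e^{i\langle t,x_k\rangle},\qquad t\in\mathbb{R}^d,$$ be its characteristic function. The following statements are equivalent: (a) $F$ is quasi-infinitely divisible; (b) $\inf_{t\in\mathbb{R}^d}|f(t)|>0$. If one of these conditions is satisfied (and hence both are), then $f$ admits the representation $$f(t)=\exp\Bigl\{i\langle t,\gamma\rangle+\sum_{u\in\langle X\rangle\setminus\{0\}}\lambda_u\bigl(e^{i\langle t,u\rangle}-1\bigr)\Bigr\},\qquad t\in\mathbb{R}^d,$$ where $X=\{x_k:\ p_{x_k}>0,\ k\in\mathbb{N}\}\neq\varnothing$, $\gamma\in\langle X\rangle$, $\lambda_u\in\mathbb{R}$ for all $u\in\langle X\rangle\setminus\{0\}$, and $\sum_{u\in\langle X\rangle\setminus\{0\}}|\lambda_u|<\infty$.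
   Context: $\mathbb{N}$ is the set of positive integers; $\langle t,x\rangle$ (two arguments) is the standard scalar product on $\mathbb{R}^d$; $0$ in $\langle X\rangle\setminus\{0\}$ is the zero vector of $\mathbb{R}^d$. For $x=(x^{(1)},\ldots,x^{(d)})\in\mathbb{R}^d$, $(-\infty,x]=(-\infty,x^{(1)}]\times\cdots\times(-\infty,x^{(d)}]$. A distribution function $G$ on $\mathbb{R}^d$ is infinitely divisible if for every positive integer $n$ there is a distribution function $G_n$ on $\mathbb{R}^d$ with $G=G_n^{*n}$ ($n$-fold convolution power). A distribution function $F$ on $\mathbb{R}^d$ is quasi-infinitely divisible if there exist infinitely divisible distribution functions $F_1,F_2$ on $\mathbb{R}^d$ such that $F_1=F*F_2$, where $*$ is convolution. For a set $Y$ of $d$-dimensional vectors, $\langle Y\rangle$ (one argument) denotes the product of the coordinatewise integer spans: $$\langle Y\rangle=\Bigl\{\sum_{k=1}^n z_k y_k^{(1)}:\ n\in\mathbb{N},\ z_k\in\mathbb{Z},\ y_k\in Y\Bigr\}\times\cdots\times\Bigl\{\sum_{k=1}^n z_k y_k^{(d)}:\ n\in\mathbb{N},\ z_k\in\mathbb{Z},\ y_k\in Y\Bigr\},$$ where $y_k=(y_k^{(1)},\ldots,y_k^{(d)})$; the choices of $n$, $z_k$, $y_k$ in different factors are independent. *)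

(* Defs.v *)
From HB Require Import structures.
From mathcomp Require Import all_boot all_order all_algebra.
From mathcomp Require Import complex.
From mathcomp Require Import all_classical all_reals all_analysis.
Import Order.TTheory GRing.Theory Num.Theory.
Import numFieldNormedType.Exports.

Set Implicit Arguments.
Unset Strict Implicit.
Unset Printing Implicit Defensive.

Local Open Scope classical_set_scope.
Local Open Scope complex_scope.
Local Open Scope ring_scope.

(* R^d is 'rV[R]_d. It receives the sigma-algebra generated by the d
   coordinate maps, i.e. the Borel sigma-algebra of R^d (same construction
   as the library's one on n.-tuple T). *)
Definition measure_rV_display : measure_display. Proof. exact: default_measure_display. Qed.

Section measurable_rV.
Variables (R : realType) (d : nat).

Let coords : 'I_d -> 'rV[R]_d -> R := fun j x => x ord0 j.

Let rV_set0 : g_sigma_preimage coords set0.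
Proof. exact: sigma_algebra0. Qed.

Let rV_setC A : g_sigma_preimage coords A -> g_sigma_preimage coords (~` A).
Proof. exact: sigma_algebraC. Qed.

Let rV_bigcup (A : (set 'rV[R]_d)^nat) :
  (forall i, g_sigma_preimage coords (A i)) ->
  g_sigma_preimage coords (\bigcup_i (A i)).
Proof. exact: sigma_algebra_bigcup. Qed.

HB.instance Definition _ := @isMeasurable.Build measure_rV_display
  'rV[R]_d (g_sigma_preimage coords) rV_set0 rV_setC rV_bigcup.

End measurable_rV.

Section distribution_functions.
Variables (R : realType) (d : nat).
Implicit Types (F G : 'rV[R]_d -> R) (P : probability 'rV[R]_d R).

(* The closed lower orthant (-oo, x]. *)
Definition orthant (x : 'rV[R]_d) : set 'rV[R]_d :=
  [set y : 'rV[R]_d | forall j, y ord0 j <= x ord0 j].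

Definition mcdf P : 'rV[R]_d -> R := fun x => fine (P (orthant x)).

Definition distribution_function F := exists P, F = mcdf P.

(* The probability measure dF whose distribution function is F (unique when
   it exists); the default value is irrelevant when F is a distribution
   function. *)
Definition law F : probability 'rV[R]_d R :=
  xget (dirac (0 : 'rV[R]_d) : probability 'rV[R]_d R) [set P | F = mcdf P].

Definition conv F G : 'rV[R]_d -> R :=
  fun x => \int[law G]_y F (x - y).

(* The value at n = 0 is the distribution function of the unit mass at 0. *)
Definition convn F (n : nat) : 'rV[R]_d -> R :=
  iterop n conv F (mcdf (dirac (0 : 'rV[R]_d) : probability 'rV[R]_d R)).

Definition infinitely_divisible G :=
  distribution_function G /\
  forall n : nat, (0 < n)%N ->
    exists Gn, distribution_function Gn /\ G = convn Gn n.

Definition quasi_infinitely_divisible F :=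
  distribution_function F /\
  exists F1 F2, [/\ infinitely_divisible F1, infinitely_divisible F2 &
                    F1 = conv F F2].

End distribution_functions.

Section complex_analysis.
Variable R : realType.

Definition cexp (z : R[i]) : R[i] :=
  (expR (complex.Re z))%:C * (cos (complex.Im z) +i* sin (complex.Im z)).

Definition cintegral d (T : measurableType d) (P : probability T R)
    (g : T -> R[i]) : R[i] :=
  (\int[P]_x complex.Re (g x)) +i* (\int[P]_x complex.Im (g x)).

(* Sum of an absolutely summable family, as the difference of the sums of its
   positive and negative parts. *)
Definition rsum (T : choiceType) (A : set T) (g : T -> R) : R :=
  fine (\esum_(u in A) (EFin \o g)^\+ u)%E -
  fine (\esum_(u in A) (EFin \o g)^\- u)%E.

Definition csum (T : choiceType) (A : set T) (g : T -> R[i]) : R[i] :=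
  rsum A (fun u => complex.Re (g u)) +i* rsum A (fun u => complex.Im (g u)).

End complex_analysis.

Section characteristic_function.
Variables (R : realType) (d : nat).

Definition dotp (t x : 'rV[R]_d) : R := \sum_(j < d) t ord0 j * x ord0 j.

Definition charfun (F : 'rV[R]_d -> R) (t : 'rV[R]_d) : R[i] :=
  cintegral (law F) (fun x => cexp ((dotp t x)*i)).

(* Integer combinations of the j-th coordinates of vectors of Y, with at
   least one term. *)
Definition coord_zspan (Y : set 'rV[R]_d) (j : 'I_d) : set R :=
  [set a | exists n (z : 'I_n.+1 -> int) (y : 'I_n.+1 -> 'rV[R]_d),
     (forall k, Y (y k)) /\ a = \sum_(k < n.+1) (z k)%:~R * y k ord0 j].

Definition zspan (Y : set 'rV[R]_d) : set 'rV[R]_d :=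
  [set u : 'rV[R]_d | forall j, coord_zspan Y j (u ord0 j)].

End characteristic_function.

(* Main.v *)
(* Write [f] for the characteristic function of [F]; it is an absolutely
   convergent series [sum_u p_u exp(i <t, u>)].

   (b) => (a) and the representation. If [|f| >= c > 0] then [1/f] is again such
   a series: the norms of the powers of [1 - |f|^2] are governed by their
   suprema, since the n-th power of a polynomial with [m] frequencies has only
   O(n^m) of them. Hence, for [h] such that the translate [f(. + h)] is close
   to [f] in norm, [log(f(. + h) / f)] is a series of norm at most 1. Adding
   up small steps gives a logarithm for every [h]; its coefficient at
   [u <> 0] is a cocycle in [h], so it is [c_u (exp(i <h, u>) - 1)] for some
   [c_u]. By almost periodicity these logarithms are bounded in norm uniformly
   in [h], and averaging over [h] yields [sum |c_u| < oo]. Dividing [f] by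
   [exp(sum c_u exp(i <t, u>))] leaves a series that is multiplicative in [t],
   thus a single character [exp(i <t, gamma>)]. The positive and negative
   parts of [c] define compound Poisson laws witnessing (a).

   (a) => (b). Put [l = ln |f1|^2] for an infinitely divisible [f1]. Applying
   [|g(t+h) + g(t-h) - 2 g(t)| <= 2 (1 - g(h))] to the n-th roots [g] of
   [|f1|^2] and letting n grow gives [|l(t+h) + l(t-h) - 2 l(t)| <= - 2 l(h)].
   So the second differences of [ln |f|^2] with step [h] are bounded in [t],
   and finitely many [h] suffice to bring any [t] to a point where
   [|f| >= 1/2]. *)
Require Import Defs.
From HB Require Import structures.
From mathcomp Require Import all_boot all_order all_algebra.
From mathcomp Require Import complex.
From mathcomp Require Import all_classical all_reals all_analysis.
From mathcomp Require Import measurable_realfun ring lra.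
Import Order.TTheory GRing.Theory Num.Theory.
Import numFieldNormedType.Exports.
Set Implicit Arguments.
Unset Strict Implicit.
Unset Printing Implicit Defensive.
Local Open Scope classical_set_scope.
Local Open Scope complex_scope.
Local Open Scope ring_scope.

(** * Complex numbers and the complex exponential *)

(** Two obstacles shape the proof. The frequencies need not lie in a lattice, so [f] is not periodic
    and there is no compact period to argue on; inverses and logarithms are obtained in norm, from
    power series whose convergence rests on counting frequencies. And [log f] itself is out of reach
    of the norm, since its linear term [i <t, gamma>] is unbounded. In [f(. + h) / f] that term
    becomes a constant, at frequency 0, which is why coefficients are compared at [u <> 0] and
    [gamma] is recovered only at the end.

    Series are encoded as functionals on bounded functions: products, translations and coefficients
    are then substitutions of a test function, and an identity between series is checked on
    characters. The subgroup [M] carrying the frequencies is kept throughout, as it places [gamma]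
    and the [lambda_u] in [<X>].

    For the converse, an infinitely divisible transform may tend to 0, so no lower bound on [f1] or
    [f2] alone can help. Bounds on second differences depend only on the step, and they survive in
    the difference of [ln |f1|^2] and [ln |f2|^2]. *)

Section complex_modulus.
Variable R : realType.
Local Notation C := R[i].
Local Notation nc := (@Normc.normc R).
Implicit Types (z w : C) (x y : R).

Lemma cReD z w : complex.Re (z + w) = complex.Re z + complex.Re w.
Proof. by case: z w => ? ? []. Qed.

Lemma cImD z w : complex.Im (z + w) = complex.Im z + complex.Im w.
Proof. by case: z w => ? ? []. Qed.

Lemma cReN z : complex.Re (- z) = - complex.Re z.
Proof. by case: z. Qed.

Lemma cImN z : complex.Im (- z) = - complex.Im z.
Proof. by case: z. Qed.

Lemma cReM z w : complex.Re (z * w) =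
  complex.Re z * complex.Re w - complex.Im z * complex.Im w.
Proof. by case: z w => ? ? []. Qed.

Lemma cImM z w : complex.Im (z * w) =
  complex.Re z * complex.Im w + complex.Im z * complex.Re w.
Proof. by case: z w => ? ? []. Qed.

Lemma cRe_sum I (s : seq I) (F : I -> C) :
  complex.Re (\sum_(i <- s) F i) = \sum_(i <- s) complex.Re (F i).
Proof. by elim/big_rec2: _ => // i y1 y2 _ <-; rewrite cReD. Qed.

Lemma cIm_sum I (s : seq I) (F : I -> C) :
  complex.Im (\sum_(i <- s) F i) = \sum_(i <- s) complex.Im (F i).
Proof. by elim/big_rec2: _ => // i y1 y2 _ <-; rewrite cImD. Qed.

Lemma complexP z w :
  complex.Re z = complex.Re w -> complex.Im z = complex.Im w -> z = w.
Proof. by case: z w => ? ? [? ?] /= -> ->. Qed.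

Lemma nc_ge0 z : 0 <= nc z.
Proof. by case: z => a b; rewrite /= sqrtr_ge0. Qed.

Lemma ncD z w : nc (z + w) <= nc z + nc w.
Proof. exact: (@le_normcD R z w). Qed.

Lemma ncN z : nc (- z) = nc z.
Proof. exact: (@normcN R z). Qed.

Lemma ncB z w : nc (z - w) <= nc z + nc w.
Proof. by rewrite -(ncN w) ncD. Qed.

Lemma ncC z w : nc (z - w) = nc (w - z).
Proof. by rewrite -ncN opprB. Qed.

Lemma nc0 : nc 0 = 0.
Proof. exact: Normc.normc0. Qed.

Lemma nc1 : nc 1 = 1.
Proof. exact: Normc.normc1. Qed.

Lemma ncM z w : nc (z * w) = nc z * nc w.
Proof. exact: Normc.normcM. Qed.

Lemma ncV z : nc z^-1 = (nc z)^-1.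
Proof. exact: Normc.normcV. Qed.

Lemma ncX z n : nc (z ^+ n) = nc z ^+ n.
Proof. by elim: n => [|n IH]; rewrite ?nc1// !exprS ncM IH. Qed.

Lemma nc_eq0 z : nc z = 0 -> z = 0.
Proof. exact: Normc.eq0_normc. Qed.

Lemma ncR x : nc x%:C = `|x|.
Proof. by rewrite /= expr0n/= addr0 sqrtr_sqr. Qed.

Lemma ncn n : nc n%:R = n%:R.
Proof.
rewrite -[n%:R](rmorph_nat (real_complex R)) ncR ger0_norm ?ler0n //.
Qed.

Lemma nc_Re z : `|complex.Re z| <= nc z.
Proof.
by case: z => a b /=; rewrite -sqrtr_sqr ler_wsqrtr// lerDl sqr_ge0.
Qed.

Lemma nc_Im z : `|complex.Im z| <= nc z.
Proof.
by case: z => a b /=; rewrite -sqrtr_sqr ler_wsqrtr// lerDr sqr_ge0.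
Qed.

Lemma nc_ReIm z : nc z <= `|complex.Re z| + `|complex.Im z|.
Proof.
have -> : z = (complex.Re z)%:C + 'i * (complex.Im z)%:C.
  by case: z => a b; apply: complexP; rewrite ?cReD ?cImD ?cReM ?cImM/=; ring.
rewrite (le_trans (ncD _ _))// ncM !ncR cReD cImD cReM cImM/=.
by rewrite !(mul0r, mulr0, mul1r, addr0, add0r, subr0) expr0n/= add0r expr1n sqrtr1 mul1r.
Qed.

Lemma nc_sqr z : nc z ^+ 2 = complex.Re z ^+ 2 + complex.Im z ^+ 2.
Proof. by case: z => a b /=; rewrite sqr_sqrtr// addr_ge0 ?sqr_ge0. Qed.

Lemma nc_sum I (s : seq I) (F : I -> C) :
  nc (\sum_(i <- s) F i) <= \sum_(i <- s) nc (F i).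
Proof.
elim/big_rec2: _ => [|i y1 y2 _ h]; first by rewrite nc0.
by rewrite (le_trans (ncD _ _))// lerD2l.
Qed.

Lemma nc_conj z : nc z^*%C = nc z.
Proof. by case: z => a b; rewrite /= sqrrN. Qed.

Lemma mul_conj z : z * z^*%C = (nc z ^+ 2)%:C.
Proof.
by rewrite nc_sqr; case: z => a b; apply: complexP; rewrite ?cReM ?cImM/=; ring.
Qed.

Lemma ncB_ge z w : nc z - nc w <= nc (z - w).
Proof. by rewrite lerBlDr -{1}(subrK w z) ncD. Qed.

Lemma nc_small_eq0 z : (forall e : R, 0 < e -> nc z <= e) -> z = 0.
Proof.
move=> h; apply: nc_eq0; apply/eqP; rewrite eq_le nc_ge0 andbT.
by apply/ler_addgt0Pr => e e0; rewrite add0r h.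
Qed.

End complex_modulus.

Section complex_exponential.
Variable R : realType.
Local Notation C := R[i].
Local Notation nc := (@Normc.normc R).
Implicit Types (z w : C) (x y : R).

Lemma cexpE z : cexp z =
  (expR (complex.Re z))%:C * (cos (complex.Im z) +i* sin (complex.Im z)).
Proof. by []. Qed.

Lemma cexpD z w : cexp (z + w) = cexp z * cexp w.
Proof.
rewrite /cexp cReD cImD expRD; apply: complexP; rewrite !(cReM, cImM)/= cosD ?sinD;
  by ring.
Qed.

Lemma cexp0 : cexp (0 : C) = 1.
Proof.
by rewrite /cexp/= expR0 cos0 sin0; apply: complexP; rewrite ?cReM ?cImM/=; ring.
Qed.

Lemma cexp_neq0 z : cexp z != 0.
Proof.
apply/eqP => h; have := cexpD z (- z).
by rewrite subrr cexp0 h mul0r => /eqP; rewrite oner_eq0.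
Qed.

Lemma cexpN z : cexp (- z) = (cexp z)^-1.
Proof.
apply: (mulfI (cexp_neq0 z)).
by rewrite -cexpD subrr cexp0 mulfV// cexp_neq0.
Qed.

Lemma cexpB z w : cexp (z - w) = cexp z / cexp w.
Proof. by rewrite cexpD cexpN. Qed.

Lemma cexpMn z n : cexp (z *+ n) = cexp z ^+ n.
Proof.
by elim: n => [|n IH]; rewrite ?mulr0n ?cexp0// mulrS cexpD IH exprS.
Qed.

Lemma nc_cexp z : nc (cexp z) = expR (complex.Re z).
Proof.
rewrite /cexp ncM ncR (ger0_norm (expR_ge0 _)).
by rewrite /= cos2Dsin2 sqrtr1 mulr1.
Qed.

Lemma cexp_conj z : (cexp z)^*%C = cexp z^*%C.
Proof.
by case: z => a b; rewrite /cexp/= cosN sinN; apply: complexP => /=; ring.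
Qed.

Lemma nc_cexpi x : nc (cexp (x *i)) = 1.
Proof. by rewrite nc_cexp/= expR0. Qed.

Lemma cexpiE x : cexp (x *i) = cos x +i* sin x.
Proof. by rewrite /cexp/= expR0; apply: complexP => /=; ring. Qed.

(** The bound 3 lies below [2 * pi] with room, since only [pi >= 2] is used: the half angle
    [|y| / 2] stays below [pi], so a zero of its sine forces [y = 0]. *)
Lemma cexp_eq1 z : cexp z = 1 -> nc z <= 3 -> z = 0.
Proof.
move=> ez z3; have /eqP := nc_cexp z; rewrite ez nc1 eq_sym -expR0.
move=> /eqP/expR_inj re0.
have := ez; rewrite (_ : z = (complex.Im z) *i); last first.
  by apply: complexP.
rewrite cexpiE => -[]; set y := complex.Im z => cy _.
suff -> : y = 0 by [].
have y3 : `|y| <= 3 by rewrite (le_trans (nc_Im z)).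
have pi2 := @pi_ge2 R.
have s0 : sin (`|y| / 2) = 0.
  apply/eqP; rewrite -sqrf_eq0 sin2cos2.
  have : cos (`|y| / 2 *+ 2) = 1.
    by rewrite -mulr_natr divfK ?pnatr_eq0// cos_norm.
  rewrite cos_mulr2n => h; apply/eqP; lra.
have := @sin_gt0_pi R (`|y| / 2); rewrite s0 ltxx => h.
apply/eqP; rewrite -normr_eq0; apply: contraT => y0; apply: h.
have : 0 < `|y| by rewrite lt_def y0 normr_ge0.
by move=> ?; apply/andP; split; lra.
Qed.

End complex_exponential.

(** * Derivatives along a real parameter; truncated exponential and logarithm *)

Section complex_derivative.
Variable R : realType.
Local Notation C := R[i].
Local Notation nc := (@Normc.normc R).
Implicit Types (z w : C) (x y : R) (f g : R -> C).

(** Every estimate below follows [s |-> g (s z)] for [s] in [[0, 1]], so componentwise real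
    derivatives take the place of holomorphy. *)
Definition cderiv f x z :=
  is_derive x 1 (fun y => complex.Re (f y)) (complex.Re z) /\
  is_derive x 1 (fun y => complex.Im (f y)) (complex.Im z).

Lemma cderiv_eq f x z w : cderiv f x z -> z = w -> cderiv f x w.
Proof. by move=> ? <-. Qed.

Lemma cderiv_cst z x : cderiv (fun=> z) x 0.
Proof. by split; exact: is_derive_cst. Qed.

Lemma cderiv_real x : cderiv (fun y => y%:C) x 1.
Proof. by split => /=; [exact: is_derive_id|exact: is_derive_cst]. Qed.

Lemma cderivD f g x z w :
  cderiv f x z -> cderiv g x w -> cderiv (fun y => f y + g y) x (z + w).
Proof.
move=> [f1 f2] [g1 g2]; split.
  rewrite cReD; rewrite (_ : (fun y => _) =
    (fun y => complex.Re (f y)) + (fun y => complex.Re (g y))).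
    exact: is_deriveD.
  by apply/funext => y; rewrite cReD.
rewrite cImD; rewrite (_ : (fun y => _) =
    (fun y => complex.Im (f y)) + (fun y => complex.Im (g y))).
  exact: is_deriveD.
by apply/funext => y; rewrite cImD.
Qed.

Lemma cderivM f g x z w : cderiv f x z -> cderiv g x w ->
  cderiv (fun y => f y * g y) x (z * g x + f x * w).
Proof.
move=> [f1 f2] [g1 g2]; split.
  rewrite (_ : (fun y => _) =
    (fun y => complex.Re (f y)) * (fun y => complex.Re (g y)) -
    (fun y => complex.Im (f y)) * (fun y => complex.Im (g y))).
    apply: is_derive_eq.
    by rewrite cReD !cReM /GRing.scale/=; ring.
  by apply/funext => y; rewrite cReM.
rewrite (_ : (fun y => _) =
    (fun y => complex.Re (f y)) * (fun y => complex.Im (g y)) +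
    (fun y => complex.Im (f y)) * (fun y => complex.Re (g y))).
  apply: is_derive_eq.
  by rewrite cImD !cImM /GRing.scale/=; ring.
by apply/funext => y; rewrite cImM.
Qed.

Lemma cderivX n x : cderiv (fun y => (y ^+ n)%:C) x (n%:R * x ^+ n.-1)%:C.
Proof.
elim: n => [|n IH].
  by apply: (cderiv_eq (cderiv_cst 1 x)); rewrite mul0r.
rewrite (_ : (fun y => _) = (fun y => y%:C * (y ^+ n)%:C)); last first.
  by apply/funext => y; rewrite exprS rmorphM.
apply: cderiv_eq (cderivM (cderiv_real x) IH) _.
rewrite mul1r -rmorphM -rmorphD /=; congr (_%:C).
by case: n {IH} => [|n]/=; rewrite ?mul0r ?mulr0 ?addr0 ?mul1r//
   exprS; ring.
Qed.

Lemma cderiv_sum n (F : nat -> R -> C) (dF : nat -> C) x :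
  (forall k, cderiv (F k) x (dF k)) ->
  cderiv (fun y => \sum_(k < n) F k y) x (\sum_(k < n) dF k).
Proof.
move=> h; elim: n => [|n IH].
  rewrite big_ord0 (_ : (fun y => _) = fun=> 0); first exact: cderiv_cst.
  by apply/funext => y; rewrite big_ord0.
rewrite big_ord_recr/= (_ : (fun y => _) =
  (fun y => \sum_(k < n) F k y + F n y)); first exact: cderivD.
by apply/funext => y; rewrite big_ord_recr.
Qed.

Lemma cderiv_cexp f x z :
  cderiv f x z -> cderiv (fun y => cexp (f y)) x (z * cexp (f x)).
Proof.
move=> [f1 f2].
have e1 : is_derive x 1 (fun y => expR (complex.Re (f y)))
   (expR (complex.Re (f x)) * complex.Re z).
  by apply: is_derive_eq (is_derive1_comp _ _) _ => //; rewrite mulrC.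
have e2 : is_derive x 1 (fun y => cos (complex.Im (f y)))
   (- sin (complex.Im (f x)) * complex.Im z).
  by apply: is_derive_eq (is_derive1_comp _ _) _ => //; rewrite mulrC.
have e3 : is_derive x 1 (fun y => sin (complex.Im (f y)))
   (cos (complex.Im (f x)) * complex.Im z).
  by apply: is_derive_eq (is_derive1_comp _ _) _ => //; rewrite mulrC.
have h : cderiv (fun y => (expR (complex.Re (f y)))%:C) x
   (expR (complex.Re (f x)) * complex.Re z)%:C.
  by split => //=; exact: is_derive_cst.
have k : cderiv (fun y => cos (complex.Im (f y)) +i* sin (complex.Im (f y))) x
   ((- sin (complex.Im (f x)) * complex.Im z) +i*
    (cos (complex.Im (f x)) * complex.Im z)).
  by split.
apply: cderiv_eq (cderivM h k) _.
by apply: complexP; rewrite cexpE !(cReM, cImM, cReD, cImD)/=; ring.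
Qed.

Lemma mean_value_le (f df : R -> R) (M : R) :
  (forall x, 0 <= x <= 1 -> is_derive x 1 f (df x)) ->
  (forall x, 0 <= x <= 1 -> `|df x| <= M) -> `|f 1 - f 0| <= M.
Proof.
move=> fd dM.
have h1 x : x \in `]0, 1[%R -> is_derive x 1 f (df x).
  by rewrite in_itv/= => /andP[c0 c1]; apply: fd; rewrite !ltW.
have h2 : {within `[0, 1], continuous f}.
  apply: derivable_within_continuous => c; rewrite in_itv/= => h.
  exact: (@ex_derive _ _ _ _ _ _ _ (fd c h)).
have [c c01 ->] := MVT_segment ler01 h1 h2.
by rewrite subr0 mulr1 dM//; move: c01; rewrite in_itv.
Qed.

(** There is no intermediate point common to both components; treating them separately costs the
    factor 2. *)
Lemma cmean_value_le f (df : R -> C) (M : R) :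
  (forall x, 0 <= x <= 1 -> cderiv f x (df x)) ->
  (forall x, 0 <= x <= 1 -> nc (df x) <= M) -> nc (f 1 - f 0) <= 2 * M.
Proof.
move=> fd dM; rewrite (le_trans (nc_ReIm _))// mulr_natl mulr2n.
rewrite cReD cReN cImD cImN lerD//.
  apply: (@mean_value_le (fun x => complex.Re (f x)) (fun x => complex.Re (df x))).
    by move=> x /fd[].
  by move=> x /dM; apply: le_trans; exact: nc_Re.
apply: (@mean_value_le (fun x => complex.Im (f x)) (fun x => complex.Im (df x))).
  by move=> x /fd[].
by move=> x /dM; apply: le_trans; exact: nc_Im.
Qed.

Lemma nc_cexpiB1 x : nc (cexp (x *i) - 1) <= 2 * `|x|.
Proof.
have h := @cmean_value_le (fun s => cexp (s%:C * x *i))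
  (fun s => x *i * cexp (s%:C * x *i)) `|x|.
move: h; rewrite mul1r mul0r cexp0; apply => s s01.
  apply: cderiv_cexp; apply: cderiv_eq.
    exact: cderivM (cderiv_real s) (cderiv_cst (x *i) s).
  by rewrite mulr0 addr0 mul1r.
rewrite ncM; have -> : s%:C * x *i = (s * x) *i.
  by apply: complexP; rewrite ?(cReM,cImM)/=; ring.
by rewrite nc_cexpi mulr1 /= expr0n/= add0r sqrtr_sqr.
Qed.

(* [exp (- s z)] times the truncated exponential series of [s z] has a
   derivative of size [|z|^(n+1) / n!]. *)
Lemma cexp_series_le z n :
  nc (\sum_(k < n.+1) z ^+ k / k`!%:R - cexp z) <=
  2 * (expR (nc z) * nc z * (nc z ^+ n / n`!%:R)) * expR (nc z).
Proof.
pose S (s : R) := \sum_(k < n.+1) (s ^+ k)%:C * (z ^+ k / k`!%:R).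
pose dS (s : R) := \sum_(k < n.+1) (k%:R * s ^+ k.-1)%:C * (z ^+ k / k`!%:R).
(* The truncated series satisfies [S' = z S] up to its last term, so in the derivative of
   [exp (- s z) * S s] everything else cancels. *)
have dSE s : dS s = z * (S s - (s ^+ n)%:C * (z ^+ n / n`!%:R)).
  rewrite /S big_ord_recr/= addrK /dS big_ord_recl/= mul0r mul0r add0r.
  rewrite mulr_sumr; apply: eq_bigr => i _.
  rewrite /bump/= add1n/= rmorphM/= factS natrM invfM exprS.
  rewrite rmorph_nat.
  have : (i.+1%:R : C) != 0 by rewrite pnatr_eq0.
  move: (i`!%:R^-1) (i.+1%:R) => a b; move => b0; field.
  by rewrite b0.
have Sd s : cderiv S s (dS s).
  apply: (@cderiv_sum _ (fun k s => (s ^+ k)%:C * (z ^+ k / k`!%:R))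
    (fun k => (k%:R * s ^+ k.-1)%:C * (z ^+ k / k`!%:R))) => k.
  apply: cderiv_eq; first exact: cderivM (cderivX k s) (cderiv_cst _ s).
  by rewrite mulr0 addr0.
have Ed (s : R) : cderiv (fun s => cexp (s%:C * - z)) s (- z * cexp (s%:C * - z)).
  apply: cderiv_cexp; apply: cderiv_eq.
    exact: cderivM (cderiv_real s) (cderiv_cst _ s).
  by rewrite mulr0 addr0 mul1r.
have := @cmean_value_le (fun s => cexp (s%:C * - z) * S s)
  (fun s => - z * cexp (s%:C * - z) * S s + cexp (s%:C * - z) * dS s)
  (expR (nc z) * nc z * (nc z ^+ n / n`!%:R)).
have -> : S 0 = 1.
  rewrite /S big_ord_recl/= expr0 fact0 invr1 expr0 !mulr1 big1 ?addr0// => i _.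
  by rewrite expr0n/= mul0r.
have -> : S 1 = \sum_(k < n.+1) z ^+ k / k`!%:R.
  by apply: eq_bigr => i _; rewrite expr1n mul1r.
rewrite mul0r cexp0 !mul1r => h.
have {h}h := h (fun s _ => cderivM (Ed s) (Sd s)).
set T := \sum_(k < _) _ in h *.
have -> : T - cexp z = (cexp (- z) * T - 1) * cexp z.
  by rewrite mulrBl mulrAC -cexpD addNr cexp0 mul1r mul1r.
rewrite ncM; apply: ler_pM; rewrite ?nc_ge0//; last first.
  rewrite nc_cexp ler_expR (le_trans (ler_norm _))// nc_Re//.
apply: h => s /andP[s0 s1]; rewrite dSE.
have -> : - z * cexp (s%:C * - z) * S s + cexp (s%:C * - z) *
    (z * (S s - (s ^+ n)%:C * (z ^+ n / n`!%:R))) =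
    - (cexp (s%:C * - z) * z * ((s ^+ n)%:C * (z ^+ n / n`!%:R))) by ring.
rewrite ncN ncM (ncM (cexp _)).
apply: ler_pM; rewrite ?mulr_ge0 ?nc_ge0//.
  apply: ler_wpM2r; rewrite ?nc_ge0// nc_cexp ler_expR cReM/= mul0r subr0.
  rewrite (le_trans (ler_norm _))// normrM (ger0_norm s0).
  apply: le_trans (ler_piMl _ s1) _; first exact: normr_ge0.
  by rewrite cReN normrN; exact: nc_Re.
rewrite 2!ncM ncR ger0_norm ?exprn_ge0// ncV ncn ncX.
by rewrite ler_piMl ?exprn_ile1// divr_ge0// exprn_ge0 ?nc_ge0.
Qed.

Lemma sum_half_powers n : \sum_(k < n) (1 / 2) ^+ k.+1 = 1 - (1 / 2) ^+ n :> R.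
Proof.
elim: n => [|n IH]; first by rewrite big_ord0 expr0 subrr.
by rewrite big_ord_recr/= IH exprS; field.
Qed.

Lemma nc_log_term z n : nc z <= 1 / 2 ->
  nc (\sum_(k < n) (-1) ^+ k * z ^+ k.+1 / k.+1%:R) <= 1.
Proof.
move=> z2; rewrite (le_trans (nc_sum _ _))//.
apply: (@le_trans _ _ (\sum_(k < n) (1 / 2) ^+ k.+1)).
  apply: ler_sum => k _; rewrite 2!ncM ncV ncn !ncX ncN nc1 expr1n mul1r.
  rewrite ler_pdivrMr ?ltr0n// -[leLHS]mulr1; apply: ler_pM => //.
  - by rewrite exprn_ge0 ?nc_ge0.
  - by apply: lerXn2r; rewrite ?nnegrE ?nc_ge0//; lra.
  - by rewrite ler1n.
by rewrite sum_half_powers lerBlDr lerDl exprn_ge0//; lra.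
Qed.

(* [exp (- log(1 + s z)) (1 + s z)], with the logarithm truncated, has a
   geometrically small derivative. *)
Lemma cexp_log_series_le z n : nc z <= 1 / 2 ->
  nc (cexp (- \sum_(k < n) (-1) ^+ k * z ^+ k.+1 / k.+1%:R) * (1 + z) - 1)
  <= 2 * (expR 1 * (1 / 2) ^+ n.+1).
Proof.
move=> z2.
pose S (s : R) := \sum_(k < n) (s ^+ k.+1)%:C * ((-1) ^+ k * z ^+ k.+1 / k.+1%:R).
pose dS (s : R) := \sum_(k < n) (s ^+ k)%:C * ((-1) ^+ k * z ^+ k.+1).
have Sd s : cderiv S s (dS s).
  apply: (@cderiv_eq _ _ (\sum_(k < n) (k.+1%:R * s ^+ k)%:C *
     ((-1) ^+ k * z ^+ k.+1 / k.+1%:R))).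
    apply: (@cderiv_sum _
      (fun k s => (s ^+ k.+1)%:C * ((-1) ^+ k * z ^+ k.+1 / k.+1%:R))
      (fun k => (k.+1%:R * s ^+ k)%:C * ((-1) ^+ k * z ^+ k.+1 / k.+1%:R))) => k.
    apply: cderiv_eq.
      exact: cderivM (cderivX k.+1 s) (cderiv_cst _ s).
    by rewrite mulr0 addr0.
  apply: eq_bigr => k _; rewrite rmorphM/= rmorph_nat.
  by field; rewrite addrC natr1 pnatr_eq0.
have Sz s : S s = \sum_(k < n) (-1) ^+ k * (s%:C * z) ^+ k.+1 / k.+1%:R.
  by apply: eq_bigr => k _; rewrite exprMn rmorphXn/=; ring.
(* [S'] is a finite geometric sum; multiplied by [1 + s z] it leaves [z] and a single remainder of
   order [n + 1]. *)
have dSE s : (1 + s%:C * z) * dS s = z * (1 - (- (s%:C * z)) ^+ n).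
  have -> : dS s = z * \sum_(k < n) (- (s%:C * z)) ^+ k.
    rewrite mulr_sumr; apply: eq_bigr => k _.
    by rewrite -[- (_ * z)]mulN1r !exprMn rmorphXn/= exprS; ring.
  rewrite mulrCA; congr (_ * _).
  elim: n {S dS Sd Sz} => [|n IH]; first by rewrite big_ord0 expr0 subrr mulr0.
  by rewrite big_ord_recr/= mulrDr IH exprS; ring.
have Ed s : cderiv (fun s => cexp (- S s)) s (- dS s * cexp (- S s)).
  apply: cderiv_cexp; rewrite (_ : (fun y => - S y) = (fun y => (-1) * S y)).
    apply: cderiv_eq; first exact: cderivM (cderiv_cst _ s) (Sd s).
    by rewrite mul0r add0r mulN1r.
  by apply/funext => y; rewrite mulN1r.
have Zd (s : R) : cderiv (fun s => 1 + s%:C * z) s z.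
  apply: cderiv_eq.
    apply: cderivD (cderiv_cst 1 s) _.
    exact: cderivM (cderiv_real s) (cderiv_cst z s).
  by rewrite add0r mul1r mulr0 addr0.
have := @cmean_value_le (fun s => cexp (- S s) * (1 + s%:C * z))
  (fun s => - dS s * cexp (- S s) * (1 + s%:C * z) + cexp (- S s) * z)
  (expR 1 * (1 / 2) ^+ n.+1).
have -> : S 0 = 0.
  by rewrite /S big1// => k _; rewrite expr0n/= mul0r.
rewrite oppr0 cexp0 !mul1r mul0r addr0 Sz !mul1r; apply => s s01.
  exact: cderivM.
have -> : - dS s * cexp (- S s) * (1 + s%:C * z) + cexp (- S s) * z =
  cexp (- S s) * (z * (- (s%:C * z)) ^+ n).
  have -> : - dS s * cexp (- S s) * (1 + s%:C * z) =
   - cexp (- S s) * ((1 + s%:C * z) * dS s) by ring.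
  by rewrite dSE; ring.
have sz : nc (s%:C * z) <= 1 / 2.
  move: s01 => /andP[s0 s1].
  by rewrite ncM ncR ger0_norm// (le_trans _ z2)// ler_piMl// nc_ge0.
rewrite ncM; apply: ler_pM; rewrite ?nc_ge0//.
  rewrite nc_cexp ler_expR (le_trans (ler_norm _))// (le_trans (nc_Re _))//.
  by rewrite ncN Sz; exact: nc_log_term.
rewrite ncM exprS; apply: ler_pM; rewrite ?nc_ge0//; first by lra.
rewrite ncX.
by apply: lerXn2r; rewrite ?nnegrE ?nc_ge0 ?ncN//; lra.
Qed.

End complex_derivative.

(** * Absolutely summable families *)

Section families.
Variables (R : realType) (T : choiceType).
Local Notation C := R[i].
Local Notation nc := (@Normc.normc R).
Implicit Types (A : set T) (D : seq T) (N : T -> R).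

Definition nnsummable A N :=
  (forall k, A k -> 0 <= N k) /\ (\esum_(k in A) (N k)%:E < +oo)%E.

Lemma sum_le_esum A N D : uniq D -> {subset D <= A} ->
  ((\sum_(k <- D) N k)%:E <= \esum_(k in A) (N k)%:E)%E.
Proof.
move=> uD DA; apply: esum_ge; exists [set` D].
  by split => // k /DA; rewrite inE.
by rewrite -fsbig_seq// sumEFin.
Qed.

Lemma esum_le_seq A N (M : R) :
  (forall D, uniq D -> {subset D <= A} -> \sum_(k <- D) N k <= M) ->
  (\esum_(k in A) (N k)%:E <= M%:E)%E.
Proof.
move=> h; apply: ge_ereal_sup => /= _ [X [finX XA]] <-.
rewrite fsbig_finite//= sumEFin lee_fin; apply: h => // k.
by rewrite in_fset_set// => /set_mem /XA /mem_set.
Qed.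

Lemma esumE_seq A N D : (forall k, A k -> 0 <= N k) ->
  uniq D -> {subset D <= A} -> (\esum_(k in A) (N k)%:E =
  (\sum_(k <- D) N k)%:E + \esum_(k in A `&` ~` [set` D]) (N k)%:E)%E.
Proof.
move=> N0 uD DA; rewrite (@esumID _ _ [set` D]); last by move=> i /N0; rewrite lee_fin.
congr (_ + _)%E; have -> : A `&` [set` D] = [set` D].
  by apply/seteqP; split => k /=; [case|move=> kD; split => //; apply: set_mem; exact: DA].
rewrite esum_fset//; first by rewrite -fsbig_seq// sumEFin.
by move=> k kD; rewrite lee_fin N0//; move: kD => /set_mem/=/DA/set_mem.
Qed.

Lemma nnsummable_tail A N (e : R) : nnsummable A N -> 0 < e ->
  exists D, [/\ uniq D, {subset D <= A} & forall D', uniq D' ->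
    {subset D' <= A} -> {subset D <= D'} ->
    (\esum_(k in A `&` ~` [set` D']) (N k)%:E <= e%:E)%E].
Proof.
move=> [N0 Noo] e0.
have fin : (\esum_(k in A) (N k)%:E)%E \is a fin_num.
  by rewrite ge0_fin_numE// esum_ge0// => k /N0; rewrite lee_fin.
have [D uD [DA De]] : exists2 D, uniq D & {subset D <= A} /\
   (\esum_(k in A) (N k)%:E - e%:E <= (\sum_(k <- D) N k)%:E)%E.
  have [_ [X [finX XA] <-] h] := ub_ereal_sup_adherent e0 fin.
  exists (finmap.enum_fset (fset_set X)); first exact: finmap.fset_uniq.
  split; last by move: h; rewrite fsbig_finite//= sumEFin => /ltW.
  by move=> k; rewrite in_fset_set// => /set_mem /XA /mem_set.
exists D; split => // D' uD' D'A DD'.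
have sDD' : \sum_(k <- D) N k <= \sum_(k <- D') N k.
  have /(perm_big _) -> /= : perm_eq D' (D ++ [seq k <- D' | k \notin D]).
    apply: uniq_perm => //.
      rewrite cat_uniq uD filter_uniq// andbT/=; apply/hasPn => k.
      by rewrite mem_filter => /andP[].
    move=> k; rewrite mem_cat mem_filter; case: (boolP (k \in D)) => //=.
    by move=> /DD' ->.
  rewrite big_cat/= lerDl big_filter big_seq_cond sumr_ge0// => k.
  by rewrite andbC => /andP[_ /D'A /set_mem]; exact: N0.
move: De fin; rewrite (esumE_seq N0 uD' D'A).
case: (\esum_(k in A `&` ~` [set` D']) (N k)%:E)%E => [r||] //=.
by rewrite -?EFinD -?EFinB !lee_fin => h _; lra.
Qed.

Lemma rsum_le A N D (e B : R) (g : T -> R) : nnsummable A N -> 0 <= B ->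
  uniq D -> {subset D <= A} ->
  (\esum_(k in A `&` ~` [set` D]) (N k)%:E <= e%:E)%E ->
  (forall k, A k -> `|g k| <= N k * B) ->
  `|rsum A g - \sum_(k <- D) g k| <= e * B.
Proof.
move=> [N0 Noo] B0 uD DA De gN.
(* The tails of the positive and of the negative part both lie in [[0, e * B]], so their difference
   costs no factor 2. *)
have aux (g' : T -> R) : (forall k, 0 <= g' k) ->
    (forall k, A k -> g' k <= N k * B) ->
    exists2 r, 0 <= r <= e * B & (\esum_(k in A) (g' k)%:E =
     (\sum_(k <- D) g' k + r)%:E)%E.
  move=> g0 gle; rewrite (esumE_seq _ uD DA)//.
  have := esum_ge0 (S := A `&` ~` [set` D]) (a := fun k => (g' k)%:E).
  have : (\esum_(k in A `&` ~` [set` D]) (g' k)%:E <= (e * B)%:E)%E.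
    apply: esum_le_seq => E uE EA.
    apply: (@le_trans _ _ ((\sum_(k <- E) N k) * B)).
      rewrite mulr_suml big_seq [leRHS]big_seq; apply: ler_sum => k kE.
      by apply: gle; have := EA _ kE; rewrite inE => -[].
    apply: ler_wpM2r => //; rewrite -lee_fin; apply: le_trans De.
    exact: sum_le_esum.
  case: (\esum_(k in A `&` ~` [set` D]) (g' k)%:E)%E => [r||] //=.
  + rewrite !lee_fin => re r0; exists r => //; rewrite re andbT.
    by apply: r0 => k _; rewrite lee_fin.
  + by move=> _ h; exfalso; have := h (fun k _ => g0 k).
have [r1 r1e E1] := aux (fun k => Num.max (g k) 0) (fun k => ltac:(by rewrite le_max lexx orbT))
  (fun k Ak => ltac:(by rewrite (le_trans _ (gN _ Ak))// ge_max normr_ge0 ler_norm)).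
have [r2 r2e E2] := aux (fun k => Num.max (- g k) 0) (fun k => ltac:(by rewrite le_max lexx orbT))
  (fun k Ak => ltac:(by rewrite (le_trans _ (gN _ Ak))// ge_max normr_ge0 -normrN ler_norm)).
have -> : rsum A g = (\sum_(k <- D) Num.max (g k) 0 + r1) -
   (\sum_(k <- D) Num.max (- g k) 0 + r2).
  have P1 : (\esum_(u in A) ((EFin \o g)^\+ u) = \esum_(k in A) (Num.max (g k) 0)%:E)%E.
    by apply: eq_esum => k _; rewrite funeposE/= EFin_max.
  have P2 : (\esum_(u in A) ((EFin \o g)^\- u) = \esum_(k in A) (Num.max (- g k) 0)%:E)%E.
    by apply: eq_esum => k _; rewrite funenegE/= EFin_max.
  by rewrite /rsum P1 P2 E1 E2.
have -> : \sum_(k <- D) g k = \sum_(k <- D) Num.max (g k) 0 - \sum_(k <- D) Num.max (- g k) 0.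
  rewrite -sumrB; apply: eq_bigr => k _; rewrite /Num.max.
  by case: ltP => h1; case: ltP => h2; lra.
by rewrite ler_norml; apply/andP; split; lra.
Qed.

(** The finite set [D] depends on the majorant [N] only and serves all dominated [g] at once; this
    uniformity makes a sum of functionals a norm limit of finite sums in [apx_csum]. *)
Lemma csum_approx A N (e : R) : nnsummable A N -> 0 < e ->
  exists D, [/\ uniq D, {subset D <= A} & forall D', uniq D' ->
    {subset D' <= A} -> {subset D <= D'} -> forall (g : T -> C) (B : R),
    0 <= B -> (forall k, A k -> nc (g k) <= N k * B) ->
    nc (csum A g - \sum_(k <- D') g k) <= e * B].
Proof.
move=> NS e0; have e2 : 0 < e / 2 by rewrite divr_gt0.
have [D [uD DA h]] := nnsummable_tail NS e2.
exists D; split => // D' uD' D'A DD' g B B0 gN.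
have tl := h _ uD' D'A DD'.
rewrite (le_trans (nc_ReIm _))// cReD cReN cImD cImN cRe_sum cIm_sum.
have -> : e * B = e / 2 * B + e / 2 * B by field.
apply: lerD; apply: (rsum_le NS) => // k /gN; apply: le_trans.
  exact: nc_Re.
exact: nc_Im.
Qed.

Lemma nnsummable_le_seq A N M : (forall k, A k -> 0 <= N k) ->
  (forall D, uniq D -> {subset D <= A} -> \sum_(k <- D) N k <= M) ->
  nnsummable A N.
Proof.
by move=> N0 h; split=> //; rewrite (le_lt_trans (esum_le_seq h))// ltry.
Qed.

Lemma nnsummable_bound A N : nnsummable A N ->
  exists M, 0 <= M /\ forall D, uniq D -> {subset D <= A} -> \sum_(k <- D) N k <= M.
Proof.
move=> [N0 Noo]; exists (fine (\esum_(k in A) (N k)%:E)%E).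
have E0 : (0 <= \esum_(k in A) (N k)%:E)%E.
  by apply: esum_ge0 => k /N0; rewrite lee_fin.
split; first exact: fine_ge0.
move=> D uD DA; rewrite -lee_fin fineK; first exact: sum_le_esum.
by rewrite ge0_fin_numE.
Qed.

Lemma csum_le A N M (g : T -> C) : nnsummable A N ->
  (forall D, uniq D -> {subset D <= A} -> \sum_(k <- D) N k <= M) ->
  (forall k, A k -> nc (g k) <= N k) -> nc (csum A g) <= M.
Proof.
move=> NS NM gN; apply/ler_addgt0Pl => e e0.
have [D [uD DA /(_ D uD DA (fun=> id) g 1 ler01)]] := csum_approx NS e0.
move=> /(_ (fun k Ak => ltac:(rewrite mulr1; exact: gN))) h.
rewrite -(subrK (\sum_(k <- D) g k) (csum A g)) (le_trans (ncD _ _))//.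
rewrite mulr1 in h; apply: lerD => //; apply: le_trans (NM _ uD DA).
rewrite (le_trans (nc_sum _ _))// big_seq [leRHS]big_seq.
by apply: ler_sum => k /DA /set_mem; exact: gN.
Qed.

(** Domination by [N] already gives unconditional convergence, so the value may be identified along
    any cofinal family of finite sets. *)
Lemma csum_unique A N (g : T -> C) (z : C) : nnsummable A N ->
  (forall k, A k -> nc (g k) <= N k) ->
  (forall e D, 0 < e -> uniq D -> {subset D <= A} -> exists D',
    [/\ uniq D', {subset D' <= A}, {subset D <= D'} &
        nc (z - \sum_(k <- D') g k) <= e]) ->
  csum A g = z.
Proof.
move=> NS gN h; apply/eqP; rewrite -subr_eq0; apply/eqP; apply: nc_small_eq0 => e e0.
have e2 : 0 < e / 2 by rewrite divr_gt0.
have [D [uD DA hD]] := csum_approx NS e2.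
have [D' [uD' D'A DD' zD']] := h _ _ e2 uD DA.
have := hD _ uD' D'A DD' g 1 ler01 (fun k Ak => ltac:(rewrite mulr1; exact: gN)).
rewrite mulr1 => k.
rewrite (_ : csum A g - z = (csum A g - \sum_(k <- D') g k) - (z - \sum_(k <- D') g k)).
  by rewrite (le_trans (ncB _ _))//; lra.
by ring.
Qed.

Lemma csumB A N1 N2 (g1 g2 : T -> C) : nnsummable A N1 -> nnsummable A N2 ->
  (forall k, A k -> nc (g1 k) <= N1 k) -> (forall k, A k -> nc (g2 k) <= N2 k) ->
  csum A (fun k => g1 k - g2 k) = csum A g1 - csum A g2.
Proof.
move=> S1 S2 h1 h2.
have [M1 [M10 HM1]] := nnsummable_bound S1.
have [M2 [M20 HM2]] := nnsummable_bound S2.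
apply: (@csum_unique A (fun k => N1 k + N2 k)).
- apply: (@nnsummable_le_seq _ _ (M1 + M2)) => [k Ak|D uD DA].
    by rewrite addr_ge0 ?(S1.1 _ Ak) ?(S2.1 _ Ak).
  by rewrite big_split/= lerD ?HM1 ?HM2.
- by move=> k Ak; rewrite (le_trans (ncB _ _))// lerD ?h1 ?h2.
move=> e D e0 uD DA; have e2 : 0 < e / 2 by rewrite divr_gt0.
have [D1 [uD1 D1A hD1]] := csum_approx S1 e2.
have [D2 [uD2 D2A hD2]] := csum_approx S2 e2.
exists (undup (D ++ D1 ++ D2)).
have sA : {subset undup (D ++ D1 ++ D2) <= A}.
  by move=> k; rewrite mem_undup !mem_cat => /or3P[/DA|/D1A|/D2A].
split => //; first exact: undup_uniq.
  by move=> k kD; rewrite mem_undup mem_cat kD.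
have s1 : {subset D1 <= undup (D ++ D1 ++ D2)}.
  by move=> k kD; rewrite mem_undup !mem_cat kD orbT.
have s2 : {subset D2 <= undup (D ++ D1 ++ D2)}.
  by move=> k kD; rewrite mem_undup !mem_cat kD !orbT.
have := hD1 _ (undup_uniq _) sA s1 g1 1 ler01 (fun k Ak => ltac:(rewrite mulr1; exact: h1)).
have := hD2 _ (undup_uniq _) sA s2 g2 1 ler01 (fun k Ak => ltac:(rewrite mulr1; exact: h2)).
rewrite sumrB !mulr1 => k2 k1.
set a := csum A g1 in k1 *; set b := csum A g2 in k2 *.
rewrite (_ : a - b - _ = (a - \sum_(i <- undup (D ++ D1 ++ D2)) g1 i) -
    (b - \sum_(i <- undup (D ++ D1 ++ D2)) g2 i)); last by ring.
by rewrite (le_trans (ncB _ _))//; lra.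
Qed.

End families.

Section series_families.
Variable R : realType.
Local Notation C := R[i].
Local Notation nc := (@Normc.normc R).

Lemma sum_seq_le_ord (N : nat -> R) (D : seq nat) : (forall k, 0 <= N k) ->
  uniq D -> exists n, \sum_(k <- D) N k <= \sum_(k < n) N k.
Proof.
move=> N0 uD; have [n Dn] : exists n, {subset D <= iota 0 n}.
  exists (\max_(k <- D) k).+1 => k kD.
  by rewrite mem_iota add0n ltnS (@leq_bigmax_seq _ D xpredT id).
exists n; rewrite -(big_mkord xpredT N) /index_iota subn0.
have /(perm_big _) -> /= : perm_eq (iota 0 n) (D ++ [seq k <- iota 0 n | k \notin D]).
  apply: uniq_perm; first exact: iota_uniq.
    rewrite cat_uniq uD filter_uniq ?iota_uniq// andbT/=; apply/hasPn => k.
    by rewrite mem_filter => /andP[].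
  move=> k; rewrite mem_cat mem_filter; case: (boolP (k \in D)) => //=.
  by move=> /Dn ->.
by rewrite big_cat/= lerDl sumr_ge0.
Qed.

Lemma nnsummable_nat (N : nat -> R) M : (forall k, 0 <= N k) ->
  (forall n, \sum_(k < n) N k <= M) -> nnsummable setT N.
Proof.
move=> N0 h; apply: (@nnsummable_le_seq _ _ _ _ M) => // D uD _.
by have [n hn] := sum_seq_le_ord N0 uD; exact: le_trans hn (h n).
Qed.

Lemma csum_nat_unique (N : nat -> R) (g : nat -> C) z : nnsummable setT N ->
  (forall k, nc (g k) <= N k) ->
  (forall e, 0 < e -> exists n0, forall n, (n0 <= n)%N ->
     nc (z - \sum_(k < n) g k) <= e) ->
  csum setT g = z.
Proof.
move=> NS gN h; apply: (csum_unique NS) => // e D e0 uD _.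
have [n0 hn] := h _ e0.
pose n := maxn n0 (\max_(k <- D) k).+1.
exists (iota 0 n); split => //; first exact: iota_uniq.
- by move=> k _; rewrite inE.
- move=> k kD; rewrite mem_iota add0n /= /n leq_max ltnS; apply/orP; right.
  by rewrite (@leq_bigmax_seq _ D xpredT id).
- have := hn n; rewrite leq_maxl => /(_ isT).
  by rewrite -(big_mkord xpredT g) /index_iota subn0.
Qed.

End series_families.

(** * Absolutely convergent almost periodic series *)

Section characters.
Variables (R : realType) (d : nat).
Local Notation C := R[i].
Local Notation nc := (@Normc.normc R).
Local Notation V := 'rV[R]_d.
Implicit Types (t u v w h : V).

Lemma dotpDl t h u : dotp (t + h) u = dotp t u + dotp h u.
Proof. by rewrite /dotp -big_split; apply: eq_bigr => j _; rewrite mxE mulrDl. Qed.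

Lemma dotpC t u : dotp t u = dotp u t.
Proof. by apply: eq_bigr => j _; rewrite mulrC. Qed.

Lemma dotpDr t u v : dotp t (u + v) = dotp t u + dotp t v.
Proof. by rewrite ![dotp t _]dotpC dotpDl. Qed.

Lemma dotpZl (a : R) t u : dotp (a *: t) u = a * dotp t u.
Proof. by rewrite /dotp mulr_sumr; apply: eq_bigr => j _; rewrite mxE mulrA. Qed.

Lemma dotpNl t u : dotp (- t) u = - dotp t u.
Proof. by rewrite -scaleN1r dotpZl mulN1r. Qed.

Lemma dotpNr t u : dotp t (- u) = - dotp t u.
Proof. by rewrite dotpC dotpNl dotpC. Qed.

Lemma dotp0l u : dotp 0 u = 0.
Proof. by rewrite -(scale0r (0 : V)) dotpZl mul0r. Qed.

Lemma dotp0r u : dotp u 0 = 0.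
Proof. by rewrite dotpC dotp0l. Qed.

Lemma dotp_gt0 u : u != 0 -> 0 < dotp u u.
Proof.
move=> u0; rewrite lt_def sumr_ge0 ?andbT; last first.
  by move=> j _; rewrite -expr2 sqr_ge0.
apply: contra u0 => /eqP h; apply/eqP/rowP => j; rewrite mxE; apply/eqP.
have /(_ j isT) := psumr_eq0P (fun j _ => sqr_ge0 (u ord0 j)) h.
by move=> /eqP; rewrite sqrf_eq0.
Qed.

Lemma dotp_le t u (b : R) : (forall j, `|t ord0 j| <= b) ->
  `|dotp t u| <= b * \sum_(j < d) `|u ord0 j|.
Proof.
move=> tb; rewrite (le_trans (ler_norm_sum _ _ _))// mulr_sumr.
by apply: ler_sum => j _; rewrite normrM ler_wpM2r.
Qed.

Definition echar t u : C := cexp ((dotp t u) *i).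

Lemma imagD (a b : R) : (a + b) *i = a *i + b *i :> C.
Proof. by apply: complexP; rewrite ?cReD ?cImD/=; ring. Qed.

Lemma echarDl t h u : echar (t + h) u = echar t u * echar h u.
Proof. by rewrite /echar dotpDl imagD cexpD. Qed.

Lemma echarDr t u v : echar t (u + v) = echar t u * echar t v.
Proof. by rewrite /echar dotpDr imagD cexpD. Qed.

Lemma echar0l u : echar 0 u = 1.
Proof. by rewrite /echar dotp0l cexp0. Qed.

Lemma echar0r t : echar t 0 = 1.
Proof. by rewrite /echar dotp0r cexp0. Qed.

Lemma nc_echar t u : nc (echar t u) = 1.
Proof. exact: nc_cexpi. Qed.

Lemma echarC t u : echar t u = echar u t.
Proof. by rewrite /echar dotpC. Qed.

Lemma echarN t u : echar (- t) u = echar t (- u).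
Proof. by rewrite /echar dotpNl dotpNr. Qed.

Lemma echar_conj t u : (echar t u)^*%C = echar t (- u).
Proof.
by rewrite /echar cexp_conj dotpNr; congr cexp; apply: complexP => //=; rewrite oppr0.
Qed.

Lemma echarMn t u n : echar (t *+ n) u = echar t u ^+ n.
Proof. by elim: n => [|n IH]; rewrite ?mulr0n ?echar0l// mulrS echarDl IH exprS. Qed.

Lemma echar_neq0 t u : echar t u != 0.
Proof. exact: cexp_neq0. Qed.

(* A finite averaging set: adjoining to [T] its translate by
   [pi w / <w, w>] multiplies the average at [w'] by
   [(1 + exp(i pi <w, w'> / <w, w>)) / 2], which vanishes at [w]. *)
Lemma finite_mean (D : seq V) : (forall w, w \in D -> w != 0) ->
  exists T : seq V, (0 < size T)%N /\
    forall w, w \in D -> \sum_(t <- T) echar t w = 0.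
Proof.
elim: D => [|w D IH] h; first by exists [:: 0].
have [|T [T0 TD]] := IH; first by move=> w' wD; apply: h; rewrite inE wD orbT.
pose k := (pi / dotp w w) *: w.
exists (T ++ [seq t + k | t <- T]); split; first by rewrite size_cat addn_gt0 T0.
move=> w' w'D; rewrite big_cat big_map/=.
under [X in _ + X]eq_bigr do rewrite echarDl.
rewrite -mulr_suml; move: w'D; rewrite inE => /orP[/eqP ->|/TD ->]; last first.
  by rewrite mul0r addr0.
have -> : echar k w = -1.
  rewrite /echar /k dotpZl divfK ?gt_eqF ?dotp_gt0 ?h ?mem_head//.
  by rewrite cexpiE cospi sinpi; apply: complexP; rewrite ?cReN ?cImN/= ?oppr0.
by rewrite mulrN1 subrr.
Qed.

End characters.

(** * Coefficients, norm and uniqueness for norm limits of trigonometric polynomials *)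

Section functionals.
Variables (R : realType) (d : nat).
Local Notation C := R[i].
Local Notation nc := (@Normc.normc R).
Local Notation V := 'rV[R]_d.
Local Notation functional := ((V -> C) -> C).
Implicit Types (t u v w h : V) (M : set V) (L : functional) (s : seq (C * V))
  (phi psi : V -> C) (B N eps : R).

Definition bnd phi B := forall u, nc (phi u) <= B.

(** A list of (coefficient, frequency) pairs is a finitely supported complex measure; frequencies
    may repeat, so products need no merging of terms. *)
Definition ev s : functional := fun phi => \sum_(p <- s) p.1 * phi p.2.

Definition freqs_in M s := forall p, p \in s -> M p.2.

(* Norm limits of trigonometric polynomials with frequencies in [M], seen as
   functionals on bounded functions; these are the absolutely summable
   families of coefficients on [M], and [L (echar t)] is the value at [t] of
   the corresponding absolutely convergent series. *)
Definition apx M L := forall eps, 0 < eps -> exists2 s, freqs_in M s &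
  forall phi B, bnd phi B -> nc (L phi - ev s phi) <= eps * B.

(** For [L] in [apx M] this bounds the total variation, the sum of the moduli of the coefficients
    [L (ind w)]; see [nle_coef]. *)
Definition nle L N := forall phi B, bnd phi B -> nc (L phi) <= N * B.

Definition ind w : V -> C := fun u => (u == w)%:R.

Lemma bnd_ge0 phi B : bnd phi B -> 0 <= B.
Proof. by move=> /(_ 0); apply: le_trans; exact: nc_ge0. Qed.

Lemma bnd_echar t : bnd (echar t) 1.
Proof. by move=> u; rewrite nc_echar. Qed.

Lemma bnd_ind w : bnd (ind w) 1.
Proof. by move=> u; rewrite /ind ncn lern1 leq_b1. Qed.

Lemma bnd_cst (a : C) : bnd (fun=> a) (nc a).
Proof. by move=> u; rewrite lexx. Qed.

Lemma bnd_echarM phi B t : bnd phi B -> bnd (fun u => echar t u * phi u) B.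
Proof. by move=> h u; rewrite ncM nc_echar mul1r. Qed.

Lemma bndD phi psi B1 B2 :
  bnd phi B1 -> bnd psi B2 -> bnd (fun u => phi u + psi u) (B1 + B2).
Proof. by move=> h k u; rewrite (le_trans (ncD _ _))// lerD. Qed.

Lemma bndZ phi a B : bnd phi B -> bnd (fun u => a * phi u) (nc a * B).
Proof. by move=> h u; rewrite ncM ler_wpM2l ?nc_ge0. Qed.

Lemma bnd_shift phi B v : bnd phi B -> bnd (fun u => phi (v + u)) B.
Proof. by move=> h u. Qed.

Lemma ev_lin s a b phi psi :
  ev s (fun u => a * phi u + b * psi u) = a * ev s phi + b * ev s psi.
Proof.
by rewrite /ev !mulr_sumr -big_split; apply: eq_bigr => p _ /=; ring.
Qed.

Lemma ev_cat s1 s2 phi : ev (s1 ++ s2) phi = ev s1 phi + ev s2 phi.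
Proof. by rewrite /ev big_cat. Qed.

Lemma ev_nle s : nle (ev s) (\sum_(p <- s) nc p.1).
Proof.
move=> phi B h; rewrite (le_trans (nc_sum _ _))// mulr_suml ler_sum// => p _.
by rewrite ncM ler_wpM2l ?nc_ge0.
Qed.

Lemma apx_nle M L : apx M L -> exists2 N, 0 <= N & nle L N.
Proof.
move=> /(_ 1 ltr01)[s _ h]; exists (1 + \sum_(p <- s) nc p.1).
  by rewrite addr_ge0// sumr_ge0// => p _; exact: nc_ge0.
move=> phi B hB; rewrite -(subrK (ev s phi) (L phi)) (le_trans (ncD _ _))//.
by rewrite mulrDl; apply: lerD; [exact: h|exact: ev_nle].
Qed.

Lemma apx_ext M L L' : apx M L ->
  (forall phi B, bnd phi B -> L phi = L' phi) -> apx M L'.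
Proof.
by move=> h e eps /h[s sM hs]; exists s => // phi B hB; rewrite -(e _ _ hB) hs.
Qed.

(** Functionals are bare maps; their linearity on bounded functions is inherited from the
    approximating [ev s]. *)
Lemma apx_lin M L a b phi psi B1 B2 : apx M L -> bnd phi B1 -> bnd psi B2 ->
  L (fun u => a * phi u + b * psi u) = a * L phi + b * L psi.
Proof.
move=> hL h1 h2; apply/eqP; rewrite -subr_eq0; apply/eqP; apply: nc_small_eq0 => e e0.
(* The three approximation errors add up to [e / K] times [K - 1]; the final 1 keeps [K]
   positive. *)
pose K := (nc a * B1 + nc b * B2) + (nc a * B1 + nc b * B2) + 1.
have a0 := nc_ge0 a; have b0 := nc_ge0 b.
have k0 : 0 <= nc a * B1 + nc b * B2.
  by rewrite addr_ge0// mulr_ge0 ?nc_ge0 ?(bnd_ge0 h1) ?(bnd_ge0 h2).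
have K0 : 0 < K by rewrite /K; lra.
have [s _ hs] := hL (e / K) (divr_gt0 e0 K0).
have := hs _ _ (bndD (bndZ a h1) (bndZ b h2)); rewrite ev_lin.
set X := L _; move: (hs _ _ h1) (hs _ _ h2).
set Y := L phi; set Z := L psi; set y := ev s phi; set z := ev s psi => i1 i2 i3.
have -> : X - (a * Y + b * Z) = (X - (a * y + b * z)) - (a * (Y - y) + b * (Z - z)).
  by ring.
apply: (@le_trans _ _ (e / K * (nc a * B1 + nc b * B2) +
   (nc a * (e / K * B1) + nc b * (e / K * B2)))).
  rewrite (le_trans (ncB _ _))// lerD// (le_trans (ncD _ _))// !ncM.
  by rewrite lerD// ler_wpM2l.
have -> : e / K * (nc a * B1 + nc b * B2) + (nc a * (e / K * B1) + nc b * (e / K * B2))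
  = e * ((K - 1) / K) by rewrite /K; ring.
by rewrite ler_piMr ?(ltW e0)// ler_pdivrMr// mul1r; lra.
Qed.

Lemma apxZr M L a phi B : apx M L -> bnd phi B ->
  L (fun u => a * phi u) = a * L phi.
Proof.
move=> hL h; rewrite -[RHS]addr0 -(mul0r (L phi)) -(apx_lin a 0 hL h h).
by congr L; apply/funext => u; rewrite mul0r addr0.
Qed.

Lemma apxDr M L phi psi B1 B2 : apx M L -> bnd phi B1 -> bnd psi B2 ->
  L (fun u => phi u + psi u) = L phi + L psi.
Proof.
move=> hL h1 h2; rewrite -[L phi]mul1r -[L psi]mul1r -(apx_lin 1 1 hL h1 h2).
by congr L; apply/funext => u; rewrite !mul1r.
Qed.

Lemma apxBr M L phi psi B1 B2 : apx M L -> bnd phi B1 -> bnd psi B2 ->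
  L (fun u => phi u - psi u) = L phi - L psi.
Proof.
move=> hL h1 h2; rewrite -[L phi]mul1r -[- L psi]mulN1r -(apx_lin 1 (-1) hL h1 h2).
by congr L; apply/funext => u; rewrite mul1r mulN1r.
Qed.

Lemma apx_sumr M L I (r : seq I) (F : I -> V -> C) (K : I -> R) : apx M L ->
  (forall i, bnd (F i) (K i)) ->
  L (fun u => \sum_(i <- r) F i u) = \sum_(i <- r) L (F i).
Proof.
move=> hL hF; elim: r => [|i r IH].
  rewrite big_nil; have h := apxZr 0 hL (@bnd_cst 0).
  transitivity (L (fun=> 0 * 0)); last by rewrite h mul0r.
  by congr L; apply/funext => u; rewrite big_nil mul0r.
rewrite big_cons -IH -(@apxDr M L _ _ (K i) (\sum_(i <- r) K i) hL (hF i)).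
  by congr L; apply/funext => u; rewrite big_cons.
by move=> u; rewrite (le_trans (nc_sum _ _))// ler_sum// => j _; exact: hF.
Qed.

Lemma ev_apx M s : freqs_in M s -> apx M (ev s).
Proof.
move=> sM eps e0; exists s => // phi B h.
by rewrite subrr nc0 mulr_ge0 ?(ltW e0) ?(bnd_ge0 h).
Qed.

Lemma ev_sumr s I (r : seq I) (F : I -> V -> C) :
  ev s (fun u => \sum_(i <- r) F i u) = \sum_(i <- r) ev s (F i).
Proof. by rewrite /ev exchange_big; apply: eq_bigr => p _; rewrite mulr_sumr. Qed.

(* Averaging [ev s (echar t) * echar t (- w)] over a finite set of [t] that
   kills the other frequencies extracts the coefficient at [w]. *)
Lemma ev_coef_le s K w : (forall t, nc (ev s (echar t)) <= K) ->
  nc (ev s (ind w)) <= K.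
Proof.
move=> hK; pose D := [seq v <- [seq p.2 - w | p <- s] | v != 0].
have [|T [T0 TD]] := @finite_mean R d D.
  by move=> v; rewrite mem_filter => /andP[].
have e1 : \sum_(t <- T) ev s (echar t) * echar t (- w) =
    (size T)%:R * ev s (ind w).
  under eq_bigr do rewrite /ev mulr_suml.
  rewrite exchange_big/= /ev mulr_sumr big_seq [RHS]big_seq; apply: eq_bigr => p ps.
  under eq_bigr do rewrite -mulrA -echarDr.
  rewrite -mulr_sumr mulrCA; congr (_ * _); rewrite /ind.
  have [->|pw] := eqVneq p.2 w.
    under eq_bigr do rewrite subrr echar0r.
    by rewrite mulr1 big_const_seq count_predT iter_addr_0.
  rewrite mulr0 TD// mem_filter subr_eq0 pw/=.
  by apply/mapP; exists p.
have T0' : 0 < (size T)%:R :> R by rewrite ltr0n.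
rewrite -(ler_pM2l T0') -[X in X * nc _]ncn -ncM -e1 (le_trans (nc_sum _ _))//.
apply: (@le_trans _ _ (\sum_(t <- T) K)).
  by apply: ler_sum => t _; rewrite ncM nc_echar mulr1.
by rewrite big_const_seq count_predT iter_addr_0 mulr_natl.
Qed.

Lemma ind_decomp (D : seq V) phi u : uniq D -> u \in D ->
  phi u = \sum_(w <- D) phi w * ind w u.
Proof.
move=> uD uinD; rewrite (bigD1_seq u)//= /ind eqxx mulr1 big1 ?addr0// => w wu.
by rewrite eq_sym (negbTE wu) mulr0.
Qed.

(** Each coefficient is at most the supremum [K] of the transform, and there are at most [size D] of
    them. The loss is affordable for powers, whose number of frequencies grows only polynomially. *)
Lemma ev_norm_le s (D : seq V) K : (forall p, p \in s -> p.2 \in D) ->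
  (forall t, nc (ev s (echar t)) <= K) -> nle (ev s) ((size D)%:R * K).
Proof.
move=> sD hK phi B hB.
have K0 : 0 <= K := le_trans (nc_ge0 _) (hK 0).
have -> : ev s phi = \sum_(w <- undup D) phi w * ev s (ind w).
  transitivity (ev s (fun u => \sum_(w <- undup D) phi w * ind w u)).
    rewrite /ev big_seq [RHS]big_seq; apply: eq_bigr => p ps.
    by rewrite -ind_decomp ?undup_uniq// mem_undup sD.
  rewrite ev_sumr; apply: eq_bigr => w _.
  by rewrite /ev mulr_sumr; apply: eq_bigr => p _; ring.
rewrite (le_trans (nc_sum _ _))//.
apply: (@le_trans _ _ (\sum_(w <- undup D) B * K)).
  by apply: ler_sum => w _; rewrite ncM ler_pM ?nc_ge0// ev_coef_le.
rewrite big_const_seq count_predT iter_addr_0 -[leLHS]mulr_natl.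
have -> : (size D)%:R * K * B = (size D)%:R * (B * K) by ring.
by rewrite ler_wpM2r ?ler_nat ?size_undup// mulr_ge0// (bnd_ge0 hB).
Qed.

Lemma apx_coef M L eps : apx M L -> 0 < eps ->
  exists D, [/\ uniq D, forall w, w \in D -> M w & forall phi B, bnd phi B ->
    nc (L phi - \sum_(w <- D) phi w * L (ind w)) <= eps * B].
Proof.
move=> hL e0; have [s sM hs] := hL _ e0.
exists (undup [seq p.2 | p <- s]); split; first exact: undup_uniq.
  by move=> w; rewrite mem_undup => /mapP[p /sM ? ->].
move=> phi B hB; set D := undup _.
pose psi u := \sum_(w <- D) phi w * ind w u.
have bw w : bnd (fun u => phi w * ind w u) (B * 1).
  by move=> u; rewrite ncM ler_pM ?nc_ge0// bnd_ind.
have psiE u : psi u = if u \in D then phi u else 0.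
  case: ifPn => uD; first by rewrite /psi -ind_decomp ?undup_uniq.
  rewrite /psi big_seq big1// => w wD; rewrite /ind; case: eqP => [uw|_].
    by rewrite uw wD in uD.
  by rewrite mulr0.
have bpsi : bnd psi B.
  by move=> u; rewrite psiE; case: ifP => _; rewrite ?nc0 ?(bnd_ge0 hB).
have -> : \sum_(w <- D) phi w * L (ind w) = L psi.
  rewrite /psi (apx_sumr _ hL bw); apply: eq_bigr => w _.
  by rewrite (apxZr _ hL (bnd_ind w)).
rewrite -(apxBr hL hB bpsi).
(* [phi - psi] vanishes on every frequency of [s], so [ev s] kills it and only the approximation
   error is left. *)
have bd : bnd (fun u => phi u - psi u) B.
  by move=> u; rewrite psiE; case: ifP => _; rewrite ?subrr ?subr0 ?nc0 ?(bnd_ge0 hB).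
have := hs _ _ bd; rewrite (_ : ev s _ = 0) ?subr0//.
rewrite /ev big_seq big1// => p ps; rewrite psiE ifT ?subrr ?mulr0//.
by rewrite mem_undup; apply/mapP; exists p.
Qed.

Lemma apx_coef_uniq M L phi B : apx M L -> (forall w, M w -> L (ind w) = 0) ->
  bnd phi B -> L phi = 0.
Proof.
move=> hL h0 hB; apply: nc_small_eq0 => e e0.
have B0 := bnd_ge0 hB.
have K0 : 0 < B + 1 by lra.
have [D [uD DM hD]] := apx_coef hL (divr_gt0 e0 K0).
have := hD _ _ hB; rewrite big_seq big1 ?subr0 => [h|w /DM /h0 ->]; last by rewrite mulr0.
rewrite (le_trans h)// mulrAC ler_pdivrMr//; lra.
Qed.

(** If the transform vanishes, an approximating polynomial has a small transform, hence small
    coefficients by [ev_coef_le]: Fourier uniqueness without integration. *)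
Lemma apx_char_uniq M L phi B : apx M L -> (forall t, L (echar t) = 0) ->
  bnd phi B -> L phi = 0.
Proof.
move=> hL h0; apply: (apx_coef_uniq hL) => w _.
apply: nc_small_eq0 => e e0; have e2 : 0 < e / 2 by rewrite divr_gt0.
have [s _ hs] := hL _ e2.
have hK t : nc (ev s (echar t)) <= e / 2.
  by have := hs _ _ (@bnd_echar t); rewrite h0 sub0r ncN mulr1.
rewrite -(subrK (ev s (ind w)) (L (ind w))) (le_trans (ncD _ _))//.
have := ev_coef_le w hK; have := hs _ _ (@bnd_ind w); lra.
Qed.

Lemma apx_support M L w : apx M L -> ~ M w -> L (ind w) = 0.
Proof.
move=> hL Mw; apply: nc_small_eq0 => e e0.
have [s sM hs] := hL _ e0.
have := hs _ _ (@bnd_ind w); rewrite mulr1 (_ : ev s _ = 0) ?subr0//.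
rewrite /ev big_seq big1// => p /sM; rewrite /ind.
by case: eqP => [->//|_ _]; rewrite mulr0.
Qed.

(** The test function takes at each point of [S] the conjugate phase of the coefficient there (0
    where the coefficient is 0), so [L] returns the sum of the moduli. *)
Lemma nle_coef L N (S : seq V) M : apx M L -> nle L N -> uniq S ->
  \sum_(w <- S) nc (L (ind w)) <= N.
Proof.
move=> hL hN uS.
pose sg (z : C) := z^*%C / (nc z)%:C.
have sgE z : sg z * z = (nc z)%:C.
  have [->|z0] := eqVneq z 0; first by rewrite mulr0 nc0.
  have nz : (nc z)%:C != 0 :> C.
    by apply/eqP => -[] /nc_eq0 /eqP; rewrite (negbTE z0).
  by rewrite /sg mulrAC [_ * z]mulrC mul_conj expr2 rmorphM/= mulfK.
have sg1 z : nc (sg z) <= 1.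
  have [->|z0] := eqVneq z 0.
    by rewrite /sg nc0 invr0 mulr0 nc0.
  rewrite /sg ncM nc_conj ncV ncR ger0_norm ?nc_ge0// divff//.
  by apply: contra z0 => /eqP/nc_eq0 ->.
pose phi u := \sum_(w <- S) sg (L (ind w)) * ind w u.
have bw w : bnd (fun u => sg (L (ind w)) * ind w u) 1.
  by move=> u; rewrite ncM -[leRHS]mulr1 ler_pM ?nc_ge0// bnd_ind.
have bphi : bnd phi 1.
  move=> u; have [uS'|uS'] := boolP (u \in S).
    by rewrite /phi -(@ind_decomp S (fun w => sg (L (ind w))))//.
  rewrite /phi big_seq big1 ?nc0// => w wS; rewrite /ind; case: eqP => [uw|_].
    by rewrite uw wS in uS'.
  by rewrite mulr0.
have := hN _ _ bphi; rewrite (apx_sumr _ hL bw) mulr1.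
under eq_bigr do rewrite (apxZr _ hL (@bnd_ind _)) sgE.
rewrite -rmorph_sum ncR ger0_norm//.
by apply: sumr_ge0 => w _; exact: nc_ge0.
Qed.

End functionals.

(** * Convolution, translation and almost periods *)

Section convolution_algebra.
Variables (R : realType) (d : nat).
Local Notation C := R[i].
Local Notation nc := (@Normc.normc R).
Local Notation V := 'rV[R]_d.
Local Notation functional := ((V -> C) -> C).
Implicit Types (t u v w h : V) (M : set V) (L X : functional) (s : seq (C * V))
  (phi psi : V -> C) (B N eps : R).

Definition conv_fun L X : functional := fun phi => L (fun u => X (fun v => phi (u + v))).

Definition add_fun L X : functional := fun phi => L phi + X phi.

Definition scale_fun (a : C) L : functional := fun phi => a * L phi.

Definition delta_fun w : functional := fun phi => phi w.

(* Acts on transforms as the translation by [h]. *)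
Definition transl h L : functional := fun phi => L (fun u => echar h u * phi u).

Definition refl_fun L : functional := fun phi => L (fun u => phi (- u)).

Fixpoint pow_fun L (n : nat) : functional :=
  if n is k.+1 then conv_fun L (pow_fun L k) else delta_fun 0.

Definition subgroup M :=
  [/\ M 0, forall u v, M u -> M v -> M (u + v) & forall u, M u -> M (- u)].

(** The tool for all identities below: they are checked on characters only, where convolution is
    multiplication. *)
Lemma apx_eq M L X phi B : apx M L -> apx M X ->
  (forall t, L (echar t) = X (echar t)) -> bnd phi B -> L phi = X phi.
Proof.
move=> hL hX e hB; apply/eqP; rewrite -subr_eq0; apply/eqP.
apply: (@apx_char_uniq R d M (fun phi => L phi - X phi) phi B) => // [eps e0|t].
  have e2 : 0 < eps / 2 by rewrite divr_gt0.
  have [s sM hs] := hL _ e2; have [s' s'M hs'] := hX _ e2.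
  exists (s ++ [seq (- p.1, p.2) | p <- s']).
    move=> p; rewrite mem_cat => /orP[/sM//|/mapP[q /s'M ? ->]]//.
  move=> psi B' hB'; rewrite ev_cat.
  have -> : ev [seq (- p.1, p.2) | p <- s'] psi = - ev s' psi.
    by rewrite /ev big_map -sumrN; apply: eq_bigr => p _; rewrite mulNr.
  have -> : L psi - X psi - (ev s psi - ev s' psi) =
    (L psi - ev s psi) - (X psi - ev s' psi) by ring.
  rewrite (le_trans (ncB _ _))//.
  have := hs _ _ hB'; have := hs' _ _ hB'; lra.
by rewrite e subrr.
Qed.

Lemma nle_eq L X N : (forall phi B, bnd phi B -> L phi = X phi) ->
  nle L N -> nle X N.
Proof. by move=> e h phi B hB; rewrite -(e _ _ hB) h. Qed.

Lemma nle_le L N N' : N <= N' -> nle L N -> nle L N'.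
Proof.
by move=> NN h phi B hB; rewrite (le_trans (h _ _ hB))// ler_wpM2r// (bnd_ge0 hB).
Qed.

Lemma nle_echar L N t : nle L N -> nc (L (echar t)) <= N.
Proof. by move=> h; have := h _ _ (bnd_echar t); rewrite mulr1. Qed.

Lemma apx_add M L X : apx M L -> apx M X -> apx M (add_fun L X).
Proof.
move=> hL hX eps e0; have e2 : 0 < eps / 2 by rewrite divr_gt0.
have [s sM hs] := hL _ e2; have [s' s'M hs'] := hX _ e2.
exists (s ++ s'); first by move=> p; rewrite mem_cat => /orP[/sM|/s'M].
move=> psi B' hB'; rewrite ev_cat /add_fun.
have -> : L psi + X psi - (ev s psi + ev s' psi) =
  (L psi - ev s psi) + (X psi - ev s' psi) by ring.
rewrite (le_trans (ncD _ _))//.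
have := hs _ _ hB'; have := hs' _ _ hB'; lra.
Qed.

Lemma nle_add L X N N' : nle L N -> nle X N' -> nle (add_fun L X) (N + N').
Proof.
by move=> h k phi B hB; rewrite mulrDl (le_trans (ncD _ _))// lerD ?h ?k.
Qed.

Lemma nle_scale a L N : nle L N -> nle (scale_fun a L) (nc a * N).
Proof. by move=> h phi B hB; rewrite ncM -mulrA ler_wpM2l ?nc_ge0 ?h. Qed.

Lemma apx_scale M a L : apx M L -> apx M (scale_fun a L).
Proof.
move=> hL eps e0; have a1 : 0 < nc a + 1 by rewrite ltr_wpDl ?nc_ge0.
have [s sM hs] := hL _ (divr_gt0 e0 a1).
exists [seq (a * p.1, p.2) | p <- s]; first by move=> p /mapP[q /sM ? ->].
move=> phi B hB.
have -> : ev [seq (a * p.1, p.2) | p <- s] phi = a * ev s phi.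
  by rewrite /ev big_map mulr_sumr; apply: eq_bigr => p _; rewrite mulrA.
rewrite /scale_fun -mulrBr ncM; apply: (@le_trans _ _ ((nc a + 1) * (eps / (nc a + 1) * B))).
  apply: ler_pM; rewrite ?nc_ge0 ?lerDl//; exact: hs.
by rewrite mulrA mulrCA divff ?mulr1// gt_eqF.
Qed.

Lemma apx_delta M w : M w -> apx M (delta_fun w).
Proof.
move=> Mw eps e0; exists [:: (1, w)]; first by move=> p; rewrite inE => /eqP ->.
move=> phi B hB; rewrite /ev big_seq1 mul1r subrr nc0 mulr_ge0 ?(ltW e0)//.
exact: bnd_ge0 hB.
Qed.

Lemma nle_delta w : nle (delta_fun w) 1.
Proof. by move=> phi B hB; rewrite mul1r; exact: hB. Qed.

Lemma bnd_inner X N phi B : nle X N -> bnd phi B ->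
  bnd (fun u => X (fun v => phi (u + v))) (N * B).
Proof. by move=> hX hB u; apply: hX; exact: bnd_shift. Qed.

Lemma nle_conv L X N N' : nle L N -> nle X N' -> nle (conv_fun L X) (N * N').
Proof.
by move=> h k phi B hB; rewrite -mulrA; exact: h (bnd_inner k hB).
Qed.

Definition ev_prod s s' : seq (C * V) :=
  [seq (p.1 * q.1, p.2 + q.2) | p <- s, q <- s'].

Lemma ev_prodE s s' phi : ev (ev_prod s s') phi = conv_fun (ev s) (ev s') phi.
Proof.
rewrite /ev_prod /conv_fun /ev big_allpairs_dep; apply: eq_bigr => p _.
by rewrite mulr_sumr; apply: eq_bigr => q _; rewrite mulrA.
Qed.

Lemma apx_conv M L X : subgroup M -> apx M L -> apx M X -> apx M (conv_fun L X).
Proof.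
move=> [_ Madd _] hL hX eps e0.
have e2 : 0 < eps / 2 by rewrite divr_gt0.
have [N N0 hN] := apx_nle hX.
have N1 : 0 < N + 1 by lra.
have [s sM hs] := hL _ (divr_gt0 e2 N1).
set W := \sum_(p <- s) nc p.1.
have W0 : 0 <= W by apply: sumr_ge0 => p _; exact: nc_ge0.
have W1 : 0 < W + 1 by lra.
have [s' s'M hs'] := hX _ (divr_gt0 e2 W1).
exists (ev_prod s s').
  by move=> p /allpairsP[[q q'] [/sM ? /s'M ?] ->]; apply: Madd.
move=> phi B hB; have B0 := bnd_ge0 hB; rewrite ev_prodE /conv_fun.
set G := fun u => X _; set G' := fun u => ev s' _.
have bG : bnd G (N * B) := bnd_inner hN hB.
have bGG : bnd (fun u => 1 * G u + (-1) * G' u) (eps / 2 / (W + 1) * B).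
  by move=> u; rewrite mul1r mulN1r; exact: hs' (bnd_shift u hB).
have -> : L G - ev s G' = (L G - ev s G) + ev s (fun u => 1 * G u + (-1) * G' u).
  by rewrite ev_lin; ring.
rewrite (le_trans (ncD _ _))//.
have h1 : nc (L G - ev s G) <= eps / 2 * B.
  rewrite (le_trans (hs _ _ bG))// mulrA ler_wpM2r// mulrAC ler_pdivrMr//.
  by rewrite ler_wpM2l//; lra.
have h2 : nc (ev s (fun u => 1 * G u + (-1) * G' u)) <= eps / 2 * B.
  rewrite (le_trans (@ev_nle _ _ s _ _ bGG))// mulrA ler_wpM2r// mulrCA ler_piMr//; first lra.
  by rewrite ler_pdivrMr// mul1r; rewrite -/W; lra.
lra.
Qed.

Lemma conv_echar M L X t : apx M L -> apx M X ->
  conv_fun L X (echar t) = L (echar t) * X (echar t).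
Proof.
move=> hL hX; rewrite /conv_fun.
have -> : (fun u => X (fun v => echar t (u + v))) =
   (fun u => X (echar t) * echar t u).
  apply/funext => u; rewrite mulrC -(apxZr _ hX (bnd_echar t)); congr X.
  by apply/funext => v; rewrite echarDr.
by rewrite (apxZr _ hL (bnd_echar t)) mulrC.
Qed.

Lemma transl_echar h L t : transl h L (echar t) = L (echar (t + h)).
Proof. by congr L; apply/funext => u; rewrite echarDl mulrC. Qed.

Lemma apx_transl M h L : apx M L -> apx M (transl h L).
Proof.
move=> hL eps /hL[s sM hs].
exists [seq (p.1 * echar h p.2, p.2) | p <- s]; first by move=> p /mapP[q /sM ? ->].
move=> phi B hB; have := hs _ _ (bnd_echarM h hB).
congr (nc (_ - _) <= _); rewrite /ev big_map; apply: eq_bigr => p _ /=.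
by rewrite mulrA.
Qed.

Lemma refl_echar L t : refl_fun L (echar t) = L (echar (- t)).
Proof. by congr L; apply/funext => u; rewrite echarN. Qed.

Lemma apx_refl M L : subgroup M -> apx M L -> apx M (refl_fun L).
Proof.
move=> [_ _ MN] hL eps /hL[s sM hs].
exists [seq (p.1, - p.2) | p <- s]; first by move=> p /mapP[q /sM/MN ? ->].
move=> phi B hB; have hB' : bnd (fun u => phi (- u)) B by move=> u.
by have := hs _ _ hB'; congr (nc (_ - _) <= _); rewrite /ev big_map.
Qed.

Lemma apx_sum M I (r : seq I) (F : I -> functional) : (forall i, apx M (F i)) ->
  apx M (fun phi => \sum_(i <- r) F i phi).
Proof.
move=> hF; elim: r => [|i r IH].
  move=> eps e0; exists [::] => // phi B hB.
  by rewrite big_nil /ev big_nil subr0 nc0 mulr_ge0 ?(ltW e0) ?(bnd_ge0 hB).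
apply: (apx_ext (apx_add (hF i) IH)) => phi B _.
by rewrite big_cons.
Qed.

Lemma apx_csum M (T : choiceType) (A : set T) (F : T -> functional) (N : T -> R) :
  nnsummable A N -> (forall k, A k -> apx M (F k)) -> (forall k, A k -> nle (F k) (N k)) ->
  apx M (fun phi => csum A (fun k => F k phi)).
Proof.
move=> NS hF hN eps e0; have e2 : 0 < eps / 2 by rewrite divr_gt0.
have [D [uD DA hD]] := csum_approx NS e2.
(* [apx_sum] wants every index to be admissible, so [F] is replaced by the zero functional off [A],
   where nothing is known about it. *)
have hF' k : apx M (if k \in A then F k else fun=> 0).
  case: ifPn => [/set_mem/hF//|_] e e1; exists [::] => // phi B hB.
  by rewrite /ev big_nil subr0 nc0 mulr_ge0 ?(ltW e1) ?(bnd_ge0 hB).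
have [s sM hs] := apx_sum D hF' e2.
exists s => // phi B hB.
have := hs _ _ hB; have -> : \sum_(i <- D) (if i \in A then F i else fun=> 0) phi =
   \sum_(i <- D) F i phi.
  by rewrite big_seq [RHS]big_seq; apply: eq_bigr => k /DA ->.
have := hD _ uD DA (fun=> id) (fun k => F k phi) B (bnd_ge0 hB) (fun k Ak => hN k Ak _ _ hB).
set S := \sum_(i <- D) _ => i1 i2.
rewrite -(subrK S (csum _ _)) -addrA (le_trans (ncD _ _))//; lra.
Qed.

Lemma nle_csum (T : choiceType) (A : set T) (F : T -> functional) (N : T -> R) K :
  nnsummable A N -> (forall k, A k -> nle (F k) (N k)) ->
  (forall D, uniq D -> {subset D <= A} -> \sum_(k <- D) N k <= K) ->
  nle (fun phi => csum A (fun k => F k phi)) K.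
Proof.
move=> NS hN hK phi B hB; have B0 := bnd_ge0 hB.
apply: (@csum_le _ _ _ (fun k => N k * B)).
- apply: (@nnsummable_le_seq _ _ _ _ (K * B)) => [k Ak|D uD DA].
    by rewrite mulr_ge0// NS.1.
  by rewrite -mulr_suml ler_wpM2r// hK.
- by move=> D uD DA; rewrite -mulr_suml ler_wpM2r// hK.
- by move=> k Ak; exact: hN.
Qed.

Lemma apx_pow M L n : subgroup M -> apx M L -> apx M (pow_fun L n).
Proof.
move=> Mg hL; elim: n => [|n IH]; last exact: apx_conv.
by apply: apx_delta; case: Mg.
Qed.

Lemma nle_pow L N n : nle L N -> nle (pow_fun L n) (N ^+ n).
Proof.
move=> h; elim: n => [|n IH]; first exact: nle_delta.
by rewrite exprS; exact: nle_conv.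
Qed.

Lemma pow_echar M L n t : subgroup M -> apx M L ->
  pow_fun L n (echar t) = L (echar t) ^+ n.
Proof.
move=> Mg hL; elim: n => [|n IH]; first by rewrite /= /delta_fun echar0r.
by rewrite /= (conv_echar _ hL (apx_pow n Mg hL)) IH exprS.
Qed.

Lemma ev_scale_small s (b : R) h phi B : (forall j, `|h ord0 j| <= b) -> bnd phi B ->
  nc (ev s (fun u => (echar h u - 1) * phi u)) <=
  b * (\sum_(p <- s) nc p.1 * (2 * \sum_(j < d) `|p.2 ord0 j|)) * B.
Proof.
move=> hb hB; rewrite (le_trans (nc_sum _ _))// mulr_sumr mulr_suml.
apply: ler_sum => p _; rewrite ncM mulrCA -mulrA ler_wpM2l ?nc_ge0// ncM.
apply: ler_pM; rewrite ?nc_ge0//.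
rewrite (le_trans (nc_cexpiB1 _))// mulrCA ler_wpM2l//; exact: dotp_le.
Qed.

(** Translations act continuously in norm: for polynomials by [|exp(i x) - 1| <= 2 |x|], and in the
    limit because multiplication by a character preserves bounds. *)
Lemma transl_small M L eps : apx M L -> 0 < eps -> exists2 b, 0 < b &
  forall h, (forall j, `|h ord0 j| <= b) ->
  nle (add_fun (transl h L) (scale_fun (-1) L)) eps.
Proof.
move=> hL e0; have e2 : 0 < eps / 2 by rewrite divr_gt0.
have e4 : 0 < eps / 4 by rewrite divr_gt0.
have [s sM hs] := hL _ e4.
set W := \sum_(p <- s) nc p.1 * (2 * \sum_(j < d) `|p.2 ord0 j|).
have W0 : 0 <= W.
  by apply: sumr_ge0 => p _; rewrite !mulr_ge0 ?nc_ge0// sumr_ge0.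
have W1 : 0 < W + 1 by lra.
exists (eps / 2 / (W + 1)); first by rewrite divr_gt0.
move=> h hb phi B hB; have B0 := bnd_ge0 hB.
rewrite /add_fun /scale_fun /transl mulN1r.
have := ev_scale_small s hb hB; rewrite -/W.
have -> : ev s (fun u => (echar h u - 1) * phi u) =
   ev s (fun u => 1 * (echar h u * phi u) + (-1) * phi u).
  by congr ev; apply/funext => u; ring.
rewrite ev_lin mul1r mulN1r.
have := hs _ _ (bnd_echarM h hB); have := hs _ _ hB.
set a := L _; set b := L _; set a' := ev s _; set b' := ev s _ => i1 i2 i3.
have i4 : eps / 2 / (W + 1) * W * B <= eps / 2 * B.
  rewrite ler_wpM2r// mulrAC -mulrA ler_piMr//; first lra.
  by rewrite ler_pdivrMr// mul1r; lra.
have -> : b - a = (b - b') - (a - a') + (b' - a') by ring.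
rewrite (le_trans (ncD _ _))// .
have := ncB (b - b') (a - a').
lra.
Qed.

(* Pigeonhole on the finitely many cells of a fine grid containing
   [exp(i <h, u>)], [u] in [D]. *)
Lemma simultaneous_return (D : seq V) (eps : R) : 0 < eps ->
  exists H : seq V, forall h, exists2 k, k \in H &
    forall u, u \in D -> nc (echar (h - k) u - 1) <= eps.
Proof.
(* Real and imaginary parts will each contribute [1 / n], hence [2 / n <= eps]. *)
move=> e0; pose n := (Num.truncn (2 / eps)).+1.
have n0 : 0 < n%:R :> R by rewrite ltr0n.
have ne : 2 / n%:R <= eps.
  rewrite ler_pdivrMr// mulrC -ler_pdivrMr//; apply: ltW.
  have := truncn_itv (ltW (divr_gt0 (ltr0Sn R 1) e0)).
  by move=> /andP[].
(* Cells of width [1 / n] on [[-1, 1]]; the endpoint 1 falls in cell [2 n], so there are [2 n + 1]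
   of them. *)
pose cell (x : R) : 'I_(2 * n).+1 := inord (Num.truncn ((x + 1) * n%:R)).
have cellP x y : `|x| <= 1 -> `|y| <= 1 -> cell x = cell y -> `|x - y| <= 1 / n%:R.
  have tr (z : R) : `|z| <= 1 -> [/\ (Num.truncn ((z + 1) * n%:R) < (2 * n).+1)%N,
     (Num.truncn ((z + 1) * n%:R))%:R <= (z + 1) * n%:R &
     (z + 1) * n%:R < (Num.truncn ((z + 1) * n%:R))%:R + 1].
    move=> /ler_normlP[z1 z2]; have z0 : 0 <= (z + 1) * n%:R.
      by rewrite mulr_ge0 ?(ltW n0)//; lra.
    have /andP[t1 t2] := truncn_itv z0; split => //; last by rewrite natr1.
    rewrite ltnS -(ler_nat R) (le_trans t1)// natrM ler_wpM2r ?(ltW n0)//; lra.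
  move=> /tr[x1 x2 x3] /tr[y1 y2 y3] /(congr1 (@nat_of_ord _)); rewrite /cell !inordK// => exy.
  rewrite exy in x2 x3; rewrite ler_pdivlMr// -[X in _ * X]gtr0_norm// -normrM.
  by rewrite ler_norml; apply/andP; split; lra.
pose cl h : {ffun 'I_(size D) -> 'I_(2 * n).+1 * 'I_(2 * n).+1} :=
  [ffun i : 'I_(size D) => (cell (complex.Re (echar h (nth 0 D i))),
              cell (complex.Im (echar h (nth 0 D i))))].
(* One representative per cell; an empty cell contributes the default 0, which does no harm. *)
exists [seq xget 0 [set h | cl h = c] | c <- enum [set: {ffun 'I_(size D) -> 'I_(2 * n).+1 * 'I_(2 * n).+1}]%SET] => h.
exists (xget 0 [set k | cl k = cl h]).
  by apply/mapP; exists (cl h) => //; rewrite mem_enum inE.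
set k : V := xget _ _; have ck : cl k = cl h.
  exact: (@xgetPex _ 0 [set k | cl k = cl h] (ex_intro _ h erefl)).
move=> u uD; have iD : (index u D < size D)%N by rewrite index_mem.
have [c1 c2] : cell (complex.Re (echar k u)) = cell (complex.Re (echar h u)) /\
    cell (complex.Im (echar k u)) = cell (complex.Im (echar h u)).
  have := congr1 (fun f : {ffun _} => f (Ordinal iD)) ck.
  by rewrite !ffunE/= nth_index// => -[-> ->].
have -> : echar (h - k) u - 1 = (echar h u - echar k u) * echar (- k) u.
  by rewrite mulrBl -!echarDl subrr echar0l.
rewrite ncM nc_echar mulr1 (le_trans (nc_ReIm _))// (le_trans _ ne)//.
have nb : forall z : C, nc z = 1 -> `|complex.Re z| <= 1 /\ `|complex.Im z| <= 1.
  by move=> z z1; rewrite -z1; split; [exact: nc_Re|exact: nc_Im].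
have [h1 h2] := nb _ (nc_echar h u); have [k1 k2] := nb _ (nc_echar k u).
have -> : 2 / n%:R = 1 / n%:R + 1 / n%:R :> R by field; rewrite gt_eqF.
by rewrite cReD cReN cImD cImN lerD// cellP.
Qed.

(** Bohr almost periodicity in norm: every [h] differs from a member of the finite set [H] by an
    [eps]-almost period. *)
Lemma transl_almost_period M L eps : apx M L -> 0 < eps ->
  exists H : seq V, forall h, exists2 k, k \in H &
  nle (add_fun (transl (h - k) L) (scale_fun (-1) L)) eps.
Proof.
move=> hL e0; have e4 : 0 < eps / 4 by rewrite divr_gt0.
have e2 : 0 < eps / 2 by rewrite divr_gt0.
have [s sM hs] := hL _ e4.
set W := \sum_(p <- s) nc p.1.
have W0 : 0 <= W by apply: sumr_ge0 => p _; exact: nc_ge0.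
have W1 : 0 < W + 1 by lra.
have [H hH] := simultaneous_return [seq p.2 | p <- s] (divr_gt0 e2 W1).
exists H => h; have [k kH hk] := hH h; exists k => // phi B hB.
have B0 := bnd_ge0 hB.
rewrite /add_fun /scale_fun /transl mulN1r.
have i3 : nc (ev s (fun u => 1 * (echar (h - k) u * phi u) + (-1) * phi u)) <=
    eps / 2 * B.
  apply: (@le_trans _ _ (W * (eps / 2 / (W + 1) * B))).
    rewrite (le_trans (nc_sum _ _))// mulr_suml big_seq [leRHS]big_seq.
    apply: ler_sum => p ps; rewrite ncM ler_wpM2l ?nc_ge0//.
    have -> : 1 * (echar (h - k) p.2 * phi p.2) + -1 * phi p.2 =
      (echar (h - k) p.2 - 1) * phi p.2 by ring.
    by rewrite ncM ler_pM ?nc_ge0 ?hk//; apply/mapP; exists p.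
  rewrite mulrA ler_wpM2r// mulrCA ler_piMr//; first lra.
  by rewrite ler_pdivrMr// mul1r; lra.
move: i3; rewrite ev_lin mul1r mulN1r.
have := hs _ _ (bnd_echarM (h - k) hB); have := hs _ _ hB.
set a := L _; set b := L _; set a' := ev s _; set b' := ev s _ => i1 i2 i3.
have -> : b - a = (b - b') - (a - a') + (b' - a') by ring.
rewrite (le_trans (ncD _ _))// .
have := ncB (b - b') (a - a').
lra.
Qed.

End convolution_algebra.

(** * Wiener's lemma, logarithms and exponentials *)

Section wiener.
Local Arguments Normc.normc : simpl never.
Variables (R : realType) (d : nat).
Local Notation C := R[i].
Local Notation nc := (@Normc.normc R).
Local Notation V := 'rV[R]_d.
Local Notation functional := ((V -> C) -> C).
Implicit Types (t u v w h : V) (M : set V) (L X : functional) (s : seq (C * V))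
  (phi psi : V -> C) (B N eps : R).

Lemma geometric_sum_le (x : R) n : 0 <= x < 1 -> \sum_(k < n) x ^+ k <= (1 - x)^-1.
Proof.
move=> /andP[x0 x1]; have x1' : 0 < 1 - x by lra.
rewrite -[leRHS]mul1r ler_pdivlMr// mulrC.
have -> : (1 - x) * \sum_(k < n) x ^+ k = 1 - x ^+ n.
  elim: n => [|n IH]; first by rewrite big_ord0 expr0 subrr mulr0.
  by rewrite big_ord_recr/= mulrDr IH exprS; ring.
by rewrite lerBlDr lerDl exprn_ge0.
Qed.

(** Induction on [m] with [y = sqrt x]: one half [y ^ n] absorbs a factor [n + 1], because [(n + 1)
    y ^ n <= 1 + y + ... + y ^ n <= 1 / (1 - y)]. *)
Lemma poly_geometric_bounded m (x : R) : 0 < x < 1 ->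
  exists2 K, 0 < K & forall n, n.+1%:R ^+ m * x ^+ n <= K.
Proof.
elim: m x => [|m IH] x x01; move: (x01) => /andP[x0 x1].
  by exists 1 => // n; rewrite expr0 mul1r exprn_ile1// ltW.
pose y := Num.sqrt x.
have y0 : 0 < y by rewrite sqrtr_gt0.
have yy : y ^+ 2 = x by rewrite sqr_sqrtr// ltW.
have y1 : y < 1 by rewrite -(@ltr_pXn2r _ 2) ?nnegrE ?(ltW y0)// yy expr1n.
have [K K0 hK] := IH y (introT andP (conj y0 y1)).
have z0 : 0 < (1 - y)^-1 by rewrite invr_gt0; lra.
exists (K * (1 - y)^-1); first exact: mulr_gt0.
move=> n; rewrite -yy exprAC expr2 exprS.
have -> : n.+1%:R * n.+1%:R ^+ m * (y ^+ n * y ^+ n) =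
  (n.+1%:R ^+ m * y ^+ n) * (n.+1%:R * y ^+ n) by ring.
apply: ler_pM => //; rewrite ?mulr_ge0 ?exprn_ge0 ?ler0n ?(ltW y0)//.
rewrite (le_trans _ (@geometric_sum_le y n.+1 _)) ?(ltW y0)//.
apply: (@le_trans _ _ (\sum_(k < n.+1) y ^+ n)).
  by rewrite sumr_const card_ord mulr_natl.
apply: ler_sum => k _; apply: ler_wiXn2l; rewrite ?(ltW y0) ?(ltW y1)//.
by rewrite -ltnS.
Qed.

Fixpoint spow s n : seq (C * V) := if n is k.+1 then ev_prod s (spow s k) else [:: (1, 0)].

Lemma spowE s n phi : ev (spow s n) phi = pow_fun (ev s) n phi.
Proof.
elim: n phi => [|n IH] phi; first by rewrite /= /ev big_seq1 mul1r.
rewrite /= ev_prodE /conv_fun; congr (ev s); apply/funext => u.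
exact: IH.
Qed.

(** Addition is commutative, so a sum of [n] frequencies depends only on how often each position of
    [s] is used. Multiplicities in [0 .. n] give [(n + 1) ^ m] candidates instead of [m ^ n]. *)
Definition spow_freqs s n : seq V :=
  [seq \sum_(i < size s) (nth (0, 0) s i).2 *+ (a i : nat) |
    a : {ffun 'I_(size s) -> 'I_n.+1}].

Lemma size_spow_freqs s n : size (spow_freqs s n) = (n.+1 ^ size s)%N.
Proof. by rewrite size_map -cardE card_ffun !card_ord. Qed.

Lemma spow_freqsP s n p : p \in spow s n -> p.2 \in spow_freqs s n.
Proof.
move=> ps; suff [a [an ->]] : exists a : 'I_(size s) -> nat, (forall i, a i <= n)%N /\
    p.2 = \sum_(i < size s) (nth (0, 0) s i).2 *+ a i.
  apply/mapP; exists [ffun i => inord (a i)]; first by rewrite mem_enum.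
  by apply: eq_bigr => i _; rewrite ffunE inordK// ltnS.
elim: n p ps => [|n IH] p /=.
  rewrite inE => /eqP ->; exists (fun=> 0%N); split => //=.
  by rewrite big1.
move=> /allpairsP[[q r] /= [qs /IH[a [an ra]] ->]] /=.
have iq : (index q s < size s)%N by rewrite index_mem.
exists (fun j => a j + (j == Ordinal iq))%N; split.
  by move=> i; apply: leq_trans (leq_add (an i) (leq_b1 _)) _; rewrite addn1.
under eq_bigr do rewrite mulrnDr.
rewrite big_split/= -ra addrC; congr (_ + _).
rewrite (bigD1 (Ordinal iq))//= eqxx mulr1n nth_index// big1 ?addr0// => i ne.
by rewrite (negbTE ne) mulr0n.
Qed.

(* Spectral radius: a polynomial [s] with [m] frequencies approximates [L], and
   [s ^ k] has at most [(k + 1) ^ m] frequencies, so its norm is at most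
   [(k + 1) ^ m] times its supremum. The bound is carried over to
   [s ^ k * L ^ n] by induction on [n], writing [L = s + (L - s)]. *)
Lemma nle_pow_geometric M L (rho : R) : subgroup M -> apx M L -> 0 <= rho < 1 ->
  (forall t, nc (L (echar t)) <= rho) ->
  exists K sg, [/\ 0 < K, 0 < sg < 1 & forall n, nle (pow_fun L n) (K * sg ^+ n)].
Proof.
(* Four steps of size [e] lead from [rho] to 1: [rho + e] bounds the transform of [s], [rho + 2 e]
   absorbs the polynomial factor, [rho + 3 e] absorbs the error [L - s], and the last keeps the
   ratio below 1. *)
move=> Mg hL /andP[r0 r1] hrho; pose e := (1 - rho) / 4.
have e0 : 0 < e by rewrite divr_gt0//; lra.
have eE : rho + 4 * e = 1 by rewrite /e; field.
have [s sM hs] := hL _ e0.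
have sr t : nc (ev s (echar t)) <= rho + e.
  rewrite -(subrK (L (echar t)) (ev s _)) (le_trans (ncD _ _))// addrC lerD//.
  by rewrite ncC (le_trans (hs _ _ (bnd_echar t)))// mulr1.
pose x := (rho + e) / (rho + 2 * e).
have x01 : 0 < x < 1.
  apply/andP; split; first by rewrite divr_gt0//; lra.
  by rewrite ltr_pdivrMr; lra.
have [K K0 hK] := poly_geometric_bounded (size s) x01.
have sA := ev_apx sM.
have pk k : nle (pow_fun (ev s) k) (K * (rho + 2 * e) ^+ k).
  apply: (@nle_eq _ _ (ev (spow s k))); first by move=> phi B _; exact: spowE.
  have hk t : nc (ev (spow s k) (echar t)) <= (rho + e) ^+ k.
    rewrite spowE (pow_echar _ _ Mg sA) ncX.
    by apply: lerXn2r; rewrite ?nnegrE ?nc_ge0//; lra.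
  apply: nle_le (ev_norm_le (@spow_freqsP s k) hk).
  rewrite size_spow_freqs natrX.
  have -> : (rho + e) ^+ k = x ^+ k * (rho + 2 * e) ^+ k.
    by rewrite -exprMn /x divfK// gt_eqF//; lra.
  by rewrite mulrA ler_wpM2r// exprn_ge0//; lra.
exists K, (rho + 3 * e); split => //; first by apply/andP; split; lra.
have main n : forall k, nle (conv_fun (pow_fun (ev s) k) (pow_fun L n))
    (K * (rho + 2 * e) ^+ k * (rho + 3 * e) ^+ n).
  elim: n => [|n IH] k.
    apply: (nle_eq _ (_ : nle (pow_fun (ev s) k) _)); last first.
      by rewrite expr0 mulr1; exact: pk.
    move=> phi B _; rewrite /conv_fun/= /delta_fun; congr pow_fun.
    by apply/funext => u; rewrite addr0.
  pose Y := conv_fun (pow_fun (ev s) k) (pow_fun L n).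
  pose Z := conv_fun (pow_fun (ev s) k.+1) (pow_fun L n).
  pose dl := add_fun L (scale_fun (-1) (ev s)).
  have adl : apx M dl by apply: apx_add => //; exact: apx_scale.
  have ndl : nle dl e.
    by move=> phi B hB; rewrite /dl /add_fun /scale_fun mulN1r hs.
  have aY : apx M Y by apply: apx_conv => //; exact: apx_pow.
  have aZ : apx M Z by apply: apx_conv => //; exact: apx_pow.
  have aW : apx M (conv_fun dl Y) by exact: apx_conv.
  have aT : apx M (add_fun Z (conv_fun dl Y)) by exact: apx_add.
  have aX : apx M (conv_fun (pow_fun (ev s) k) (pow_fun L n.+1)).
    by apply: apx_conv => //; exact: apx_pow.
  apply: (@nle_eq _ _ (add_fun Z (conv_fun dl Y))).
    move=> phi B hB; apply: (apx_eq aT aX) hB => t.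
    have PE i j : conv_fun (pow_fun (ev s) i) (pow_fun L j) (echar t) =
        ev s (echar t) ^+ i * L (echar t) ^+ j.
      rewrite (conv_echar _ (apx_pow i Mg sA) (apx_pow j Mg hL)).
      by rewrite (pow_echar _ _ Mg sA) (pow_echar _ _ Mg hL).
    rewrite /add_fun (conv_echar _ adl aY) /Z /Y !PE.
    by rewrite /dl /add_fun /scale_fun !exprS; ring.
  apply: nle_le (nle_add (IH k.+1) (nle_conv ndl (IH k))).
  by rewrite !exprS le_eqVlt; apply/orP; left; apply/eqP; ring.
move=> n; apply: (nle_eq _ (_ : nle (conv_fun (pow_fun (ev s) 0) (pow_fun L n)) _)).
  move=> phi B _; rewrite /conv_fun/= /delta_fun; congr pow_fun.
  by apply/funext => u; rewrite add0r.
by have := main n 0%N; rewrite expr0 mulr1.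
Qed.

Definition power_series_fun (al : nat -> C) L : functional :=
  fun phi => csum setT (fun n => al n * pow_fun L n phi).

Lemma nnsummable_power (al : nat -> C) (K : nat -> R) Q :
  (forall n, 0 <= K n) -> (forall n, \sum_(k < n) nc (al k) * K k <= Q) ->
  nnsummable setT (fun n => nc (al n) * K n).
Proof.
by move=> K0 h; apply: (nnsummable_nat (M := Q)) => // k; rewrite mulr_ge0 ?nc_ge0.
Qed.

Lemma apx_power_series M L (al : nat -> C) (K : nat -> R) Q : subgroup M -> apx M L ->
  (forall n, nle (pow_fun L n) (K n)) -> (forall n, 0 <= K n) ->
  (forall n, \sum_(k < n) nc (al k) * K k <= Q) ->
  apx M (power_series_fun al L).
Proof.
move=> Mg hL hK K0 hQ.
apply: (apx_csum (F := fun n => scale_fun (al n) (pow_fun L n)) (nnsummable_power K0 hQ)).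
  by move=> k _; apply: apx_scale; exact: apx_pow.
by move=> k _; apply: nle_scale.
Qed.

Lemma nle_power_series M L (al : nat -> C) (K : nat -> R) Q : subgroup M -> apx M L ->
  (forall n, nle (pow_fun L n) (K n)) -> (forall n, 0 <= K n) ->
  (forall n, \sum_(k < n) nc (al k) * K k <= Q) ->
  nle (power_series_fun al L) Q.
Proof.
move=> Mg hL hK K0 hQ; have NS := nnsummable_power K0 hQ.
apply: (nle_csum (F := fun n => scale_fun (al n) (pow_fun L n)) NS).
  by move=> k _; apply: nle_scale.
move=> D uD _.
have N0 k : 0 <= nc (al k) * K k by rewrite mulr_ge0 ?nc_ge0.
have [n h] := sum_seq_le_ord N0 uD.
exact: le_trans h (hQ n).
Qed.

Lemma power_series_echar M L (al : nat -> C) (K : nat -> R) Q t z :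
  subgroup M -> apx M L ->
  (forall n, nle (pow_fun L n) (K n)) -> (forall n, 0 <= K n) ->
  (forall n, \sum_(k < n) nc (al k) * K k <= Q) ->
  (forall e : R, 0 < e -> exists n0, forall n, (n0 <= n)%N ->
     nc (z - \sum_(k < n) al k * L (echar t) ^+ k) <= e) ->
  power_series_fun al L (echar t) = z.
Proof.
move=> Mg hL hK K0 hQ hz; apply: (csum_nat_unique (nnsummable_power K0 hQ)).
  by move=> k; rewrite ncM ler_wpM2l ?nc_ge0// nle_echar.
move=> e /hz[n0 h]; exists n0 => n /h.
by under [in X in _ -> X]eq_bigr do rewrite (pow_echar _ _ Mg hL).
Qed.

Lemma geometric_small (A x e : R) : 0 <= A -> 0 <= x < 1 -> 0 < e ->
  exists n0, forall n, (n0 <= n)%N -> A * x ^+ n <= e.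
Proof.
move=> A0 /andP[x0 x1] e0.
have : (fun n => A * x ^+ n) @ \oo --> A * 0.
  by apply: cvgMr; apply: cvg_expr; rewrite ger0_norm.
rewrite mulr0 => /cvgrPdist_le /(_ _ e0)[n0 _ h].
exists n0 => n n0n; have := h n n0n; rewrite /= sub0r normrN ger0_norm//.
by rewrite mulr_ge0// exprn_ge0.
Qed.

(** The Neumann series converges although the norm of [L] itself may exceed 1: only the norms of the
    powers have to be summable. *)
Lemma exists_inverse_one_minus M L (rho : R) : subgroup M -> apx M L -> 0 <= rho < 1 ->
  (forall t, nc (L (echar t)) <= rho) ->
  exists2 X, apx M X & forall t, X (echar t) = (1 - L (echar t))^-1.
Proof.
move=> Mg hL r01 hrho.
have [K [sg [K0 s01 hK]]] := nle_pow_geometric Mg hL r01 hrho.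
have s01' : 0 <= sg < 1 by case/andP: s01 => /ltW -> ->.
pose Kn n := K * sg ^+ n.
have Kn0 n : 0 <= Kn n.
  by rewrite mulr_ge0 ?(ltW K0) ?exprn_ge0//; case/andP: s01'.
have hQ n : \sum_(k < n) nc 1 * Kn k <= K * (1 - sg)^-1.
  under eq_bigr do rewrite nc1 mul1r.
  by rewrite -mulr_sumr ler_wpM2l ?(ltW K0)// geometric_sum_le.
exists (power_series_fun (fun=> 1) L); first exact: apx_power_series hL hK Kn0 hQ.
move=> t; apply: (power_series_echar Mg hL hK Kn0 hQ) => e e0.
set z := L (echar t).
have z1 : nc z < 1 by rewrite (le_lt_trans (hrho t))//; case/andP: r01.
have z1' : 0 < nc (1 - z).
  by have := ncB_ge 1 z; rewrite nc1; lra.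
have nz : 1 - z != 0.
  by apply: contraTneq z1' => ->; rewrite nc0 ltxx.
have A0 : 0 <= (nc (1 - z))^-1 by rewrite invr_ge0 nc_ge0.
have zz : 0 <= nc z < 1 by rewrite nc_ge0.
have [n0 h] := geometric_small A0 zz e0; exists n0 => n /h; apply: le_trans.
have -> : \sum_(k < n) 1 * z ^+ k = (1 - z)^-1 * (1 - z ^+ n).
  apply: (mulfI nz); rewrite mulrA divff// mul1r.
  elim: n => [|n IH]; first by rewrite big_ord0 expr0 subrr mulr0.
  by rewrite big_ord_recr/= mulrDr IH exprS; ring.
have -> : (1 - z)^-1 - (1 - z)^-1 * (1 - z ^+ n) = (1 - z)^-1 * z ^+ n by ring.
by rewrite ncM ncV ncX.
Qed.

(** [1 / f = conj f / |f|^2], where [conj f] is the transform of the reflected functional and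
    [1 - |f|^2] has supremum at most [1 - c^2 < 1]. *)
Lemma exists_inverse M L (c : R) : subgroup M -> apx M L -> 0 < c ->
  (forall t, L (echar (- t)) = (L (echar t))^*%C) ->
  (forall t, c <= nc (L (echar t)) <= 1) ->
  exists2 X, apx M X & forall t, X (echar t) = (L (echar t))^-1.
Proof.
move=> Mg hL c0 hr hc.
have aR := apx_refl Mg hL.
pose Q := conv_fun L (refl_fun L).
have aQ : apx M Q by exact: apx_conv.
have QE t : Q (echar t) = (nc (L (echar t)) ^+ 2)%:C.
  by rewrite /Q (conv_echar _ hL aR) refl_echar hr mul_conj.
pose r := add_fun (delta_fun 0) (scale_fun (-1) Q).
have ar : apx M r.
  apply: apx_add; first by apply: apx_delta; case: Mg.
  exact: apx_scale.
have rE t : r (echar t) = (1 - nc (L (echar t)) ^+ 2)%:C.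
  by rewrite /r /add_fun /scale_fun /delta_fun echar0r QE mulN1r rmorphB.
have c1 : c <= 1 by have /andP[h1 h2] := hc 0; exact: le_trans h1 h2.
have r01 : 0 <= 1 - c ^+ 2 < 1.
  apply/andP; split; first by rewrite subr_ge0 exprn_ile1// ltW.
  by rewrite ltrBlDr ltrDl exprn_gt0.
have [|X aX XE] := exists_inverse_one_minus Mg ar r01.
  move=> t; rewrite rE ncR; have /andP[h1 h2] := hc t.
  rewrite ger0_norm ?subr_ge0 ?exprn_ile1 ?nc_ge0// lerB//.
  by apply: lerXn2r; rewrite ?nnegrE ?nc_ge0// ltW.
exists (conv_fun (refl_fun L) X); first exact: apx_conv.
move=> t; rewrite (conv_echar _ aR aX) XE refl_echar hr rE.
set z := L (echar t).
have nz : z != 0.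
  apply/eqP => z0; have := hc t; rewrite -/z z0 nc0 => /andP[h _]; lra.
have -> : 1 - (1 - nc z ^+ 2)%:C = z * z^*%C.
  by rewrite mul_conj rmorphB/= opprB addrCA subrr addr0.
rewrite invfM mulrCA divff ?mulr1//.
apply: contra nz => /eqP h; apply/eqP; apply: nc_eq0.
by rewrite -nc_conj h nc0.
Qed.

(** Norm at most [1 / 2] bounds the terms of the logarithmic series by [2 ^ - k], [k >= 1], whence
    the norm bound 1. *)
Lemma exists_log M L : subgroup M -> apx M L -> nle L (1 / 2) ->
  exists X, [/\ apx M X, nle X 1 & forall t, cexp (X (echar t)) = 1 + L (echar t)].
Proof.
move=> Mg hL hN.
pose al n : C := if n is k.+1 then (-1) ^+ k / k.+1%:R else 0.
pose Kn n : R := (1 / 2) ^+ n.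
have hK n : nle (pow_fun L n) (Kn n) by exact: nle_pow.
have h2 : 0 <= 1 / 2 :> R by lra.
have Kn0 n : 0 <= Kn n by rewrite exprn_ge0.
have hQ n : \sum_(k < n) nc (al k) * Kn k <= 1.
  case: n => [|n]; first by rewrite big_ord0.
  rewrite big_ord_recl/= nc0 mul0r add0r.
  apply: (@le_trans _ _ (\sum_(k < n) (1 / 2) ^+ k.+1)).
    apply: ler_sum => k _; rewrite /bump/= add1n/= ler_piMl ?exprn_ge0//.
    rewrite ncM ncX ncN nc1 expr1n mul1r ncV ncn invf_le1 ?ler1n ?ltr0n//.
  by rewrite sum_half_powers lerBlDr lerDl exprn_ge0.
have NS := nnsummable_power Kn0 hQ.
exists (power_series_fun al L); split.
- exact: apx_power_series hL hK Kn0 hQ.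
- exact: nle_power_series hL hK Kn0 hQ.
move=> t; set z := L (echar t).
have z2 : nc z <= 1 / 2 by exact: nle_echar.
set w := power_series_fun al L (echar t).
pose ps n := \sum_(k < n) (-1) ^+ k * z ^+ k.+1 / k.+1%:R.
(* [exp w] is compared with the exponentials of the partial sums [ps n]. *)
have wps e : 0 < e -> exists n0, forall n, (n0 <= n)%N -> nc (w - ps n) <= e.
  move=> e0; have [D [uD _ hD]] := csum_approx NS e0.
  pose n0 := (\max_(k <- D) k).+1.
  exists n0 => n n0n.
  (* Since [al 0 = 0], the partial sum [ps n] corresponds to the first [n + 1] terms. *)
  have := hD (iota 0 n.+1) (iota_uniq _ _) (fun k _ => ltac:(by rewrite inE)).
  have sD : {subset D <= iota 0 n.+1}.
    move=> k kD; rewrite mem_iota add0n ltnS (leq_trans _ (ltnW n0n))//.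
    by rewrite (@leq_bigmax_seq _ D xpredT id).
  move=> /(_ sD (fun n => al n * pow_fun L n (echar t)) 1 ler01).
  rewrite mulr1 => h.
  have -> : ps n = \sum_(k <- iota 0 n.+1) al k * pow_fun L k (echar t).
    rewrite -{1}(subn0 n.+1) -/(index_iota 0 n.+1) big_mkord.
    rewrite big_ord_recl/= mul0r add0r; apply: eq_bigr => k _.
    by rewrite -[conv_fun L _ _]/(pow_fun L k.+1 _) (pow_echar _ _ Mg hL) mulrAC.
  apply: h => k _; rewrite mulr1 ncM ler_wpM2l ?nc_ge0// nle_echar//.
apply/eqP; rewrite -subr_eq0; apply/eqP; apply: nc_small_eq0 => e e0.
(* [1 + z = exp (ps n) + O(2^-n)] and [exp w / exp (ps n)] is close to 1. *)
have E1 n : nc (cexp (- ps n) * (1 + z) - 1) <= 2 * (expR 1 * (1 / 2) ^+ n.+1).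
  exact: cexp_log_series_le.
have Eps n : nc (cexp (ps n)) <= expR 1.
  rewrite nc_cexp ler_expR (le_trans (ler_norm _))// (le_trans (nc_Re _))//.
  exact: nc_log_term.
pose E := expR 1 : R; have E0 : 0 < E := expR_gt0 1.
(* The total error will be [2 E^2 e1 + 2 E^2 2^-(n+1)], and each half is made at most [e / 2]. The
   minimum with [1 / 2] keeps the exponents below 1, so that [E] bounds their exponentials. *)
pose e1 := Num.min (1 / 2) (e / (4 * E * E)).
have e10 : 0 < e1.
  rewrite lt_min; apply/andP; split; first by lra.
  by rewrite divr_gt0// !mulr_gt0.
have [n1 hn1] := wps _ e10.
have A0 : 0 <= 2 * E * E by rewrite !mulr_ge0// ltW.
have ee : 0 < e / 2 by rewrite divr_gt0.
have [n2 hn2] := geometric_small A0 (introT andP (conj h2 (ltac:(lra) : 1 / 2 < 1 :> R))) ee.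
pose n := maxn n1 n2; have h1 := hn1 n (leq_maxl _ _).
have h3 := hn2 n.+1 (leq_trans (leq_maxr _ _) (leqnSn _)).
have hexp : nc (cexp (w - ps n) - 1) <= 2 * (E * e1).
  have := @cmean_value_le R (fun x : R => cexp (x%:C * (w - ps n)))
     (fun x : R => (w - ps n) * cexp (x%:C * (w - ps n))) (E * e1).
  rewrite mul1r mul0r cexp0; apply => x x01.
    apply: cderiv_cexp; apply: cderiv_eq.
      exact: cderivM (cderiv_real x) (cderiv_cst _ x).
    by rewrite mulr0 addr0 mul1r.
  rewrite ncM mulrC ler_pM ?nc_ge0// nc_cexp ler_expR.
  rewrite (le_trans (ler_norm _))// (le_trans (nc_Re _))// ncM ncR.
  move/andP: x01 => [x0 x1]; rewrite ger0_norm// (le_trans (ler_piMl _ _))//.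
    exact: nc_ge0.
  by rewrite (le_trans h1)// /e1 ge_min; apply/orP; left; lra.
have -> : cexp w - (1 + z) = cexp (ps n) * ((cexp (w - ps n) - 1) -
   (cexp (- ps n) * (1 + z) - 1)).
  have cc : cexp (ps n) * cexp (- ps n) = 1 by rewrite -cexpD subrr cexp0.
  have -> : cexp w = cexp (ps n) * cexp (w - ps n) by rewrite -cexpD addrC subrK.
  rewrite -{1}[1 + z]mul1r -{1}cc; ring.
rewrite ncM; apply: (@le_trans _ _ (E * (2 * (E * e1) + 2 * (E * (1 / 2) ^+ n.+1)))).
  rewrite ler_pM ?nc_ge0// (le_trans (ncB _ _))// lerD//; exact: E1.
have : 2 * E * E * e1 <= e / 2.
  apply: (@le_trans _ _ (2 * E * E * (e / (4 * E * E)))).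
    by rewrite ler_wpM2l// /e1 ge_min lexx orbT.
  by rewrite le_eqVlt; apply/orP; left; apply/eqP; field; rewrite gt_eqF.
move: h3; set y := (1 / 2) ^+ n.+1 => h3 h4.
have -> : E * (2 * (E * e1) + 2 * (E * y)) = 2 * E * E * e1 + 2 * E * E * y by ring.
lra.
Qed.

Definition exp_fun L : functional := power_series_fun (fun n => (n`!%:R)^-1) L.

Lemma exp_coeff_sum_le (x : R) n : 0 <= x ->
  \sum_(k < n) nc ((k`!%:R)^-1 : C) * x ^+ k <= expR x.
Proof.
move=> x0; under eq_bigr do rewrite ncV ncn mulrC.
have h := @is_cvg_series_exp_coeff_pos R.
have := @nondecreasing_cvgn_le R (series (exp_coeff x)).
move=> /(_ _ _ n) => H.
have := H; rewrite /series/= big_mkord; apply.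
  by apply: nondecreasing_series => k _ _; rewrite exp_coeff_ge0.
exact: is_cvg_series_exp_coeff.
Qed.

Lemma apx_exp M L : subgroup M -> apx M L -> apx M (exp_fun L).
Proof.
move=> Mg hL; have [N N0 hN] := apx_nle hL.
apply: (apx_power_series Mg hL (fun n => nle_pow n hN)).
  by move=> n; rewrite exprn_ge0.
by move=> n; exact: exp_coeff_sum_le.
Qed.

Lemma exp_echar M L t : subgroup M -> apx M L ->
  exp_fun L (echar t) = cexp (L (echar t)).
Proof.
move=> Mg hL; have [N N0 hN] := apx_nle hL.
apply: (power_series_echar Mg hL (fun n => nle_pow n hN)).
- by move=> n; rewrite exprn_ge0.
- by move=> n; exact: exp_coeff_sum_le.
move=> e e0; set z := L (echar t).
pose A := 2 * expR (nc z) * nc z * expR (nc z).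
have A0 : 0 <= A by rewrite !mulr_ge0 ?expR_ge0 ?nc_ge0.
have A1 : 0 < A + 1 by lra.
have /cvgrPdist_le /(_ _ (divr_gt0 e0 A1)) [n0 _ h] := cvg_exp_coeff (nc z).
exists n0.+1 => -[//|n] n0n; rewrite ncC.
under eq_bigr do rewrite mulrC.
rewrite (le_trans (cexp_series_le _ _))//.
have := h n n0n; rewrite /= sub0r normrN ger0_norm ?exp_coeff_ge0 ?nc_ge0// => hn.
have -> : 2 * (expR (nc z) * nc z * (nc z ^+ n / n`!%:R)) * expR (nc z) =
  A * (nc z ^+ n / n`!%:R) by rewrite /A; ring.
rewrite (le_trans (ler_wpM2l A0 hn))// mulrCA ler_piMr ?(ltW e0)//.
by rewrite ler_pdivrMr// mul1r; lra.
Qed.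

End wiener.

(** * The logarithm of a characteristic function bounded away from zero *)

Section logarithm.
Variables (R : realType) (d : nat).
Local Notation C := R[i].
Local Notation nc := (@Normc.normc R).
Local Notation V := 'rV[R]_d.
Local Notation functional := ((V -> C) -> C).
Implicit Types (t u v w h : V) (M : set V) (L X Y : functional)
  (phi psi : V -> C) (B N eps : R).
Local Arguments Normc.normc : simpl never.

Definition sub_fun L X := add_fun L (scale_fun (-1) X).

Lemma sub_funE L X phi : sub_fun L X phi = L phi - X phi.
Proof. by rewrite /sub_fun /add_fun /scale_fun mulN1r. Qed.

Lemma apx_sub M L X : apx M L -> apx M X -> apx M (sub_fun L X).
Proof. by move=> hL hX; apply: apx_add => //; exact: apx_scale. Qed.

Lemma small_divisor h (b : R) : 0 < b ->
  exists n (k : V), h = k *+ n.+1 /\ forall j, `|k ord0 j| <= b.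
Proof.
move=> b0; pose S := \sum_(j < d) `|h ord0 j|.
have S0 : 0 <= S by apply: sumr_ge0.
have /andP[_ hn] := truncn_itv (divr_ge0 S0 (ltW b0)).
set n := Num.truncn _ in hn; exists n, ((n.+1%:R^-1 : R) *: h); split.
  by rewrite -scaler_nat scalerA divff ?scale1r// pnatr_eq0.
move=> j; rewrite mxE normrM ger0_norm ?invr_ge0 ?ler0n// mulrC.
rewrite ler_pdivrMr ?ltr0n// mulrC -ler_pdivrMr//; apply: ltW; apply: le_lt_trans hn.
by rewrite ler_wpM2r ?invr_ge0 ?(ltW b0)// /S (bigD1 j)//= lerDl sumr_ge0.
Qed.

(* [X (echar t)] is uniformly continuous in [t] and [2 pi i Z] is discrete. *)
Lemma cexp_eq1_const M X : apx M X -> (forall t, cexp (X (echar t)) = 1) ->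
  forall t, X (echar t) = X (echar 0).
Proof.
move=> hX h t.
have [b b0 hb] := transl_small hX ltr01.
have step (k s : V) : (forall j, `|k ord0 j| <= b) -> X (echar (s + k)) = X (echar s).
  move=> /hb hk; apply/eqP; rewrite -subr_eq0; apply/eqP; apply: cexp_eq1.
    by rewrite cexpB !h divr1.
  have := nle_echar s hk; rewrite -/(sub_fun _ _) sub_funE transl_echar; lra.
have [n [k [-> hk]]] := small_divisor t b0.
elim: (n.+1) => [|m IH]; first by rewrite mulr0n.
by rewrite mulrSr step.
Qed.

Lemma const_transform_coef M X (kap : C) u : M 0 -> apx M X ->
  (forall t, X (echar t) = kap) -> u != 0 -> X (ind u) = 0.
Proof.
move=> M0 hX h u0.
have := @apx_char_uniq _ _ M (sub_fun X (scale_fun kap (delta_fun 0))) (ind u) 1.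
move=> /(_ (apx_sub hX (apx_scale kap (apx_delta M0)))).
rewrite !sub_funE /scale_fun /delta_fun /ind eq_sym (negbTE u0) mulr0 subr0; apply.
  by move=> t; rewrite sub_funE h echar0r mulr1 subrr.
exact: bnd_ind.
Qed.

Lemma single_coef_transform M X t : M 0 -> apx M X ->
  (forall u, u != 0 -> X (ind u) = 0) -> X (echar t) = X (ind 0).
Proof.
move=> M0 hX h.
have := @apx_coef_uniq _ _ M (sub_fun X (scale_fun (X (ind 0)) (delta_fun 0))) (echar t) 1.
move=> /(_ (apx_sub hX (apx_scale _ (apx_delta M0)))).
rewrite sub_funE /scale_fun /delta_fun echar0r mulr1 => H.
apply/eqP; rewrite -subr_eq0; apply/eqP; apply: H; last exact: bnd_echar.
move=> w _; rewrite sub_funE /scale_fun /delta_fun; have [->|w0] := eqVneq w 0.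
  by rewrite [ind 0 0]/ind eqxx mulr1 subrr.
by rewrite h// /ind eq_sym (negbTE w0) mulr0 subr0.
Qed.

Lemma transl_ind h X u M : apx M X -> transl h X (ind u) = echar h u * X (ind u).
Proof.
move=> hX; rewrite -(apxZr _ hX (bnd_ind u)); congr X; apply/funext => v.
by rewrite /ind; case: eqP => [->//|_]; rewrite !mulr0.
Qed.

Lemma conjM (a b : C) : (a * b)^*%C = a^*%C * b^*%C.
Proof. exact: rmorphM. Qed.

Lemma conjB (a b : C) : (a - b)^*%C = a^*%C - b^*%C.
Proof. exact: rmorphB. Qed.

Lemma csum_conj (T : choiceType) (A : set T) (N : T -> R) (g : T -> C) :
  nnsummable A N -> (forall k, A k -> nc (g k) <= N k) ->
  csum A (fun k => (g k)^*%C) = (csum A g)^*%C.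
Proof.
move=> NS gN; apply: (csum_unique NS) => [k Ak|e D e0 uD DA].
  by rewrite nc_conj gN.
have [D' [uD' D'A h]] := csum_approx NS e0.
exists (undup (D ++ D')).
have sA : {subset undup (D ++ D') <= A}.
  by move=> k; rewrite mem_undup mem_cat => /orP[/DA|/D'A].
split => //; first exact: undup_uniq.
  by move=> k kD; rewrite mem_undup mem_cat kD.
have := h _ (undup_uniq _) sA _ g 1 ler01 (fun k Ak => ltac:(rewrite mulr1; exact: gN)).
rewrite mulr1 => /(_ (fun k kD => ltac:(by rewrite mem_undup mem_cat kD orbT))).
by rewrite -nc_conj rmorphB/= rmorph_sum.
Qed.

Section coefficient_family.
Variables (M A : set V) (c : V -> C).
Hypotheses (Mg : subgroup M) (AM : A `<=` M) (cS : nnsummable A (fun u => nc (c u))).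

Definition coef_fun : functional := fun phi => csum A (fun u => c u * phi u).

Lemma apx_coef_fun : apx M coef_fun.
Proof.
apply: (apx_csum (F := fun u => scale_fun (c u) (delta_fun u)) cS).
  by move=> u /AM Mu; apply: apx_scale; exact: apx_delta.
by move=> u _; have := nle_scale (c u) (nle_delta u); rewrite mulr1.
Qed.

Lemma coef_fun_ind u : A u -> coef_fun (ind u) = c u.
Proof.
move=> Au; apply: (csum_unique cS) => [v _|e D e0 uD DA].
  by rewrite ncM -[leRHS]mulr1 ler_wpM2l ?nc_ge0// bnd_ind.
exists (undup (u :: D)); split; first exact: undup_uniq.
- by move=> v; rewrite mem_undup inE => /orP[/eqP ->|/DA]; rewrite ?inE.
- by move=> v vD; rewrite mem_undup inE vD orbT.
rewrite (bigD1_seq u) ?undup_uniq ?mem_undup ?mem_head//= {1}/ind eqxx mulr1.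
rewrite big1 ?addr0 ?subrr ?nc0 ?(ltW e0)// => v vu.
by rewrite /ind (negbTE vu) mulr0.
Qed.

End coefficient_family.

(** * Logarithms of the quotients [f(. + h) / f] and their coefficients *)

Section representation.
Variables (M : set V) (L : functional) (c0 : R).
Hypotheses (Mg : subgroup M) (hL : apx M L) (c00 : 0 < c0)
  (L1 : L (echar 0) = 1)
  (LC : forall t, L (echar (- t)) = (L (echar t))^*%C)
  (Lb : forall t, c0 <= nc (L (echar t)) <= 1).

Local Notation f t := (L (echar t)).

Let M0 : M 0. Proof. by case: Mg. Qed.

Lemma transform_neq0 t : f t != 0.
Proof. by apply/eqP => h; have := Lb t; rewrite h nc0 leNgt c00. Qed.

Definition is_log h X := apx M X /\ forall t, cexp (X (echar t)) = f (t + h) / f t.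

(** [f(. + h) / f - 1] is [f(. + h) - f] times [1 / f], of norm at most [eps * N]; this [eps] brings
    it into the range of [exists_log]. The [+ 1] keeps the divisor positive. *)
Lemma exists_good_eps : exists2 eps, 0 < eps & forall h,
  nle (sub_fun (transl h L) L) eps -> exists2 X, is_log h X & nle X 1.
Proof.
have [I hI IE] := exists_inverse Mg hL c00 LC Lb.
have [N N0 hN] := apx_nle hI.
have N1 : 0 < 2 * (N + 1) by rewrite mulr_gt0//; lra.
exists (2 * (N + 1))^-1; first by rewrite invr_gt0.
move=> h hh; pose r := conv_fun (sub_fun (transl h L) L) I.
have aT : apx M (sub_fun (transl h L) L).
  by apply: apx_sub => //; exact: apx_transl.
have ar : apx M r by exact: apx_conv.
have nr : nle r (1 / 2).
  apply: nle_le (nle_conv hh hN).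
  by rewrite mulrC ler_pdivrMr//; lra.
have [X [aX nX XE]] := exists_log Mg ar nr.
exists X => //; split => // t; rewrite XE /r (conv_echar _ aT hI) IE sub_funE transl_echar.
by field; exact: transform_neq0.
Qed.

(** The quotient for [h + k] at [t] is the one for [h] at [t + k] times the one for [k] at [t]; the
    translate of [X] is the twist in the cocycle relation. *)
Lemma is_logD h (k : V) X Y : is_log h X -> is_log k Y ->
  is_log (h + k) (add_fun (transl k X) Y).
Proof.
move=> [aX XE] [aY YE]; split; first by apply: apx_add => //; exact: apx_transl.
move=> t; rewrite /add_fun transl_echar cexpD XE YE.
rewrite [h + k]addrC addrA; have := transform_neq0 (t + k); have := transform_neq0 t.
by move=> n1 n2; field; rewrite n1.
Qed.

Lemma exists_is_log h : exists X, is_log h X.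
Proof.
have [eps e0 heps] := exists_good_eps.
have [b b0 hb] := transl_small hL e0.
have [n [k [-> hk]]] := small_divisor h b0.
have [X hX _] := heps k (hb _ hk).
elim: n => [|n [Y hY]]; first by exists X; rewrite mulr1n.
by exists (add_fun (transl (k *+ n.+1) X) Y); rewrite mulrS; exact: is_logD.
Qed.

(** Two logarithms of the same function differ by a constant, which affects frequency 0 only. *)
Lemma is_log_coef h X Y u : is_log h X -> is_log h Y -> u != 0 ->
  X (ind u) = Y (ind u).
Proof.
move=> [aX XE] [aY YE] u0; apply/eqP; rewrite -subr_eq0 -sub_funE; apply/eqP.
have aD := apx_sub aX aY.
apply: (const_transform_coef M0 aD _ u0 (kap := sub_fun X Y (echar 0))).
apply: (cexp_eq1_const aD) => t.
rewrite sub_funE cexpB XE YE divff//.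
by rewrite mulf_neq0 ?invr_eq0 ?transform_neq0.
Qed.

(** Let [x(h)] be the coefficient at [u] and [e_h = exp(i <h, u>)]. Composing the steps [h] and [k]
    in both orders gives [e_k x(h) + x(k) = e_h x(k) + x(h)], so [x(h) (e_k - 1) = x(k) (e_h - 1)].
    The choice [k u] makes [e_k = -1], so the division is by [-2]. *)
Lemma log_coefficients : exists c : V -> C,
  [/\ c 0 = 0, forall u, ~ M u -> c u = 0 &
      forall h X u, is_log h X -> u != 0 -> X (ind u) = c u * (echar h u - 1)].
Proof.
pose k u : V := (pi / dotp u u) *: u.
have [Z hZ] := choice exists_is_log.
have ek u : u != 0 -> echar (k u) u = -1.
  move=> u0; rewrite /echar /k dotpZl divfK ?gt_eqF ?dotp_gt0//.
  by rewrite cexpiE cospi sinpi; apply: complexP; rewrite ?cReN ?cImN/= ?oppr0.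
exists (fun u => if u == 0 then 0 else Z (k u) (ind u) / (-1 - 1)).
split; first by rewrite eqxx.
  by move=> u Mu; case: ifP => // _; rewrite (apx_support (hZ (k u)).1 Mu) mul0r.
move=> h X u hX u0; rewrite (negbTE u0).
have e1 := is_logD hX (hZ (k u)); have e2 := is_logD (hZ (k u)) hX.
rewrite [k u + h]addrC in e2.
have := is_log_coef e1 e2 u0.
rewrite /add_fun (transl_ind _ _ hX.1) (transl_ind _ _ (hZ (k u)).1) ek//.
set x := X _; set y := Z _ _ => e.
have n2 : -1 - 1 != 0 :> C by rewrite -opprD oppr_eq0 -(natrD _ 1 1) pnatr_eq0.
apply: (mulIf n2); rewrite mulrAC divfK//.
have -> : x * (-1 - 1) = -1 * x + y - x - y by ring.
by rewrite e; ring.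
Qed.

Lemma log_coefficients_summable (c : V -> C) :
  (forall h X u, is_log h X -> u != 0 -> X (ind u) = c u * (echar h u - 1)) ->
  exists B, forall S, uniq S -> 0 \notin S -> \sum_(u <- S) nc (c u) <= B.
Proof.
move=> hc; have [eps e0 heps] := exists_good_eps.
have [H hH] := transl_almost_period hL e0.
have bk (k : V) : exists N, 0 <= N /\ forall S, uniq S -> 0 \notin S ->
    \sum_(u <- S) nc (c u * (echar k u - 1)) <= N.
  have [X hX] := exists_is_log k; have [N N0 hN] := apx_nle hX.1.
  exists N; split => // S uS S0; apply: le_trans (nle_coef hX.1 hN uS).
  rewrite big_seq [leRHS]big_seq; apply: ler_sum => u uS'; rewrite (hc _ _ _ hX)//.
  by apply: contraNneq S0 => <-.
have [NN hNN] := choice bk.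
(* The step [k] ranges over the finite set [H], and the almost period [h - k] has a logarithm of
   norm at most 1; hence a bound independent of [h]. *)
pose B := \sum_(k <- H) NN k + 1.
have hB h S : uniq S -> 0 \notin S -> \sum_(u <- S) nc (c u * (echar h u - 1)) <= B.
  move=> uS S0; have [k kH hk] := hH h.
  have [X hX nX] := heps _ hk.
  have h1 : \sum_(u <- S) nc (c u * (echar (h - k) u - 1)) <= 1.
    apply: le_trans (nle_coef hX.1 nX uS).
    rewrite big_seq [leRHS]big_seq; apply: ler_sum => u uS'; rewrite (hc _ _ _ hX)//.
    by apply: contraNneq S0 => <-.
  have h2 : \sum_(u <- S) nc (c u * (echar k u - 1)) <= \sum_(k <- H) NN k.
    apply: le_trans ((hNN k).2 _ uS S0) _.
    rewrite (big_rem k)//= lerDl sumr_ge0// => i _; exact: (hNN i).1.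
  apply: le_trans (lerD h2 h1); rewrite -big_split/=; apply: ler_sum => u _.
  have -> : c u * (echar h u - 1) = c u * (echar k u - 1) +
      echar k u * (c u * (echar (h - k) u - 1)).
    have -> : echar h u = echar (h - k) u * echar k u by rewrite -echarDl subrK.
    by ring.
  by rewrite (le_trans (ncD _ _))// lerD// ncM nc_echar mul1r.
exists B => S uS S0.
have [|T [T0 TS]] := @finite_mean R d S.
  by move=> w wS; apply: contraNneq S0 => <-.
have T0' : 0 < (size T)%:R :> R by rewrite ltr0n.
(* For [u] in [S] the mean of [|echar t u - 1|] over [T] is at least the modulus of the mean of
   [echar t u - 1], which is 1. *)
rewrite -(ler_pM2l T0') mulr_sumr.
apply: (@le_trans _ _ (\sum_(t <- T) \sum_(u <- S) nc (c u * (echar t u - 1)))).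
  rewrite exchange_big/= big_seq [leRHS]big_seq; apply: ler_sum => u uS'.
  apply: le_trans (nc_sum _ _).
  rewrite -mulr_sumr sumrB TS// sub0r big_const_seq count_predT iter_addr_0.
  by rewrite ncM ncN ncn mulrC.
apply: (@le_trans _ _ (\sum_(t <- T) B)).
  by apply: ler_sum => t _; exact: hB.
by rewrite big_const_seq count_predT iter_addr_0 mulr_natl.
Qed.

Lemma exp_representation : exists (c : V -> C) (gam : V),
  [/\ c 0 = 0, forall u, ~ M u -> c u = 0, nnsummable (M `\ 0) (fun u => nc (c u)), M gam &
  forall t, f t = echar t gam *
    cexp (coef_fun (M `\ 0) c (echar t) - coef_fun (M `\ 0) c (echar 0))].
Proof.
have [c [c_0 cM hc]] := log_coefficients.
have [B hB] := log_coefficients_summable hc.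
have cS : nnsummable (M `\ 0) (fun u => nc (c u)).
  apply: (@nnsummable_le_seq _ _ _ _ B) => [u _|D uD DA]; first exact: nc_ge0.
  by apply: hB => //; apply/negP => /DA; rewrite inE => -[_ []].
pose A := M `\ 0; have AM : A `<=` M by move=> u [].
pose K := coef_fun A c.
have aK : apx M K := apx_coef_fun AM cS.
have KE u : u != 0 -> K (ind u) = c u.
  move=> u0; have [Mu|Mu] := pselect (M u).
    by rewrite /K coef_fun_ind//; split => //; exact/eqP.
  by rewrite (apx_support aK Mu) cM.
(* A logarithm of the quotient and [K(. + h) - K] have the same coefficients off 0, so they differ
   by a constant: [f exp(- K)] is multiplied by a constant under each translation. *)
have step h : exists kap : C, forall t,
    f (t + h) * cexp (- K (echar (t + h))) = kap * (f t * cexp (- K (echar t))).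
  have [X hX] := exists_is_log h.
  pose Y := sub_fun X (sub_fun (transl h K) K).
  have aY : apx M Y.
    by apply: apx_sub; [exact: hX.1|apply: apx_sub => //; exact: apx_transl].
  have YE t : Y (echar t) = Y (ind 0).
    apply: (single_coef_transform _ M0 aY) => u u0.
    by rewrite /Y !sub_funE (transl_ind _ _ aK) KE// (hc _ _ _ hX)//; ring.
  exists (cexp (Y (ind 0))) => t; rewrite -(YE t) /Y !sub_funE transl_echar.
  rewrite !(cexpB, cexpN) (hX.2 t).
  have := transform_neq0 t; have := cexp_neq0 (K (echar t)).
  have := cexp_neq0 (K (echar (t + h))).
  by move=> n1 n2 n3; field; rewrite n1 n2.
pose G := conv_fun L (exp_fun (scale_fun (-1) K)).
have aE : apx M (exp_fun (scale_fun (-1) K)) by apply: apx_exp => //; exact: apx_scale.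
have aG : apx M G by exact: apx_conv.
have GE t : G (echar t) = f t * cexp (- K (echar t)).
  rewrite /G (conv_echar _ hL aE) (exp_echar _ Mg (apx_scale _ aK)).
  by rewrite /scale_fun mulN1r.
(* [G] is not zero, so some coefficient survives; its frequency [w] serves as [gam], and lies in [M]
   because [G] is carried by [M]. *)
have [w Gw] : exists w, G (ind w) != 0.
  apply: contrapT => /forallNP h.
  have : G (echar 0) = 0.
    apply: (apx_coef_uniq aG) (bnd_echar 0) => w _.
    by apply: contrapT => /eqP; exact: h.
  rewrite GE; apply/eqP; rewrite mulf_neq0 ?cexp_neq0//; exact: transform_neq0.
have Mw : M w.
  by apply: contrapT => h; rewrite (apx_support aG h) eqxx in Gw.
exists c, w; split => // t.
have [kap hk] := step t.
(* Compare the coefficients at [w] on both sides of [G(. + t) = kap G]. *)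
have ek : kap = echar t w.
  apply: (mulIf Gw); rewrite -(transl_ind _ _ aG); symmetry.
  rewrite -/(scale_fun kap G (ind w)).
  apply: (apx_eq (apx_transl t aG) (apx_scale kap aG)) (bnd_ind w) => s.
  by rewrite transl_echar /scale_fun !GE hk.
have := hk 0; rewrite add0r L1 mul1r ek => e.
rewrite -/A -/K cexpB -[LHS]mulr1.
have -> : 1 = cexp (- K (echar t)) * cexp (K (echar t)) by rewrite -cexpD addNr cexp0.
by rewrite mulrA e cexpN; ring.
Qed.

(** By [f(- t) = conj f(t)], the exponents built from [c] and from [conj c] have equal exponentials;
    their difference is then constant, so [c] and [conj c] agree off 0. *)
Theorem real_exp_representation : exists (lam : V -> R) (gam : V),
  [/\ nnsummable (M `\ 0) (fun u => `|lam u|), M gam &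
  forall t, f t = cexp ((dotp t gam) *i + csum (M `\ 0)
    (fun u => (lam u)%:C * (cexp ((dotp t u) *i) - 1)))].
Proof.
have [c [gam [c_0 cM cS Mgam E]]] := exp_representation.
pose A := M `\ 0; have AM : A `<=` M by move=> u [].
have aK : apx M (coef_fun A c) := apx_coef_fun AM cS.
pose c' u := (c u)^*%C.
have cS' : nnsummable A (fun u => nc (c' u)).
  by rewrite /c'; under eq_fun do rewrite nc_conj.
have aK' : apx M (coef_fun A c') := apx_coef_fun AM cS'.
have cj t : coef_fun A c' (echar (- t)) = (coef_fun A c (echar t))^*%C.
  rewrite /coef_fun -(csum_conj cS).
    congr csum; apply/funext => u; rewrite /c' echarN -echar_conj.
    by case: (c u) (echar t u) => ? ? [? ?]; apply: complexP => /=; ring.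
  by move=> u _; rewrite ncM nc_echar mulr1.
pose D := sub_fun (coef_fun A c) (coef_fun A c').
have aD : apx M D by exact: apx_sub.
have DE t : D (echar t) = D (echar 0).
  pose Y := sub_fun D (scale_fun (D (echar 0)) (delta_fun 0)).
  have aY : apx M Y.
    by apply: apx_sub => //; apply: apx_scale; exact: apx_delta.
  have YE s : Y (echar s) = D (echar s) - D (echar 0).
    by rewrite /Y sub_funE /scale_fun /delta_fun echar0r mulr1.
  have := cexp_eq1_const aY; rewrite !YE subrr => h.
  apply/eqP; rewrite -subr_eq0 -YE; apply/eqP; rewrite h// ?YE ?subrr// => s.
  rewrite YE /D !sub_funE.
  have := LC (- s); rewrite opprK (E (- s)).
  rewrite conjM cexp_conj conjB.
  rewrite -!cj opprK oppr0 echar_conj -echarN opprK (E s) -/A => /(mulfI (echar_neq0 _ _)).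
  set a := coef_fun _ _ _; set b := coef_fun _ _ _; set p := coef_fun _ _ _.
  set q := coef_fun _ _ _ => e.
  have -> : a - p - (b - q) = (a - b) - (p - q) by ring.
  by rewrite cexpB e divff ?cexp_neq0.
pose lam u := complex.Re (c u).
have clam : c = fun u => (lam u)%:C.
  apply/funext => u; have [->|u0] := eqVneq u 0; first by rewrite /lam c_0.
  have [Mu|Mu] := pselect (M u); last by rewrite /lam cM.
  have Au : A u by split => //; exact/eqP.
  have := const_transform_coef M0 aD DE u0.
  rewrite /D sub_funE (coef_fun_ind cS Au) (coef_fun_ind cS' Au) /c' /lam.
  case: (c u) => a b /= => -[_]; rewrite opprK => bb.
  by apply: complexP => //=; lra.
exists lam, gam; split => //.
  by move: cS; rewrite clam; under eq_fun do rewrite ncR.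
move=> t; rewrite E [RHS]cexpD; congr (_ * cexp _).
rewrite -(apxBr aK (bnd_echar t) (bnd_echar 0)) /coef_fun -/A; congr csum.
by apply/funext => u; rewrite echar0l clam.
Qed.

End representation.
End logarithm.

(** * Distribution functions and convolution *)

Section bounded_integrals.
Context (R : realType) (dd : measure_display) (T : measurableType dd).
Implicit Types (P : probability T R) (f g : T -> R).

Lemma bounded_integrable P f (B : R) : measurable_fun [set: T] f ->
  (forall x, `|f x| <= B) -> P.-integrable [set: T] (EFin \o f).
Proof.
move=> mf fB; apply: measurable_bounded_integrable => //.
  by rewrite (le_lt_trans (probability_le1 P measurableT))// ltry.
exists B; split; first exact: num_real.
by move=> M BM x _; apply: le_trans (fB x) _; exact: ltW.
Qed.

Lemma Rintegral_norm_le P f (B : R) : measurable_fun [set: T] f ->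
  (forall x, `|f x| <= B) -> `|\int[P]_x f x| <= B.
Proof.
move=> mf fB; have fi := bounded_integrable P mf fB.
rewrite (le_trans (le_normr_Rintegral _ fi))//.
have -> : B = \int[P]_x (cst B x).
  rewrite Rintegral_cst//; have -> := probability_setT P : Measure.sort P setT = 1%E.
  by rewrite mulr1.
apply: le_Rintegral => //.
  by apply: (@bounded_integrable _ _ B) => [|x]; [exact: measurableT_comp|rewrite normr_id].
by apply: (@bounded_integrable _ _ `|B|).
Qed.

End bounded_integrals.

Section product_integral.
Context (R : realType) (d1 d2 : measure_display)
  (T1 : measurableType d1) (T2 : measurableType d2)
  (P : probability T1 R) (Q : probability T2 R).

Lemma Rintegral_prodM (f : T1 -> R) (g : T2 -> R) (A B : R) :
  measurable_fun [set: T1] f -> measurable_fun [set: T2] g ->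
  (forall x, `|f x| <= A) -> (forall y, `|g y| <= B) ->
  \int[(P \x Q)%E]_z (f z.1 * g z.2) = (\int[P]_x f x) * (\int[Q]_y g y).
Proof.
move=> mf mg fA gB.
have mfg : measurable_fun [set: T1 * T2] (fun z => f z.1 * g z.2).
  apply: measurable_funM; first exact: measurableT_comp.
  exact: measurableT_comp.
have fgi : (P \x Q)%E.-integrable [set: T1 * T2] (EFin \o (fun z => f z.1 * g z.2)).
  apply: (@bounded_integrable _ _ _ _ _ (A * B)) => // z.
  by rewrite normrM ler_pM.
have gi := bounded_integrable Q mg gB.
have fi := bounded_integrable P mf fA.
rewrite /Rintegral -integral12_prod_meas1// /fubini_F.
have -> : (fun x => \int[Q]_y (EFin \o (fun z => (f z.1 * g z.2)%R)) (x, y))%E =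
   (fun x => (fine (\int[Q]_y (g y)%:E)%E * f x)%:E).
  apply/funext => x /=.
  under eq_integral do rewrite EFinM.
  rewrite integralZl// muleC EFinM fineK//.
  exact: integrable_fin_num.
set c := fine (\int[Q]_y (g y)%:E)%E.
have gfi : P.-integrable [set: T1] (fun x => (f x)%:E) by exact: fi.
have -> : (\int[P]_x (c * f x)%:E = c%:E * \int[P]_x (f x)%:E)%E.
  by rewrite -integralZl//; apply: eq_integral => x _; rewrite EFinM.
by rewrite fineM// ?integrable_fin_num// mulrC.
Qed.

End product_integral.

Section rV_measurability.
Variables (R : realType) (d : nat).
Local Notation V := 'rV[R]_d.

Lemma measurable_coord (j : 'I_d) :
  measurable_fun [set: V] (fun x : V => x ord0 j).
Proof.
move=> _ Y mY; rewrite setTI; apply: sub_sigma_algebra => /=.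
rewrite -bigcup_seq/=; exists j => /=; first by rewrite mem_index_enum.
by exists Y => //; rewrite setTI.
Qed.

Lemma measurable_fun_rV dd (T : measurableType dd) (f : T -> V) :
  (forall j, measurable_fun [set: T] (fun x => f x ord0 j)) ->
  measurable_fun [set: T] f.
Proof.
move=> mf; apply: (@measurability _ _ _ _ setT f
  (\big[setU/set0]_(j < d) preimage_set_system setT (fun x : V => x ord0 j) measurable)) => //.
move=> A [B]; rewrite -bigcup_seq/= => -[j _ [C mC <-] <-].
by rewrite !setTI; have := mf j measurableT C mC; rewrite setTI.
Qed.

Lemma orthantE (x : V) : orthant x =
  \bigcap_(j in [set: 'I_d]) (fun y : V => y ord0 j) @^-1` `]-oo, x ord0 j].
Proof.
apply/seteqP; split => y /= h j; first by move=> _; rewrite /= in_itv/= h.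
by have := h j I; rewrite /= in_itv.
Qed.

Lemma measurable_orthant (x : V) : measurable (orthant x).
Proof.
rewrite orthantE; apply: fin_bigcap_measurable => //.
by move=> j _; rewrite -[X in measurable X]setTI; exact: measurable_coord.
Qed.

Lemma measurable_set1_rV (x : V) : measurable [set x].
Proof.
have -> : [set x] = \bigcap_(j in [set: 'I_d]) (fun y : V => y ord0 j) @^-1` [set x ord0 j].
  apply/seteqP; split => y /= h; first by rewrite h => j _.
  by apply/rowP => j; exact: h.
apply: fin_bigcap_measurable => //.
by move=> j _; rewrite -[X in measurable X]setTI; exact: measurable_coord.
Qed.

Lemma measurable_dotp (t : V) : measurable_fun [set: V] (dotp t).
Proof.
rewrite /dotp; apply: measurable_sum => j; apply: measurable_funM => //.
exact: measurable_coord.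
Qed.

Definition addV (z : V * V) : V := z.1 + z.2.

Lemma measurable_addV : measurable_fun [set: V * V] addV.
Proof.
apply: measurable_fun_rV => j; rewrite /addV.
under eq_fun do rewrite mxE.
apply: measurable_funD; apply: (measurableT_comp (measurable_coord j)) => //.
Qed.

HB.instance Definition _ := isMeasurableFun.Build _ _ _ _ addV measurable_addV.

End rV_measurability.

Section distribution_functions.
Variables (R : realType) (d : nat).
Local Notation V := 'rV[R]_d.
Implicit Types (P Q : probability V R).

Definition orthants : set (set V) := range (@orthant R d).

Lemma sigma_orthants (A : set V) : measurable A -> <<s orthants >> A.
Proof.
apply: smallest_sub; first exact: smallest_sigma_algebra.
move=> B; rewrite -bigcup_seq/= => -[j _ [C mC <-]]; rewrite setTI.
pose VG := g_sigma_algebraType orthants.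
suff mj : measurable_fun [set: VG] (fun y : V => y ord0 j : R).
  by have := mj measurableT _ mC; rewrite setTI.
apply: (measurability _ (RGenOInfty.measurableE R)) => _ [_ [a ->] <-].
rewrite setTI.
(* The half-space [y_j <= a] is the union of the orthants with [j]-th corner coordinate [a] and the
   others tending to infinity. *)
have -> : (fun y : V => y ord0 j) @^-1` `]a, +oo[ =
   ~` \bigcup_n orthant (\row_i (if i == j then a else n%:R) : V).
  apply/seteqP; split => y /=.
    rewrite in_itv/= andbT => ay [n _ /(_ j)]; rewrite mxE eqxx.
    by rewrite leNgt ay.
  move=> h; rewrite in_itv/= andbT ltNge; apply/negP => ya; apply: h.
  exists (Num.truncn (\sum_i `|y ord0 i|)).+1 => // i; rewrite mxE.
  case: eqP => [->//|_]; rewrite (le_trans (ler_norm _))//.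
  have /andP[_ h] := @truncn_itv R (\sum_i `|y ord0 i|) (sumr_ge0 _ (fun _ _ => normr_ge0 _)).
  by rewrite ltW// (le_lt_trans _ h)// (bigD1 i)//= lerDl sumr_ge0.
apply: (@measurableC _ VG); apply: (@bigcup_measurable _ VG) => n _.
by apply: sub_sigma_algebra; eexists.
Qed.

Lemma setI_closed_orthants : setI_closed orthants.
Proof.
move=> _ _ [x _ <-] [y _ <-]; exists (\row_j Num.min (x ord0 j) (y ord0 j)) => //.
apply/seteqP; split => z /=.
  by move=> h; split => j; have := h j; rewrite mxE le_min => /andP[].
by move=> [h1 h2] j; rewrite mxE le_min h1 h2.
Qed.

Lemma measure_eq_orthants P Q : (forall x, P (orthant x) = Q (orthant x)) ->
  forall A, measurable A -> P A = Q A.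
Proof.
move=> h A /sigma_orthants; apply: (@g_sigma_algebra_measure_unique _ _ _ orthants _
  (fun n => orthant (const_mx n%:R : V))).
- by move=> _ [x _ <-]; exact: measurable_orthant.
- by move=> n; exists (const_mx n%:R).
- apply/seteqP; split => // y _.
  exists (Num.truncn (\sum_i `|y ord0 i|)).+1 => // i; rewrite mxE.
  rewrite (le_trans (ler_norm _))//.
  have /andP[_ k] := @truncn_itv R (\sum_i `|y ord0 i|) (sumr_ge0 _ (fun _ _ => normr_ge0 _)).
  by rewrite ltW// (le_lt_trans _ k)// (bigD1 i)//= lerDl sumr_ge0.
- exact: setI_closed_orthants.
- by move=> _ [x _ <-]; exact: h.
- by move=> n; rewrite (le_lt_trans (probability_le1 P (measurable_orthant _)))// ltry.
Qed.

Lemma mcdfK P x : (mcdf P x)%:E = P (orthant x).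
Proof. by rewrite /mcdf fineK// fin_num_measure//; exact: measurable_orthant. Qed.

(** [law] chooses some measure with the given distribution function; since orthants form a
    generating pi-system, the choice is immaterial. *)
Lemma law_mcdf P A : measurable A -> law (mcdf P) A = P A.
Proof.
move=> mA; symmetry; apply: measure_eq_orthants mA => x.
rewrite -!mcdfK; congr (_%:E).
have : [set Q | mcdf P = mcdf Q] (law (mcdf P)) by apply: xgetPex; exists P.
by move=> /= <-.
Qed.

Lemma Rintegral_law P (g : V -> R) : \int[law (mcdf P)]_x g x = \int[P]_x g x.
Proof.
rewrite /Rintegral; congr fine; apply: eq_measure_integral => A mA _.
exact: law_mcdf.
Qed.

(** [Q] comes first so that the outer integral of the product measure runs over [Q], as in
    [conv (mcdf P) (mcdf Q)]. *)
Definition conv_prob P Q : probability V R := distribution (Q \x P)%E (@addV R d).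

Lemma conv_mcdf P Q : Defs.conv (mcdf P) (mcdf Q) = mcdf (conv_prob P Q).
Proof.
apply/funext => x; rewrite /Defs.conv Rintegral_law /mcdf /Rintegral; congr fine.
rewrite /conv_prob /distribution /pushforward /product_measure1.
apply: eq_integral => y _ /=; rewrite fineK; last first.
  by rewrite fin_num_measure//; exact: measurable_orthant.
congr (P _); apply/seteqP; split => z; rewrite /xsection/= inE /addV/= => h j.
  by have := h j; rewrite !mxE; lra.
by have := h j; rewrite !mxE; lra.
Qed.

Lemma charfun_mcdf P t : charfun (mcdf P) t =
  (\int[P]_x cos (dotp t x)) +i* (\int[P]_x sin (dotp t x)).
Proof.
rewrite /charfun /cintegral !Rintegral_law.
by congr (_ +i* _); apply: eq_Rintegral => x _; rewrite cexpiE.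
Qed.

Let measurable_cos : measurable_fun [set: R] (@cos R).
Proof. exact: continuous_measurable_fun (@continuous_cos R). Qed.

Let measurable_sin : measurable_fun [set: R] (@sin R).
Proof. exact: continuous_measurable_fun (@continuous_sin R). Qed.

Lemma measurable_cos_dotp t : measurable_fun [set: V] (fun x => cos (dotp t x)).
Proof.
by apply: measurableT_comp (measurable_dotp t); exact: measurable_cos.
Qed.

Lemma measurable_sin_dotp t : measurable_fun [set: V] (fun x => sin (dotp t x)).
Proof.
by apply: measurableT_comp (measurable_dotp t); exact: measurable_sin.
Qed.

Lemma charfun_conv P Q t : charfun (Defs.conv (mcdf P) (mcdf Q)) t =
  charfun (mcdf P) t * charfun (mcdf Q) t.
Proof.
rewrite conv_mcdf !charfun_mcdf.
have mc := measurable_cos_dotp t; have ms := measurable_sin_dotp t.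
have c1 (x : V) : `|cos (dotp t x)| <= 1 by exact: cos_max.
have s1 (x : V) : `|sin (dotp t x)| <= 1 by exact: sin_max.
have push (g : R -> R) : measurable_fun setT g -> (forall a, `|g a| <= 1) ->
    \int[conv_prob P Q]_x g (dotp t x) =
    \int[(Q \x P)%E]_z g (dotp t z.1 + dotp t z.2).
  move=> mg g1; rewrite /Rintegral; congr fine.
  have mgd : measurable_fun [set: V] (fun x => g (dotp t x)).
    by apply: measurableT_comp => //; exact: measurable_dotp.
  rewrite [LHS]integral_distribution.
  - by apply: eq_integral => z _ /=; rewrite /addV dotpDr.
  - exact/measurable_EFinP.
  - apply: (@bounded_integrable _ _ _ _ (fun z => g (dotp t (addV z))) 1) => //.
    exact: (measurableT_comp mgd (@measurable_addV R d)).
have bi (f g : V -> R) : measurable_fun setT f -> measurable_fun setT g ->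
    (forall x, `|f x| <= 1) -> (forall x, `|g x| <= 1) ->
    (Q \x P)%E.-integrable [set: V * V] (EFin \o (fun z => f z.1 * g z.2)).
  move=> mf mg f1 g1.
  apply: (@bounded_integrable _ _ _ _ (fun z => f z.1 * g z.2) 1).
    apply: measurable_funM; first exact: measurableT_comp.
    exact: measurableT_comp.
  by move=> z; rewrite normrM mulr_ile1.
rewrite (push _ measurable_cos (@cos_max R)) (push _ measurable_sin (@sin_max R)).
under eq_Rintegral do rewrite cosD.
under [X in _ +i* X]eq_Rintegral do rewrite sinD.
rewrite RintegralB//; [|exact: (bi _ _ mc mc)|exact: (bi _ _ ms ms)].
rewrite RintegralD//; [|exact: (bi _ _ ms mc)|exact: (bi _ _ mc ms)].
have e1 := Rintegral_prodM Q P mc mc c1 c1.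
have e2 := Rintegral_prodM Q P ms ms s1 s1.
have e3 := Rintegral_prodM Q P ms mc s1 c1.
have e4 := Rintegral_prodM Q P mc ms c1 s1.
move: e1 e2 e3 e4; cbv beta => -> -> -> ->.
by apply: complexP; rewrite ?cReM ?cImM/=; ring.
Qed.

End distribution_functions.

(** * Discrete laws and compound Poisson laws *)

Section nonnegative_functionals.
Variables (R : realType) (d : nat).
Local Notation C := R[i].
Local Notation nc := (@Normc.normc R).
Local Notation V := 'rV[R]_d.
Local Notation functional := ((V -> C) -> C).
Implicit Types (t u v w h : V) (M : set V) (L U X : functional)
  (phi psi : V -> C) (g : V -> R) (B N eps : R).
Local Arguments Normc.normc : simpl never.

Definition nneg U := forall g B, (forall u, 0 <= g u <= B) ->
  complex.Im (U (fun u => (g u)%:C)) = 0 /\ 0 <= complex.Re (U (fun u => (g u)%:C)).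

(** Discrete probability measures with atoms in [M], as positive functionals of mass 1; no
    enumeration of the atoms has to be carried along. *)
Definition is_dlaw M U := [/\ apx M U, nneg U & U (fun=> 1) = 1].

Definition indS (A : set V) : V -> C := fun u => ((u \in A)%:R : R)%:C.

Lemma bnd_real g B : (forall u, `|g u| <= B) -> bnd (fun u => (g u)%:C) B.
Proof. by move=> h u; rewrite ncR. Qed.

Lemma bnd_indS A : bnd (indS A) 1.
Proof.
by apply: bnd_real => u; case: (u \in A); rewrite ?normr1 ?normr0.
Qed.

Lemma in_set1_eq (u w : V) : (u \in [set w]) = (u == w).
Proof. by apply/idP/eqP => [/set_mem|->]; rewrite ?inE. Qed.

Lemma indS1 w : indS [set w] = ind w.
Proof.
apply/funext => u; rewrite /indS /ind rmorph_nat; congr (_%:R).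
by rewrite in_set1_eq.
Qed.

Lemma nneg_real M U g B : apx M U -> nneg U -> (forall u, `|g u| <= B) ->
  complex.Im (U (fun u => (g u)%:C)) = 0.
Proof.
move=> aU nU gB; have B0 : 0 <= B := le_trans (normr_ge0 _) (gB 0).
have h1 : forall u, 0 <= g u + B <= B + B.
  by move=> u; have := gB u; rewrite ler_norml => /andP[? ?]; apply/andP; split; lra.
have h2 : forall u : V, 0 <= B <= B by move=> u; rewrite B0 lexx.
have [i1 _] := nU _ _ h1; have [i2 _] := nU _ _ h2.
have b1 : bnd (fun u => (g u + B)%:C) (B + B).
  by apply: bnd_real => u; have /andP[k1 k2] := h1 u; rewrite ger0_norm.
have b2 : bnd (fun u : V => B%:C) B by apply: bnd_real => u; rewrite ger0_norm.
have := apxBr aU b1 b2.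
have -> : (fun u => (g u + B)%:C - B%:C) = (fun u => (g u)%:C).
  by apply/funext => u; rewrite -rmorphB/= addrK.
by move=> ->; rewrite cImD cImN i1 i2 subr0.
Qed.

Lemma nneg_scale r U : 0 <= r -> nneg U -> nneg (scale_fun r%:C U).
Proof.
move=> r0 nU g B hg; have [i1 r1] := nU _ _ hg.
by rewrite /scale_fun cImM cReM/= i1 !mul0r !mulr0 subr0 addr0 mulr_ge0.
Qed.

Lemma nneg_delta w : nneg (delta_fun w).
Proof. by move=> g B hg; have /andP[h _] := hg w; rewrite /delta_fun/=. Qed.

Lemma nneg_conv M U X : apx M X -> nneg U -> nneg X -> nneg (conv_fun U X).
Proof.
move=> aX nU nX g B hg; have [N N0 hN] := apx_nle aX.
have hs u : forall v, 0 <= g (u + v) <= B by move=> v; exact: hg.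
rewrite /conv_fun.
have -> : (fun u => X (fun v => (g (u + v))%:C)) =
   (fun u => (complex.Re (X (fun v => (g (u + v))%:C)))%:C).
  by apply/funext => u; apply: complexP => //=; exact: (nX _ _ (hs u)).1.
apply: (nU _ (N * B)) => u; rewrite (nX _ _ (hs u)).2/=.
rewrite (le_trans (ler_norm _))// (le_trans (nc_Re _))//; apply: hN.
by apply: bnd_real => v; have /andP[? ?] := hs u v; rewrite ger0_norm.
Qed.

Lemma nneg_pow M U n : subgroup M -> apx M U -> nneg U -> nneg (pow_fun U n).
Proof.
move=> Mg aU nU; elim: n => [|n IH]; first exact: nneg_delta.
exact: nneg_conv (apx_pow n Mg aU) nU IH.
Qed.

Lemma rsum_ge0 (T : choiceType) (A : set T) (g : T -> R) :
  (forall k, A k -> 0 <= g k) ->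
  rsum A g = fine (\esum_(k in A) (g k)%:E)%E.
Proof.
move=> g0; rewrite /rsum.
have -> : (\esum_(u in A) ((EFin \o g)^\- u))%E = 0%:E.
  apply: esum1 => k Ak; rewrite funenegE/= -EFin_max.
  have : - g k <= 0 by rewrite oppr_le0 g0.
  by move=> /max_r ->.
rewrite /= subr0; congr fine; apply: eq_esum => k Ak.
by rewrite funeposE/= -EFin_max (max_l (g0 _ Ak)).
Qed.

Lemma csum_ge0 (T : choiceType) (A : set T) (f : T -> C) :
  (forall k, A k -> complex.Im (f k) = 0 /\ 0 <= complex.Re (f k)) ->
  complex.Im (csum A f) = 0 /\ 0 <= complex.Re (csum A f).
Proof.
move=> h; rewrite /csum /= (rsum_ge0 (g := fun k => complex.Im (f k))); last first.
  by move=> k /h[->].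
rewrite (rsum_ge0 (g := fun k => complex.Re (f k))); last by move=> k /h[].
split; last by apply: fine_ge0; apply: esum_ge0 => k /h[_]; rewrite lee_fin.
have -> : (\esum_(k in A) (complex.Im (f k))%:E)%E = 0%:E by apply: esum1 => k /h[->].
by [].
Qed.

Lemma nneg_csum (T : choiceType) (A : set T) (F : T -> functional) :
  (forall k, A k -> nneg (F k)) -> nneg (fun phi => csum A (fun k => F k phi)).
Proof. by move=> h g B hg; apply: csum_ge0 => k /h /(_ _ _ hg). Qed.

Lemma nneg_exp M U : subgroup M -> apx M U -> nneg U -> nneg (exp_fun U).
Proof.
move=> Mg aU nU; apply: (nneg_csum (F := fun n => scale_fun (n`!%:R)^-1 (pow_fun U n))).
move=> n _; have -> : (n`!%:R)^-1 = ((n`!%:R : R)^-1)%:C :> C.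
  by rewrite fmorphV rmorph_nat.
by apply: nneg_scale; [rewrite invr_ge0|exact: nneg_pow Mg aU nU].
Qed.

Lemma dlaw_conv M U X : subgroup M -> is_dlaw M U -> is_dlaw M X ->
  is_dlaw M (conv_fun U X).
Proof.
move=> Mg [aU nU U1] [aX nX X1]; split; first exact: apx_conv.
  exact: nneg_conv aX nU nX.
by rewrite /conv_fun X1.
Qed.

(** * The probability measure of a positive functional *)

Section discrete_measure.
Variables (M : set V) (U : functional).
Hypothesis hU : is_dlaw M U.

Let aU : apx M U. Proof. by case: hU. Qed.
Let nU : nneg U. Proof. by case: hU. Qed.

Definition dmeas (A : set V) : \bar R := (complex.Re (U (indS A)))%:E.

Let dmeas0 : dmeas set0 = 0%E.
Proof.
rewrite /dmeas; have -> : indS set0 = (fun u : V => 0 * 1).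
  by apply/funext => u; rewrite /indS in_set0 mul0r.
by rewrite (apxZr _ aU (@bnd_cst R d 1)) mul0r.
Qed.

Let dmeas_ge0 A : (0 <= dmeas A)%E.
Proof.
rewrite /dmeas lee_fin; apply: (nU (g := fun u => (u \in A)%:R) (B := 1) _).2.
by move=> u; case: (u \in A); rewrite !(lexx, ler01).
Qed.

Let dmeas_semi_sigma_additive : semi_sigma_additive dmeas.
Proof.
move=> F mF tF mUF; rewrite /dmeas.
under eq_fun do rewrite sumEFin.
apply: cvg_EFin; first by near=> n.
apply/cvgrPdist_le => e e0.
have [s sM hs] := aU e0.
(* Past [n0] the first [n] sets cover every frequency of [s] that lies in the union, so the
   indicator of the tail vanishes on [s] and only the error [e] remains. *)
have [n0 hn0] : exists n0, forall p, p \in s -> (\bigcup_n F n) p.2 ->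
    exists2 i, (i < n0)%N & F i p.2.
  elim: s {sM hs} => [|q s [n0 IH]]; first by exists 0%N.
  have [[i _ Fi]|nF] := pselect ((\bigcup_n F n) q.2).
    exists (maxn n0 i.+1) => p; rewrite inE => /orP[/eqP ->|/IH h]; move=> hF.
      by exists i => //; rewrite leq_max leqnn orbT.
    by have [j jn Fj] := h hF; exists j => //; rewrite leq_max jn.
  exists n0 => p; rewrite inE => /orP[/eqP ->//|]; exact: IH.
exists n0 => // n /= n0n.
have uniqF u i j : F i u -> F j u -> i = j.
  by move=> Fi Fj; apply: tF => //; exists u.
pose tail u : C := indS (\bigcup_n F n) u - \sum_(0 <= i < n) indS (F i) u.
have sumE u : \sum_(0 <= i < n) indS (F i) u = indS (\bigcup_(i in `I_n) F i) u.
  rewrite {2}/indS; case: (boolP (u \in \bigcup_(i in `I_n) F i)) => [/set_mem|].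
    move=> [i /= ni Fi]; rewrite (bigD1_seq i) ?iota_uniq ?mem_index_iota//=.
    rewrite {1}/indS mem_set// big1 ?addr0// => j ji.
    rewrite /indS memNset// => Fj; move: ji; rewrite (uniqF _ _ _ Fi Fj) eqxx//.
  move=> /negP nu; rewrite big_nat big1// => i ni; rewrite /indS memNset// => Fi.
  by apply: nu; apply: mem_set; exists i.
have btail : bnd tail 1.
  move=> u; rewrite /tail sumE /indS.
  case: (boolP (u \in \bigcup_(i in `I_n) F i)) => [/set_mem[i /= _ Fi]|_].
    by rewrite mem_set ?subrr ?nc0//; exists i.
  by rewrite subr0 ncR; case: (u \in _); rewrite ?normr1 ?normr0.
have tail0 : ev s tail = 0.
  rewrite /ev big_seq big1// => p ps; rewrite /tail sumE /indS.
  have [Fp|nF] := pselect ((\bigcup_n F n) p.2).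
    rewrite !mem_set ?subrr ?mulr0//.
    by have [i ni Fi] := hn0 _ ps Fp; exists i => //=; exact: leq_trans n0n.
  rewrite !memNset ?subrr ?mulr0//.
  by move=> [i _ Fi]; apply: nF; exists i.
have := hs _ _ btail; rewrite tail0 subr0 mulr1.
apply: le_trans; apply: le_trans (nc_Re _).
rewrite /tail.
have bsum : bnd (fun u => \sum_(0 <= i < n) indS (F i) u) 1.
  by move=> u; rewrite sumE bnd_indS.
rewrite (apxBr aU (bnd_indS _) bsum) (apx_sumr _ aU (fun i => bnd_indS (F i))).
by rewrite cReD cReN cRe_sum.
Unshelve. all: by end_near.
Qed.

HB.instance Definition _ := isMeasure.Build _ _ _ dmeas
  dmeas0 dmeas_ge0 dmeas_semi_sigma_additive.

Let dmeasT : dmeas [set: V] = 1%E.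
Proof.
rewrite /dmeas; have -> : indS setT = (fun=> 1).
  by apply/funext => u; rewrite /indS in_setT.
by case: hU => _ _ ->.
Qed.

HB.instance Definition _ := Measure_isProbability.Build _ _ _ dmeas dmeasT.

Definition dlaw_prob : probability V R := dmeas.

Lemma Rintegral_dlaw g B : measurable_fun [set: V] g -> (forall u, `|g u| <= B) ->
  \int[dlaw_prob]_x g x = complex.Re (U (fun u => (g u)%:C)).
Proof.
move=> mg gB; have B0 : 0 <= B := le_trans (normr_ge0 _) (gB 0).
apply/eqP; rewrite -subr_eq0 -normr_le0; apply/ler_addgt0Pl => e0 e00; rewrite addr0.
have B1 : 0 < 2 * B + 1 by lra.
(* The integral and the functional each differ from the finite sum over [D] by at most [e * B]; the
   [+ 1] keeps the divisor positive. *)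
pose e := e0 / (2 * B + 1); have e_gt0 : 0 < e by rewrite divr_gt0.
have [D [uD _ hD]] := apx_coef aU e_gt0.
pose f (w : V) (u : V) : R := g w * \1_[set w] u.
pose gD u := \sum_(w <- D) f w u.
have mf w : measurable_fun [set: V] (f w).
  apply: measurable_funM => //; exact: measurable_indic (measurable_set1_rV w).
have fB w u : `|f w u| <= B.
  rewrite normrM -[leRHS]mulr1 ler_pM// indicE.
  by case: (u \in _); rewrite ?normr1 ?normr0.
have mgD : measurable_fun [set: V] gD by exact: measurable_sum.
have gDE u : gD u = if u \in D then g u else 0.
  rewrite /gD /f; case: ifPn => uinD.
    rewrite (bigD1_seq u)//= indicE in_set1_eq eqxx mulr1 big1 ?addr0// => w wu.
    by rewrite indicE in_set1_eq eq_sym (negbTE wu) mulr0.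
  rewrite big_seq big1// => w wD; rewrite indicE in_set1_eq.
  by case: eqP => [uw|_]; rewrite ?mulr0//; rewrite uw wD in uinD.
have gDB u : `|gD u| <= B by rewrite gDE; case: ifP => _; rewrite ?normr0.
have int_f w : \int[dlaw_prob]_x f w x = g w * complex.Re (U (ind w)).
  rewrite /f RintegralZl//; last first.
    apply: (@bounded_integrable _ _ _ _ _ 1).
      exact: measurable_indic (measurable_set1_rV w).
    by move=> u; rewrite indicE; case: (u \in _); rewrite ?normr1 ?normr0.
  congr (_ * _); rewrite /Rintegral integral_indic//; last exact: measurable_set1_rV.
  by rewrite setIT -indS1.
have int_gD : \int[dlaw_prob]_x gD x = \sum_(w <- D) g w * complex.Re (U (ind w)).
  rewrite /gD; elim: (D) => [|w r IH].
    rewrite big_nil; under eq_Rintegral do rewrite big_nil.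
    by rewrite Rintegral_cst// mul0r.
  rewrite big_cons -IH -int_f; under eq_Rintegral do rewrite big_cons.
  rewrite RintegralD//; first exact: bounded_integrable (mf w) (fB w).
  apply: (@bounded_integrable _ _ _ _ _ ((size r)%:R * B)).
    exact: measurable_sum.
  move=> u; rewrite (le_trans (ler_norm_sum _ _ _))//.
  apply: (@le_trans _ _ (\sum_(i <- r) B)); first exact: ler_sum.
  by rewrite big_const_seq count_predT iter_addr_0 mulr_natl.
have mDc : measurable (~` [set` D] : set V).
  apply: measurableC; rewrite (_ : [set` D] = \bigcup_(w in [set` D]) [set w]).
    apply: fin_bigcup_measurable; first exact: finite_seq.
    by move=> w _; exact: measurable_set1_rV.
  apply/seteqP; split => [w wD|w [v vD ->]]; last exact: vD.
  by exists w.
(* The indicator of the complement vanishes on [D], so the expansion over [D] gives 0 and its error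
   bounds the mass. *)
have pDc : fine (dlaw_prob (~` [set` D])) <= e.
  have := hD _ _ (bnd_indS (~` [set` D])); rewrite mulr1 big_seq big1 ?subr0.
    by apply: le_trans; rewrite /= (le_trans (ler_norm _))// nc_Re.
  by move=> w wD; rewrite /indS memNset ?mul0r//= => h; exact: h.
have ig := bounded_integrable dlaw_prob mg gB.
have igD := bounded_integrable dlaw_prob mgD gDB.
have mind : measurable_fun [set: V] (\1_(~` [set` D]) : V -> R) by exact: measurable_indic.
have ind_int : \int[dlaw_prob]_x (B * \1_(~` [set` D]) x) <= B * e.
  rewrite RintegralZl//; last first.
    apply: (@bounded_integrable _ _ _ _ _ 1) => // u.
    by rewrite indicE; case: (u \in _); rewrite ?normr1 ?normr0.
  by rewrite ler_wpM2l// /Rintegral integral_indic// setIT.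
have mgg : measurable_fun [set: V] (fun u => g u - gD u) by exact: measurable_funB.
have b1 : `|\int[dlaw_prob]_x (g x - gD x)| <= B * e.
  have ggB u : `|g u - gD u| <= B * \1_(~` [set` D]) u.
    rewrite gDE indicE; case: ifPn => uD'.
      by rewrite subrr normr0 mulr_ge0.
    by rewrite subr0 mem_set ?mulr1//=; exact/negP.
  have bgg u : `|g u - gD u| <= B.
    by rewrite (le_trans (ggB u))// ler_piMr// indicE lern1 leq_b1.
  have igg := bounded_integrable dlaw_prob mgg bgg.
  apply: le_trans (le_normr_Rintegral _ igg) _ => //.
  apply: le_trans ind_int; apply: le_Rintegral => //.
    apply: (@bounded_integrable _ _ _ _ _ B); first exact: measurableT_comp.
    by move=> u; rewrite normr_id.
  apply: (@bounded_integrable _ _ _ _ _ B); first exact: measurable_funM.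
  by move=> u; rewrite ger0_norm ?mulr_ge0// ler_piMr// indicE lern1 leq_b1.
rewrite RintegralB// int_gD in b1.
have b2 : `|complex.Re (U (fun u => (g u)%:C)) -
    \sum_(w <- D) g w * complex.Re (U (ind w))| <= e * B.
  apply: le_trans (hD _ _ (bnd_real gB)); apply: le_trans (nc_Re _).
  rewrite cReD cReN cRe_sum le_eqVlt; apply/orP; left; apply/eqP; congr `|_ - _|.
  by apply: eq_bigr => w _; rewrite cReM/= mul0r subr0.
have -> : e0 = 2 * (B * e) + e by rewrite /e; field; rewrite gt_eqF.
move: b1 b2; rewrite !ler_norml [e * B]mulrC => /andP[p1 p2] /andP[q1 q2].
by apply/andP; split; lra.
Qed.

Lemma charfun_dlaw t : charfun (mcdf dlaw_prob) t = U (echar t).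
Proof.
have c1 (u : V) : `|cos (dotp t u)| <= 1 by exact: cos_max.
have s1 (u : V) : `|sin (dotp t u)| <= 1 by exact: sin_max.
rewrite charfun_mcdf (Rintegral_dlaw (measurable_cos_dotp t) c1).
rewrite (Rintegral_dlaw (measurable_sin_dotp t) s1).
have := apx_lin 1 'i aU (bnd_real c1) (bnd_real s1).
have -> : (fun u => 1 * (cos (dotp t u))%:C + 'i * (sin (dotp t u))%:C) = echar t.
  apply/funext => u; rewrite /echar cexpiE.
  by apply: complexP; rewrite ?cReD ?cImD ?cReM ?cImM/=; ring.
move=> ->; have := nneg_real aU nU c1; have := nneg_real aU nU s1.
move: (U _) (U _) => [a b] [c e] /= -> ->.
by apply: complexP; rewrite ?cReD ?cImD ?cReM ?cImM/=; ring.
Qed.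

Definition dcdf : V -> R := fun x => complex.Re (U (indS (orthant x))).

Lemma dcdf_mcdf : dcdf = mcdf dlaw_prob.
Proof. by []. Qed.

End discrete_measure.

Lemma conv_dcdf M U X : subgroup M -> is_dlaw M U -> is_dlaw M X ->
  Defs.conv (dcdf U) (dcdf X) = dcdf (conv_fun X U).
Proof.
move=> Mg hU hX; apply/funext => x; rewrite /Defs.conv (dcdf_mcdf hU) (dcdf_mcdf hX).
rewrite Rintegral_law.
have mF : measurable_fun [set: V] (fun y => mcdf (dlaw_prob hU) (x - y)).
  have mA : measurable (@addV R d @^-1` orthant x).
    rewrite -[X in measurable X]setTI; apply: measurable_addV => //.
    exact: measurable_orthant.
  have := measurable_fun_xsection (dlaw_prob hU) mA.
  move=> h; have := measurableT_comp (@fine_measurable R setT measurableT) h.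
  congr measurable_fun; apply/funext => y; rewrite /mcdf /=; congr (fine (dlaw_prob hU _)).
  apply/seteqP; split => z; rewrite /xsection/= inE /addV/= => k j.
    by have := k j; rewrite !mxE; lra.
  by have := k j; rewrite !mxE; lra.
have bF y : `|mcdf (dlaw_prob hU) (x - y)| <= 1.
  rewrite ger0_norm ?fine_ge0// -lee_fin mcdfK.
  exact: probability_le1 (measurable_orthant _).
rewrite (Rintegral_dlaw hX mF bF) /dcdf /conv_fun; congr (complex.Re (X _)).
apply/funext => y.
have -> : (fun v => indS (orthant x) (y + v)) = indS (orthant (x - y)).
  apply/funext => v; rewrite /indS; congr ((_%:R)%:C); congr nat_of_bool.
  apply/idP/idP => /set_mem h; apply: mem_set => j.
    by have := h j; rewrite !mxE; lra.
  by have := h j; rewrite !mxE; lra.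
case: hU {mF bF} => aU nU U1; apply: complexP => //=.
have h u : 0 <= ((u \in orthant (x - y))%:R : R) <= 1.
  by case: (u \in _); rewrite !(lexx, ler01).
by rewrite (nU _ _ h).1.
Qed.

Lemma dcdf_eq M U X : apx M U -> apx M X ->
  (forall t, U (echar t) = X (echar t)) -> dcdf U = dcdf X.
Proof.
move=> aU aX h; apply/funext => x; rewrite /dcdf; congr complex.Re.
exact: (apx_eq aU aX h (bnd_indS _)).
Qed.

Lemma convn_dcdf M U n : subgroup M -> is_dlaw M U -> exists X,
  [/\ is_dlaw M X, Defs.convn (dcdf U) n.+1 = dcdf X &
      forall t, X (echar t) = U (echar t) ^+ n.+1].
Proof.
move=> Mg hU; elim: n => [|n [X [hX e XE]]].
  by exists U; split => // t; rewrite expr1.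
exists (conv_fun X U); split; first exact: dlaw_conv.
  rewrite -(conv_dcdf Mg hU hX) -e.
  by [].
move=> t; case: hX hU => aX _ _ [aU _ _].
by rewrite (conv_echar _ aX aU) XE -exprSr.
Qed.

(* The law of [gam] plus a compound Poisson variable with jump measure [L]. *)
Definition cpoisson (gam : V) L : functional := fun phi =>
  cexp (- L (fun=> 1)) * exp_fun L (fun u => phi (gam + u)).

Let gT : subgroup [set: V]. Proof. by []. Qed.

Lemma apx_cpoisson gam L : apx setT L -> apx setT (cpoisson gam L).
Proof.
move=> aL; have aE := apx_exp gT aL.
exact: apx_scale (apx_conv gT (apx_delta (I : setT gam)) aE).
Qed.

Lemma cpoisson_echar gam L t : apx setT L ->
  cpoisson gam L (echar t) = echar t gam * cexp (L (echar t) - L (echar 0)).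
Proof.
move=> aL; have aE := apx_exp gT aL.
have ad : apx setT (delta_fun gam) := apx_delta (I : setT gam).
have -> : cpoisson gam L (echar t) = cexp (- L (fun=> 1)) *
    conv_fun (delta_fun gam) (exp_fun L) (echar t) by [].
rewrite (conv_echar _ ad aE) (exp_echar _ gT aL) /delta_fun.
have -> : (fun _ : V => 1 : C) = echar 0 by apply/funext => u; rewrite echar0l.
by rewrite mulrCA -cexpD addrC.
Qed.

Lemma cpoisson_dlaw gam L : apx setT L -> nneg L -> is_dlaw setT (cpoisson gam L).
Proof.
move=> aL nL; have aE := apx_exp gT aL; split; first exact: apx_cpoisson.
  have b1 (u : V) : 0 <= (1 : R) <= 1 by rewrite ler01 lexx.
  have [i1 _] := nL _ _ b1.
  have -> : cpoisson gam L = scale_fun (cexp (- L (fun=> 1)))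
     (conv_fun (delta_fun gam) (exp_fun L)) by [].
  have -> : cexp (- L (fun=> 1)) = (expR (- complex.Re (L (fun=> 1))))%:C.
    rewrite cexpE cReN cImN i1 oppr0 cos0 sin0.
    by apply: complexP; rewrite ?cReM ?cImM/=; ring.
  apply: nneg_scale; first exact: expR_ge0.
  exact: nneg_conv aE (nneg_delta _) (nneg_exp gT aL nL).
have -> : (fun _ : V => 1 : C) = echar 0 by apply/funext => u; rewrite echar0l.
by rewrite cpoisson_echar// echar0l subrr cexp0 mulr1.
Qed.

(** The [n]-th root has shift [gam / n] and jump measure [L / n]. As [gam / n] may leave a given
    subgroup, supports are taken in the whole space. *)
Lemma infinitely_divisible_cpoisson gam L : apx setT L -> nneg L ->
  infinitely_divisible (dcdf (cpoisson gam L)).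
Proof.
move=> aL nL; split; first by exists (dlaw_prob (cpoisson_dlaw gam aL nL)).
case=> // n _; pose r : R := n.+1%:R^-1.
have aL' : apx setT (scale_fun r%:C L) by exact: apx_scale.
have nL' : nneg (scale_fun r%:C L) by apply: nneg_scale => //; rewrite invr_ge0.
have hU := cpoisson_dlaw (r *: gam) aL' nL'.
exists (dcdf (cpoisson (r *: gam) (scale_fun r%:C L))); split.
  by exists (dlaw_prob hU).
have [X [hX -> XE]] := convn_dcdf n gT hU.
apply: (dcdf_eq (apx_cpoisson gam aL)); first by case: hX.
have rn : r *+ n.+1 = 1 by rewrite -mulr_natr mulVf// pnatr_eq0.
move=> t; rewrite XE (cpoisson_echar _ t aL) (cpoisson_echar _ t aL') exprMn.
have -> : echar t (r *: gam) ^+ n.+1 = echar t gam.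
  by rewrite echarC -echarMn scalerMnl rn scale1r echarC.
rewrite -cexpMn; congr (_ * cexp _).
have -> : scale_fun r%:C L (echar t) - scale_fun r%:C L (echar 0) =
  r%:C * (L (echar t) - L (echar 0)) by rewrite /scale_fun mulrBr.
by rewrite -mulrnAl -rmorphMn/= rn mul1r.
Qed.

End nonnegative_functionals.

(** * Infinitely divisible characteristic functions *)

Section infinitely_divisible_characteristic_functions.
Variables (R : realType) (d : nat).
Local Notation C := R[i].
Local Notation nc := (@Normc.normc R).
Local Notation V := 'rV[R]_d.
Implicit Types (t u v w h : V) (P Q : probability V R).
Local Arguments Normc.normc : simpl never.

(** The squared modulus is real, nonnegative and again a characteristic function, so real roots and
    logarithms apply to it. *)
Definition sqmod P t : R := nc (charfun (mcdf P) t) ^+ 2.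

Definition cosdiff t (z : V * V) : R := cos (dotp t z.1 - dotp t z.2).

Lemma cosdiffE t : cosdiff t = (fun z => cos (dotp t z.1) * cos (dotp t z.2) +
  sin (dotp t z.1) * sin (dotp t z.2)).
Proof. by apply/funext => z; rewrite /cosdiff cosB. Qed.

Lemma measurable_cosdiff t : measurable_fun [set: V * V] (cosdiff t).
Proof.
rewrite cosdiffE.
have mc := measurable_cos_dotp t; have ms := measurable_sin_dotp t.
apply: measurable_funD; apply: measurable_funM.
- exact: (measurableT_comp mc).
- exact: (measurableT_comp mc).
- exact: (measurableT_comp ms).
- exact: (measurableT_comp ms).
Qed.

Lemma integrable_cosdiff P t :
  (P \x P)%E.-integrable [set: V * V] (EFin \o cosdiff t).
Proof.
apply: (@bounded_integrable _ _ _ _ _ 1); first exact: measurable_cosdiff.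
by move=> z; exact: cos_max.
Qed.

(* [|f|^2] is the characteristic function of the difference of two
   independent copies. *)
Lemma sqmodE P t : sqmod P t = \int[(P \x P)%E]_z cosdiff t z.
Proof.
have mc := measurable_cos_dotp t; have ms := measurable_sin_dotp t.
have c1 (x : V) : `|cos (dotp t x)| <= 1 by exact: cos_max.
have s1 (x : V) : `|sin (dotp t x)| <= 1 by exact: sin_max.
have bi (f : V -> R) : measurable_fun setT f -> (forall x, `|f x| <= 1) ->
    (P \x P)%E.-integrable [set: V * V] (EFin \o (fun z => f z.1 * f z.2)).
  move=> mf f1; apply: (@bounded_integrable _ _ _ _ (fun z => f z.1 * f z.2) 1).
    apply: measurable_funM; first exact: measurableT_comp.
    exact: measurableT_comp.
  by move=> z; rewrite normrM mulr_ile1.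
rewrite /sqmod charfun_mcdf nc_sqr/= cosdiffE.
rewrite RintegralD//; [|exact: (bi _ mc c1)|exact: (bi _ ms s1)].
have e1 := Rintegral_prodM P P mc mc c1 c1.
have e2 := Rintegral_prodM P P ms ms s1 s1.
by move: e1 e2; cbv beta => -> ->; rewrite !expr2.
Qed.

Lemma sqmod_ge0 P t : 0 <= sqmod P t.
Proof. by rewrite exprn_ge0// nc_ge0. Qed.

Lemma sqmod_le1 P t : sqmod P t <= 1.
Proof.
rewrite sqmodE (le_trans (ler_norm _))//; apply: Rintegral_norm_le => [|z].
  exact: measurable_cosdiff.
exact: cos_max.
Qed.

Lemma sqmod0 P : sqmod P 0 = 1.
Proof.
rewrite sqmodE.
have -> : cosdiff 0 = cst 1 by apply/funext => z; rewrite /cosdiff !dotp0l subrr cos0.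
rewrite Rintegral_cst//.
have -> := probability_setT (P \x P)%E : Measure.sort (P \x P)%E setT = 1%E.
by rewrite mulr1.
Qed.

Lemma cosdiffD t h z :
  cosdiff (t + h) z + cosdiff (t - h) z = 2 * (cosdiff t z * cosdiff h z).
Proof.
rewrite /cosdiff !dotpDl !dotpNl.
set a := dotp t z.1; set b := dotp t z.2; set x := dotp h z.1; set y := dotp h z.2.
have -> : a + x - (b + y) = (a - b) + (x - y) by ring.
have -> : a - x - (b - y) = (a - b) - (x - y) by ring.
by rewrite cosD [cos (_ - (x - y))]cosB; ring.
Qed.

(** The two sides of [|2 a b - 2 a| <= 2 (1 - b)], from [(1 - a) (1 - b) >= 0] and
    [(1 + a) (1 - b) >= 0], arranged so that only sums get integrated. *)
Lemma cos_second_difference_bounds (a b : R) : `|a| <= 1 -> `|b| <= 1 ->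
  a + a + (b + b) <= 2 * (a * b) + 2 /\ 2 * (a * b) + (b + b) <= a + a + 2.
Proof.
rewrite !ler_norml => /andP[a1 a2] /andP[b1 b2].
have h1 : 0 <= (1 - a) * (1 - b) by rewrite mulr_ge0// subr_ge0.
have h2 : 0 <= (1 + a) * (1 - b) by rewrite mulr_ge0// ?subr_ge0//; lra.
by split; lra.
Qed.

Lemma sqmod_second_difference P t h :
  `|sqmod P (t + h) + sqmod P (t - h) - 2 * sqmod P t| <= 2 * (1 - sqmod P h).
Proof.
have ik := integrable_cosdiff P; pose E (g : V * V -> R) := \int[(P \x P)%E]_z g z.
have mk := @measurable_cosdiff.
have bk t' z : `|cosdiff t' z| <= 1 by exact: cos_max.
have EB (g1 g2 : V * V -> R) (B1 B2 : R) : measurable_fun setT g1 ->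
    measurable_fun setT g2 -> (forall z, `|g1 z| <= B1) -> (forall z, `|g2 z| <= B2) ->
    (forall z, g1 z <= g2 z) -> E g1 <= E g2.
  move=> m1 m2 b1 b2 g12; apply: le_Rintegral => //.
    exact: bounded_integrable m1 b1.
  exact: bounded_integrable m2 b2.
have ED s1 s2 : E (fun z => cosdiff s1 z + cosdiff s2 z) = sqmod P s1 + sqmod P s2.
  by rewrite !sqmodE; apply: RintegralD => //; exact: ik.
have mD s1 s2 : measurable_fun setT (fun z => cosdiff s1 z + cosdiff s2 z).
  by apply: measurable_funD; exact: mk.
have bD s1 s2 z : `|cosdiff s1 z + cosdiff s2 z| <= 2.
  by rewrite (le_trans (ler_normD _ _))//; have := bk s1 z; have := bk s2 z; lra.
have iD s1 s2 := bounded_integrable (P \x P)%E (mD s1 s2) (bD s1 s2).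
have m2 : measurable_fun setT (fun z : V * V => cst 2 z : R) by [].
have i2 : (P \x P)%E.-integrable [set: V * V] (EFin \o (cst 2 : V * V -> R)).
  by apply: (@bounded_integrable _ _ _ _ _ 2) => // z; rewrite ger0_norm.
have E2 : E (cst 2) = 2.
  rewrite /E Rintegral_cst//.
  have -> := probability_setT (P \x P)%E : Measure.sort (P \x P)%E setT = 1%E.
  by rewrite mulr1.
have lo : sqmod P t + sqmod P t + (sqmod P h + sqmod P h) <=
    sqmod P (t + h) + sqmod P (t - h) + 2.
  rewrite -!ED -[X in _ <= _ + X]E2 /E.
  rewrite -(RintegralD measurableT (iD t t) (iD h h)).
  rewrite -(RintegralD measurableT (iD (t + h) (t - h)) i2).
  apply: (EB _ _ 4 4) => [||z|z|z].
  - exact: measurable_funD (mD t t) (mD h h).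
  - exact: measurable_funD (mD (t + h) (t - h)) m2.
  - by rewrite (le_trans (ler_normD _ _))//; have := bD t t z; have := bD h h z; lra.
  - rewrite (le_trans (ler_normD _ _))// [X in _ + X]ger0_norm//=.
    by have := bD (t + h) (t - h) z; lra.
  - by rewrite cosdiffD; have [] := cos_second_difference_bounds (bk t z) (bk h z).
have hi : sqmod P (t + h) + sqmod P (t - h) + (sqmod P h + sqmod P h) <=
    sqmod P t + sqmod P t + 2.
  rewrite -!ED -[X in _ <= _ + X]E2 /E.
  rewrite -(RintegralD measurableT (iD (t + h) (t - h)) (iD h h)).
  rewrite -(RintegralD measurableT (iD t t) i2).
  apply: (EB _ _ 4 4) => [||z|z|z].
  - exact: measurable_funD (mD (t + h) (t - h)) (mD h h).
  - exact: measurable_funD (mD t t) m2.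
  - rewrite (le_trans (ler_normD _ _))//.
    by have := bD (t + h) (t - h) z; have := bD h h z; lra.
  - rewrite (le_trans (ler_normD _ _))// [X in _ + X]ger0_norm//=.
    by have := bD t t z; lra.
  - by rewrite cosdiffD; have [] := cos_second_difference_bounds (bk t z) (bk h z).
move: lo hi; clear; rewrite ler_norml.
move: (sqmod P (t + h)) (sqmod P (t - h)) (sqmod P t) (sqmod P h) => a b c e lo hi.
by apply/andP; split; lra.
Qed.

Lemma convn_mcdf P n : exists Q, Defs.convn (mcdf P) n.+1 = mcdf Q /\
  forall t, charfun (mcdf Q) t = charfun (mcdf P) t ^+ n.+1.
Proof.
elim: n => [|n [Q [e h]]]; first by exists P; split => // t; rewrite expr1.
exists (conv_prob P Q); rewrite -conv_mcdf; split; first by rewrite -e.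
by move=> t; rewrite charfun_conv h -exprS.
Qed.

Lemma infinitely_divisible_roots P : infinitely_divisible (mcdf P) ->
  forall n, exists Q, forall t, sqmod P t = sqmod Q t ^+ n.+1.
Proof.
move=> [_ h] n; have [_ [[Q ->] e]] := h n.+1 isT.
have [Q' [eQ' hQ']] := convn_mcdf Q n.
exists Q => t; rewrite /sqmod e eQ' hQ' ncX exprAC.
by rewrite -!exprM mulnC.
Qed.

(** For a root [Q], the second-difference bound at [t = h] reads [sqmod Q (2 h) >= 4 sqmod Q h - 3],
    which is positive once [sqmod Q h > 3 / 4]; a root of high order achieves that. *)
Lemma sqmod_double P h : infinitely_divisible (mcdf P) ->
  0 < sqmod P h -> 0 < sqmod P (h + h).
Proof.
move=> hP ph.
have x01 : 0 <= (3 / 4 : R) < 1 by apply/andP; split; lra.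
have e0 : 0 < sqmod P h / 2 by rewrite divr_gt0.
have [n0 hn0] := geometric_small ler01 x01 e0.
have [Q hQ] := infinitely_divisible_roots hP n0.
have q34 : 3 / 4 < sqmod Q h.
  rewrite ltNge; apply/negP => q; have := hn0 n0.+1 (leqnSn _).
  rewrite mul1r; have : sqmod P h <= (3 / 4) ^+ n0.+1.
    by rewrite hQ; apply: lerXn2r; rewrite ?nnegrE ?sqmod_ge0//; lra.
  by lra.
rewrite hQ exprn_gt0//.
have := sqmod_second_difference Q h h; rewrite subrr sqmod0 ler_norml => /andP[k1 k2].
by lra.
Qed.

(** Continuity at 0 by dominated convergence, along [h / 2^n] only: [sqmod_double] then climbs back
    to [h]. *)
Lemma sqmod_near0 P h : exists n, 0 < sqmod P ((2 ^- n : R) *: h).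
Proof.
pose f_ n (z : V * V) := (cosdiff ((2 ^- n : R) *: h) z)%:E.
have cv (z : V * V) : f_ ^~ z @ \oo --> (1 : R)%:E.
  have c2 : (fun n => (2^-1 : R) ^+ n) @ \oo --> (0 : R).
    apply: cvg_expr; rewrite ger0_norm//; lra.
  have : (fun n => cos ((2^-1 : R) ^+ n * (dotp h z.1 - dotp h z.2))) @ \oo --> (1 : R).
    have c3 : (fun n => (2^-1 : R) ^+ n * (dotp h z.1 - dotp h z.2)) @ \oo --> (0 : R).
      by rewrite -(mul0r (dotp h z.1 - dotp h z.2)); apply: cvgMl.
    have := @continuous_cos R 0; rewrite /continuous_at cos0 => cc.
    exact: cvg_comp c3 cc.
  move=> c4; apply: cvg_EFin; first by near=> n.
  apply: cvg_trans c4; apply: near_eq_cvg; near=> n.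
  by rewrite /f_ /cosdiff/= !dotpZl exprVn; congr cos; ring.
have fg n z : (`|f_ n z| <= (1 : R)%:E)%E by rewrite /f_ abse_EFin lee_fin cos_max.
have [_ _] := @dominated_convergence _ _ R (P \x P)%E setT measurableT f_ (cst 1%:E)
  (cst 1%:E) (fun n => ltac:(apply/measurable_EFinP; exact: measurable_cosdiff))
  (measurable_cst _) (aeW _ (fun z _ => cv z))
  (@bounded_integrable _ _ _ (P \x P)%E (cst 1) 1 (measurable_cst _) (fun z => ltac:(by rewrite normr1)))
  (aeW _ (fun z n _ => fg n z)).
rewrite integral_cst// mul1e.
have -> := probability_setT (P \x P)%E : Measure.sort (P \x P)%E setT = 1%E.
move=> /fine_cvgP[_] /cvgrPdist_lt /(_ 1 ltr01)[n _ hn].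
exists n; have := hn n (leqnn n); rewrite /= => k.
have : `|1 - sqmod P ((2 ^- n : R) *: h)| < 1 by rewrite sqmodE.
by rewrite ltr_norml => /andP[_]; lra.
Unshelve. all: by end_near.
Qed.

Lemma sqmod_gt0 P h : infinitely_divisible (mcdf P) -> 0 < sqmod P h.
Proof.
move=> hP; have [n] := sqmod_near0 P h.
have dbl m : (2 ^- m : R) *: h = (2 ^- m.+1 : R) *: h + (2 ^- m.+1 : R) *: h.
  by rewrite -scalerDl exprS; congr (_ *: _); field; rewrite expf_neq0.
elim: n => [|n IH]; first by rewrite expr0 invr1 scale1r.
by move=> k; apply: IH; rewrite dbl; exact: sqmod_double.
Qed.

(** Quantitative form of [N (a^(1/N) - 1) -> ln a] for [a = x^N]: with [y = ln x <= 0] one has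
    [y <= exp y - 1 <= y + y^2]. *)
Lemma root_bounds (x : R) n : 0 < x -> x <= 1 ->
  ln (x ^+ n.+1) <= n.+1%:R * (x - 1) /\
  n.+1%:R * (x - 1) <= ln (x ^+ n.+1) + ln (x ^+ n.+1) ^+ 2 / n.+1%:R.
Proof.
move=> x0 x1; rewrite lnXn// -[ln x *+ _]mulr_natl.
set N := n.+1%:R; have N0 : 0 < N by rewrite ltr0n.
set y := ln x; have y0 : y <= 0 by exact: ln_le0.
have ey : expR y = x by rewrite lnK.
split.
  rewrite ler_wpM2l ?(ltW N0)//; have := expR_ge1Dx y; rewrite ey; lra.
have -> : N * y + (N * y) ^+ 2 / N = N * (y + y ^+ 2) by field; rewrite gt_eqF.
rewrite ler_wpM2l ?(ltW N0)//.
have := expR_ge1Dx (- y); rewrite expRN ey => h.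
have y1 : 0 < 1 - y by lra.
have hx : x * (1 - y) <= 1.
  by rewrite -[leRHS](@divff _ x) ?gt_eqF// ler_wpM2l ?(ltW x0)//; lra.
have : (x - 1 - y - y ^+ 2) * (1 - y) <= 0.
  have -> : (x - 1 - y - y ^+ 2) * (1 - y) = (x * (1 - y) - 1) + y ^+ 2 * y by ring.
  have : y ^+ 2 * y <= 0 by rewrite mulr_ge0_le0// sqr_ge0.
  lra.
rewrite pmulr_lle0//; lra.
Qed.

Lemma archimedean_le (a b K : R) : 0 <= K -> (forall n, a <= b + K / n.+1%:R) -> a <= b.
Proof.
move=> K0 h; apply/ler_addgt0Pr => e e0.
have /andP[_ hn] := truncn_itv (divr_ge0 K0 (ltW e0)).
apply: le_trans (h (Num.truncn (K / e))) _; rewrite lerD2l.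
by rewrite ler_pdivrMr ?ltr0n// mulrC -ler_pdivrMr// ltW.
Qed.

Lemma second_difference_bounds (X Y Z W A B D x y z w : R) :
  X <= x <= X + A -> Y <= y <= Y + B -> Z <= z <= Z + D -> W <= w ->
  `|x + y - 2 * z| <= - (2 * w) ->
  2 * Z + 2 * W <= X + Y + (A + B) /\ X + Y + 2 * W <= 2 * Z + (D + D).
Proof.
move=> /andP[x1 x2] /andP[y1 y2] /andP[z1 z2] w1.
by rewrite ler_norml => /andP[k1 k2]; split; lra.
Qed.

Lemma ln_sqmod_difference P t h : infinitely_divisible (mcdf P) ->
  let l s := ln (sqmod P s) in
  2 * l t + 2 * l h <= l (t + h) + l (t - h) /\
  l (t + h) + l (t - h) + 2 * l h <= 2 * l t.
Proof.
move=> hP l.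
(* With [q] the [N]-th root of [sqmod P], [N = n + 1], the witnesses are the values of [N (q - 1)]
   at the four points; the excess over the logarithms is [O(1 / N)] and is removed by
   [archimedean_le]. *)
have main n : exists x y z w : R, [/\
   l (t + h) <= x <= l (t + h) + l (t + h) ^+ 2 / n.+1%:R,
   l (t - h) <= y <= l (t - h) + l (t - h) ^+ 2 / n.+1%:R,
   l t <= z <= l t + l t ^+ 2 / n.+1%:R,
   l h <= w & `|x + y - 2 * z| <= - (2 * w)].
  have [Q hQ] := infinitely_divisible_roots hP n.
  have Q0 s : 0 < sqmod Q s.
    rewrite lt_def sqmod_ge0 andbT; apply/eqP => q0.
    by have := sqmod_gt0 s hP; rewrite hQ q0 expr0n/= ltxx.
  have rb s : l s <= n.+1%:R * (sqmod Q s - 1) <= l s + l s ^+ 2 / n.+1%:R.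
    by rewrite /l hQ; have [-> ->] := root_bounds n (Q0 s) (sqmod_le1 Q s).
  exists (n.+1%:R * (sqmod Q (t + h) - 1)), (n.+1%:R * (sqmod Q (t - h) - 1)),
    (n.+1%:R * (sqmod Q t - 1)), (n.+1%:R * (sqmod Q h - 1)); split => //.
    by have /andP[] := rb h.
  have := sqmod_second_difference Q t h.
  rewrite -(@ler_pM2l _ (n.+1%:R : R)) ?ltr0n// -[X in X * `|_|](@ger0_norm _ n.+1%:R) ?ler0n//.
  rewrite -normrM.
  set a := sqmod Q _; set b := sqmod Q _; set c := sqmod Q _; set e := sqmod Q _.
  have -> : n.+1%:R * (a + b - 2 * c) = n.+1%:R * (a - 1) + n.+1%:R * (b - 1) -
      2 * (n.+1%:R * (c - 1)) by ring.
  by have -> : - (2 * (n.+1%:R * (e - 1))) = n.+1%:R * (2 * (1 - e)) by ring.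
split.
  apply: (@archimedean_le _ _ (l (t + h) ^+ 2 + l (t - h) ^+ 2)) => [|n].
    by rewrite addr_ge0 ?sqr_ge0.
  have [x [y [z [w [hx hy hz hw hd]]]]] := main n.
  rewrite [X in _ <= _ + X]mulrDl; exact: (second_difference_bounds hx hy hz hw hd).1.
apply: (@archimedean_le _ _ (l t ^+ 2 + l t ^+ 2)) => [|n].
  by rewrite addr_ge0 ?sqr_ge0.
have [x [y [z [w [hx hy hz hw hd]]]]] := main n.
rewrite [X in _ <= _ + X]mulrDl; exact: (second_difference_bounds hx hy hz hw hd).2.
Qed.

(** The lower bound for [l1] minus the upper bound for [l2]; what is lost depends on the step [k]
    only. *)
Lemma second_difference_quotient (l l1 l2 : V -> R) t k :
  (forall s, l1 s = l s + l2 s) ->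
  2 * l1 t + 2 * l1 k <= l1 (t + k) + l1 (t - k) ->
  l2 (t + k) + l2 (t - k) + 2 * l2 k <= 2 * l2 t ->
  2 * l t + (2 * l1 k + 2 * l2 k) <= l (t + k) + l (t - k).
Proof.
move=> e; rewrite !e.
move: (l t) (l2 t) (l k) (l2 k) (l (t + k)) (l2 (t + k)) (l (t - k)) (l2 (t - k)).
by move=> *; lra.
Qed.

Lemma lower_bound_of_sum (r K a b m S : R) : 2 * r + K <= a + b -> b <= 0 ->
  m <= r -> - (2 * m + K) <= S -> - S <= a.
Proof. by move=> *; lra. Qed.

(* On the finite set of shifts [k] the second difference of [ln |f|^2] is
   bounded below; a shift by some [k] brings any [t] to a point where [|f|]
   is at least [1/2]. *)
Lemma quasi_infinitely_divisible_bound M (U : (V -> C) -> C) P :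
  apx M U -> (forall t, charfun (mcdf P) t = U (echar t)) ->
  quasi_infinitely_divisible (mcdf P) ->
  exists2 c, 0 < c & forall t, c <= nc (charfun (mcdf P) t).
Proof.
move=> aU hU [_ [F1 [F2 [id1 id2 F12]]]].
have [[P1 e1] _] := id1; have [[P2 e2] _] := id2.
rewrite e1 e2 in id1 id2 F12.
have mul t : sqmod P1 t = sqmod P t * sqmod P2 t.
  by rewrite /sqmod F12 charfun_conv ncM exprMn.
have g1 t := sqmod_gt0 t id1; have g2 t := sqmod_gt0 t id2.
have g t : 0 < sqmod P t by rewrite -(pmulr_lgt0 _ (g2 t)) -mul.
have lnm t : ln (sqmod P1 t) = ln (sqmod P t) + ln (sqmod P2 t).
  by rewrite mul lnM// posrE.
pose K k := 2 * ln (sqmod P1 k) + 2 * ln (sqmod P2 k).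
have low t k : 2 * ln (sqmod P t) + K k <= ln (sqmod P (t + k)) + ln (sqmod P (t - k)).
  apply: (@second_difference_quotient (fun s => ln (sqmod P s))
    (fun s => ln (sqmod P1 s)) (fun s => ln (sqmod P2 s)) t k lnm).
    exact: (ln_sqmod_difference t k id1).1.
  exact: (ln_sqmod_difference t k id2).2.
have h2 : 0 < 1 / 2 :> R by lra.
have [H hH] := transl_almost_period aU h2.
pose S := \sum_(k <- H) `|2 * ln (1 / 4) + K k|.
exists (expR (- S)); first exact: expR_gt0.
move=> t; have [k kH hk] := hH t.
(* [t - k] is a [1 / 2]-almost period and [f 0 = 1], so [|f (t - k)| >= 1 / 2]. *)
have q : 1 / 4 <= sqmod P (t - k).
  have := nle_echar 0 hk; rewrite /add_fun /scale_fun mulN1r transl_echar add0r -!hU.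
  have f0 : charfun (mcdf P) 0 = 1.
    rewrite charfun_mcdf.
    have -> : (fun x : V => cos (dotp 0 x)) = cst 1.
      by apply/funext => x; rewrite dotp0l cos0.
    have -> : (fun x : V => sin (dotp 0 x)) = cst 0.
      by apply/funext => x; rewrite dotp0l sin0.
    rewrite !Rintegral_cst// mul0r.
    by have -> := probability_setT P : Measure.sort P setT = 1%E; rewrite mulr1.
  rewrite f0 => k1; have := ncB_ge 1 (charfun (mcdf P) (t - k)).
  rewrite nc1 ncC => k2; rewrite /sqmod.
  have k3 : 1 / 2 <= nc (charfun (mcdf P) (t - k)) by lra.
  have -> : 1 / 4 = (1 / 2) ^+ 2 :> R by field.
  by apply: lerXn2r; rewrite ?nnegrE ?nc_ge0//; lra.
have := low (t - k) k; rewrite subrK.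
have l1 : ln (sqmod P (t - k - k)) <= 0 by exact: ln_le0 (sqmod_le1 _ _).
have l2 : ln (1 / 4) <= ln (sqmod P (t - k)) by rewrite ler_ln ?posrE//; lra.
have l3 : - (2 * ln (1 / 4) + K k) <= S.
  rewrite (le_trans (ler_norm _))// normrN /S (big_rem k)//= lerDl.
  by rewrite sumr_ge0.
move=> l4; have l5 : - S <= ln (sqmod P t).
  exact: lower_bound_of_sum l4 l1 l2 l3.
have l6 : expR (- S) <= sqmod P t by rewrite -(@lnK _ (sqmod P t)) ?ler_expR// posrE.
(* As [|f| <= 1], a lower bound for [|f|^2] is one for [|f|]. *)
apply: le_trans l6 _; rewrite /sqmod expr2 ler_piMl ?nc_ge0//.
by rewrite -(@ler_pXn2r _ 2) ?nnegrE ?nc_ge0// expr1n; exact: sqmod_le1.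
Qed.

End infinitely_divisible_characteristic_functions.

(** * The discrete distribution function *)

Section integer_span.
Variables (R : realType) (d : nat).
Local Notation V := 'rV[R]_d.
Implicit Types (Y : set V).

Lemma coord_zspan_mem Y y j : Y y -> coord_zspan Y j (y ord0 j).
Proof.
move=> Yy; exists 0%N, (fun=> 1), (fun=> y); split => //.
by rewrite big_ord1 mul1r.
Qed.

Lemma zspan_mem Y y : Y y -> zspan Y y.
Proof. by move=> Yy j; exact: coord_zspan_mem. Qed.

Lemma coord_zspanD Y j a b :
  coord_zspan Y j a -> coord_zspan Y j b -> coord_zspan Y j (a + b).
Proof.
move=> [n [z [y [Yy ->]]]] [n' [z' [y' [Yy' ->]]]].
exists (n + n'.+1)%N.
exists (fun k : 'I_(n.+1 + n'.+1) => match fintype.split k with inl i => z i | inr i => z' i end).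
exists (fun k : 'I_(n.+1 + n'.+1) => match fintype.split k with inl i => y i | inr i => y' i end).
split; first by move=> k; case: (@fintype.split n.+1 n'.+1 k).
rewrite (@big_split_ord _ _ _ n.+1 n'.+1)/=; congr (_ + _); apply: eq_bigr => i _.
  by rewrite (unsplitK (inl i)).
by rewrite (unsplitK (inr i)).
Qed.

(** Combinations have at least one term, so even [0] needs an element of [Y], taken with coefficient
    0. *)
Lemma subgroup_zspan Y : Y !=set0 -> subgroup (zspan Y).
Proof.
move=> [y0 Yy0]; split.
- move=> j; exists 0%N, (fun=> 0), (fun=> y0); split => //.
  by rewrite big_ord1 mul0r mxE.
- by move=> u v hu hv j; rewrite mxE; exact: coord_zspanD.
- move=> u hu j; have [n [z [y [Yy e]]]] := hu j.
  exists n, (fun k => - z k), y; split => //; rewrite mxE e -sumrN.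
  by apply: eq_bigr => k _; rewrite rmorphN mulNr.
Qed.

End integer_span.

(** * The law with atoms [x k] and weights [p k] *)

Section discrete_law.
Variables (R : realType) (d : nat) (x : nat -> 'rV[R]_d) (p : nat -> R)
  (F : 'rV[R]_d -> R).
Hypotheses (p_ge0 : forall k, 0 <= p k)
  (p_sum1 : (\sum_(0 <= k <oo) (p k)%:E = 1)%E)
  (F_def : forall z : 'rV[R]_d,
     ((F z)%:E = \sum_(0 <= k <oo | x k \in orthant z) (p k)%:E)%E).
Local Notation C := R[i].
Local Notation nc := (@Normc.normc R).
Local Notation V := 'rV[R]_d.
Local Notation functional := ((V -> C) -> C).
Local Notation X := [set x k | k in [set k : nat | 0 < p k]].

Definition atom_fun : functional := fun phi => csum setT (fun k => (p k)%:C * phi (x k)).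

Lemma esum_weights : (\esum_(k in [set: nat]) (p k)%:E = 1)%E.
Proof. by rewrite -p_sum1 nneseries_esumT// => k; rewrite lee_fin. Qed.

Lemma nnsummable_weights : nnsummable setT (fun k => nc (p k)%:C).
Proof.
split; first by move=> k _; exact: nc_ge0.
under eq_esum do rewrite ncR ger0_norm//.
by rewrite esum_weights ltry.
Qed.

Lemma support_neq0 : X !=set0.
Proof.
apply: contrapT => h; have p0 k : p k = 0.
  apply/eqP; rewrite eq_le p_ge0 andbT leNgt; apply/negP => pk; apply: h.
  by exists (x k), k.
have := esum_weights; rewrite esum1 => [|k _]; last by rewrite p0.
by move=> /eqP; rewrite eq_sym onee_eq0.
Qed.

Lemma apx_atom : apx (zspan X) atom_fun.
Proof.
apply: (apx_csum (F := fun k => scale_fun (p k)%:C (delta_fun (x k))) nnsummable_weights).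
  move=> k _; have [pk|pk] := ltP 0 (p k).
    by apply: apx_scale; apply: apx_delta; apply: zspan_mem; exists k.
  (* An atom of weight 0 may lie outside [zspan X]; its term is the zero functional, rewritten as a
     null multiple of the point mass at 0. *)
  have -> : p k = 0 by apply/eqP; rewrite eq_le pk p_ge0.
  have [M0 _ _] := subgroup_zspan support_neq0.
  apply: (apx_ext (apx_scale 0 (apx_delta M0))) => phi B _.
  by rewrite /scale_fun !mul0r.
by move=> k _; have := nle_scale (p k)%:C (nle_delta (x k)); rewrite mulr1.
Qed.

Lemma csum_real (T : choiceType) (A : set T) (g : T -> R) :
  (forall k, A k -> 0 <= g k) ->
  csum A (fun k => (g k)%:C) = (fine (\esum_(k in A) (g k)%:E)%E)%:C.
Proof.
move=> g0; apply: complexP; rewrite /csum /=; first by rewrite rsum_ge0.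
rewrite (rsum_ge0 (g := fun=> 0))// (_ : (\esum_(k in A) _)%E = 0%:E)//.
exact: esum1.
Qed.

Lemma is_dlaw_atom : is_dlaw (zspan X) atom_fun.
Proof.
split; first exact: apx_atom.
  apply: (nneg_csum (F := fun k => scale_fun (p k)%:C (delta_fun (x k)))) => k _.
  by apply: nneg_scale => //; exact: nneg_delta.
rewrite /atom_fun; under eq_fun do rewrite mulr1.
by rewrite csum_real// esum_weights.
Qed.

Lemma dcdf_atom : F = dcdf atom_fun.
Proof.
apply/funext => z; apply: EFin_inj; rewrite F_def nneseries_esum; last first.
  by move=> k _; rewrite lee_fin.
rewrite /dcdf /atom_fun /indS.
under [in RHS]eq_fun do rewrite -rmorphM.
rewrite csum_real/=; last by move=> k _; rewrite mulr_ge0.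
rewrite fineK.
  rewrite [LHS]esum_mkcond; apply: eq_esum => k _.
  rewrite (_ : (k \in [set k | x k \in orthant z]) = (x k \in orthant z)); last first.
    by apply/idP/idP => [/set_mem//|h]; exact: mem_set.
  by case: ifP; rewrite ?mulr1 ?mulr0.
rewrite ge0_fin_numE; last by apply: esum_ge0 => k _; rewrite lee_fin mulr_ge0.
apply: (@le_lt_trans _ _ 1%E); last by rewrite ltry.
rewrite -esum_weights; apply: le_esum => k _; rewrite lee_fin ler_piMr//.
by case: (_ \in _).
Qed.

Local Notation f t := (charfun F t).

Lemma charfun_atom t : f t = atom_fun (echar t).
Proof. by rewrite dcdf_atom (dcdf_mcdf is_dlaw_atom) charfun_dlaw. Qed.

Lemma atom_echar0 : atom_fun (echar 0) = 1.
Proof.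
have [_ _ <-] := is_dlaw_atom; congr atom_fun.
by apply/funext => u; rewrite echar0l.
Qed.

Lemma atom_le1 t : nc (atom_fun (echar t)) <= 1.
Proof.
apply: (csum_le nnsummable_weights) => [D uD DA|k _]; last first.
  by rewrite ncM nc_echar mulr1.
rewrite -lee_fin; apply: le_trans (sum_le_esum _ uD DA) _.
under eq_esum do rewrite ncR ger0_norm//.
by rewrite esum_weights.
Qed.

Lemma atom_conj t : atom_fun (echar (- t)) = (atom_fun (echar t))^*%C.
Proof.
rewrite /atom_fun -(csum_conj nnsummable_weights).
  congr csum; apply/funext => k; rewrite conjM echarN echar_conj; congr (_ * _).
  by apply: complexP => //=; rewrite oppr0.
by move=> k _; rewrite ncM nc_echar mulr1.
Qed.

Lemma exp_representation_atom c : 0 < c -> (forall t, c <= nc (f t)) ->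
  exists (lam : V -> R) (gam : V),
  [/\ nnsummable (zspan X `\ 0) (fun u => `|lam u|), zspan X gam &
  forall t, f t = cexp ((dotp t gam) *i + csum (zspan X `\ 0)
    (fun u => (lam u)%:C * (cexp ((dotp t u) *i) - 1)))].
Proof.
move=> c0 hc; have Mg := subgroup_zspan support_neq0.
have hb t : c <= nc (atom_fun (echar t)) <= 1.
  by rewrite atom_le1 andbT -charfun_atom hc.
have [lam [gam [h1 h2 h3]]] :=
  real_exp_representation Mg apx_atom c0 atom_echar0 atom_conj hb.
by exists lam, gam; split => // t; rewrite charfun_atom h3.
Qed.

(* [F] is the deconvolution of the compound Poisson laws built from the
   positive and the negative part of [lam]. *)
Lemma quasi_infinitely_divisible_atom (A : set V) (lam : V -> R) (gam : V) :
  nnsummable A (fun u => `|lam u|) ->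
  (forall t, f t = cexp ((dotp t gam) *i + csum A
    (fun u => (lam u)%:C * (cexp ((dotp t u) *i) - 1)))) ->
  quasi_infinitely_divisible F.
Proof.
move=> lS hf.
have gT : subgroup [set: V] by [].
pose lp u : C := (Num.max (lam u) 0)%:C; pose lm u : C := (Num.max (- lam u) 0)%:C.
have [B [B0 hB]] := nnsummable_bound lS.
have sub (l : V -> C) : (forall u, nc (l u) <= `|lam u|) -> nnsummable A (fun u => nc (l u)).
  move=> hl; apply: (@nnsummable_le_seq _ _ _ _ B) => [u _|D uD DA]; first exact: nc_ge0.
  by apply: le_trans (hB _ uD DA); apply: ler_sum => u _; exact: hl.
have m0 (a : R) : 0 <= Num.max a 0 by rewrite le_max lexx orbT.
have pS : nnsummable A (fun u => nc (lp u)).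
  by apply: sub => u; rewrite ncR ger0_norm// ge_max normr_ge0 ler_norm.
have mS : nnsummable A (fun u => nc (lm u)).
  by apply: sub => u; rewrite ncR ger0_norm// ge_max normr_ge0 -normrN ler_norm.
have AT : A `<=` setT by [].
pose L1 := coef_fun A lp; pose L2 := coef_fun A lm.
have a1 : apx setT L1 := apx_coef_fun AT pS.
have a2 : apx setT L2 := apx_coef_fun AT mS.
have nn (l : V -> R) : (forall u, 0 <= l u) -> nneg (coef_fun A (fun u => (l u)%:C)).
  move=> l0; apply: (nneg_csum (F := fun u => scale_fun (l u)%:C (delta_fun u))) => u _.
  by apply: nneg_scale => //; exact: nneg_delta.
have n1 : nneg L1 by apply: nn => u.
have n2 : nneg L2 by apply: nn => u.
(* The support is enlarged to the whole space, where the compound Poisson laws live. *)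
have hU : is_dlaw setT atom_fun.
  have [h1 h2 h3] := is_dlaw_atom; split => // e /h1[s _ hs].
  by exists s.
have [aU _ _] := hU.
have c1 := cpoisson_dlaw gam a1 n1; have c2 := cpoisson_dlaw 0 a2 n2.
split; first by exists (dlaw_prob hU); rewrite dcdf_atom.
(* The whole shift [gam] goes to [F1]; on transforms the claim is then [f] times that of [F2] equals
   that of [F1]. *)
exists (dcdf (cpoisson gam L1)), (dcdf (cpoisson 0 L2)); split.
- exact: infinitely_divisible_cpoisson.
- exact: infinitely_divisible_cpoisson.
rewrite [in RHS]dcdf_atom (conv_dcdf gT hU c2).
apply: (dcdf_eq (apx_cpoisson gam a1)); first exact: apx_conv (apx_cpoisson 0 a2) aU.
move=> t; rewrite (conv_echar _ (apx_cpoisson 0 a2) aU).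
rewrite (cpoisson_echar gam t a1) (cpoisson_echar 0 t a2) echar0r mul1r.
have mulCA (a b c e : C) : b = c * e -> a * b = c * (a * e) by move=> ->; ring.
rewrite -charfun_atom hf (cexpD ((dotp t gam) *i)) -/(echar t gam); apply: mulCA.
rewrite -cexpD; congr cexp.
have bt := bnd_echar t; have b0 := @bnd_echar R d 0.
rewrite -(apxBr a1 bt b0) -(apxBr a2 bt b0).
have bE u : nc (echar t u - echar 0 u) <= 2.
  by rewrite (le_trans (ncB _ _))// !nc_echar.
have dS (l : V -> C) : nnsummable A (fun u => nc (l u)) ->
    nnsummable A (fun u => nc (l u) * 2).
  move=> hl; have [K [K0 hK]] := nnsummable_bound hl.
  apply: (@nnsummable_le_seq _ _ _ _ (K * 2)) => [u _|D uD DA].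
    by rewrite mulr_ge0// nc_ge0.
  by rewrite -mulr_suml ler_wpM2r// hK.
have -> : csum A (fun u => (lam u)%:C * (cexp ((dotp t u) *i) - 1)) =
    L1 (fun u => echar t u - echar 0 u) - L2 (fun u => echar t u - echar 0 u).
  rewrite /L1 /L2 /coef_fun -(csumB (dS _ pS) (dS _ mS)).
  - congr csum; apply/funext => u; rewrite echar0l -mulrBl; congr (_ * _).
    rewrite /lp /lm -rmorphB/=; congr (_%:C); rewrite /Num.max.
    by case: ltP => k1; case: ltP => k2; lra.
  - by move=> u _; rewrite ncM ler_wpM2l ?nc_ge0.
  - by move=> u _; rewrite ncM ler_wpM2l ?nc_ge0.
by rewrite addrCA subrr addr0.
Qed.

Lemma charfun_bound_atom : quasi_infinitely_divisible F ->
  exists2 c, 0 < c & forall t, c <= nc (f t).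
Proof.
rewrite dcdf_atom (dcdf_mcdf is_dlaw_atom).
apply: (quasi_infinitely_divisible_bound apx_atom) => t.
exact: charfun_dlaw.
Qed.

End discrete_law.

Theorem theorem3 (R : realType) (d : nat) (hd : (0 < d)%N)
    (x : nat -> 'rV[R]_d) (p : nat -> R) (F : 'rV[R]_d -> R)
    (x_inj : injective x)
    (p_ge0 : forall k, 0 <= p k)
    (p_sum1 : (\sum_(0 <= k <oo) (p k)%:E = 1)%E)
    (F_def : forall z : 'rV[R]_d,
       ((F z)%:E = \sum_(0 <= k <oo | x k \in orthant z) (p k)%:E)%E) :
  let f := charfun F in
  let X := [set x k | k in [set k : nat | 0 < p k]] in
  let a := quasi_infinitely_divisible F in
  let b := 0 < inf [set Normc.normc (f t) | t in [set: 'rV[R]_d]] in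
  (a <-> b) /\
  (a \/ b ->
   X !=set0 /\
   exists (gamma : 'rV[R]_d) (lambda : 'rV[R]_d -> R),
     [/\ zspan X gamma,
         summable (zspan X `\ 0) (fun u => (lambda u)%:E) &
         forall t : 'rV[R]_d,
           f t = cexp ((dotp t gamma)*i +
                       csum (zspan X `\ 0)
                         (fun u => (lambda u)%:C *
                                   (cexp ((dotp t u)*i) - 1)))]).
Proof.
move=> f X a b.
have bP c : 0 < c -> (forall t, c <= Normc.normc (f t)) -> b.
  move=> c0 hc; rewrite /b; apply: lt_le_trans c0 _; apply: lb_le_inf.
    by exists (Normc.normc (f 0)), 0.
  by move=> _ [t _ <-]; exact: hc.
have ab : a -> b.
  by move=> /(charfun_bound_atom p_ge0 p_sum1 F_def)[c c0 hc]; exact: bP hc.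
have rep : b -> exists (lam : 'rV[R]_d -> R) (gam : 'rV[R]_d),
    [/\ nnsummable (zspan X `\ 0) (fun u => `|lam u|), zspan X gam &
    forall t, f t = cexp ((dotp t gam) *i + csum (zspan X `\ 0)
      (fun u => (lam u)%:C * (cexp ((dotp t u) *i) - 1)))].
  move=> b0; apply: (exp_representation_atom p_ge0 p_sum1 F_def b0) => t.
  apply: inf_lbound; last by exists t.
  by exists 0 => _ [s _ <-]; exact: nc_ge0.
have ba : b -> a.
  move=> /rep[lam [gam [h1 h2 h3]]].
  exact: (quasi_infinitely_divisible_atom p_ge0 p_sum1 F_def h1 h3).
split; first by split.
move=> h; have b0 : b by case: h => [/ab|].
split; first exact: support_neq0 p_ge0 p_sum1.
have [lam [gam [[_ h1] h2 h3]]] := rep b0.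
by exists gam, lam; split.
Qed.
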